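(* Let $w:I\to(0,\infty)$ be a decreasing weight on $I=(0,a)$, $0<a\le\infty$, with $W(t)=\int_0^t w\,dm<\infty$ for all $t\in I$. Let $b=\int_I w\,dm\in(0,\infty]$, $J=(0,b)$, and let $E$ be a fully symmetric Banach function space on $J$ with support $J$. For $f\in L^0(I)$ we have $$\sup\left\{\int_I|fg|\,dm:\ g\in\Lambda_{E,w},\ \|g\|_{\Lambda_{E,w}}\le1\right\}=\begin{cases}\|f^0\|_{M_{E',w}}&\text{if } f^0\in M_{E',w},\\ \infty&\text{otherwise,}\end{cases}$$ where $f^0$ is the level function of $f$ with respect to $w$. Consequently $\|f\|_{(\Lambda_{E,w})'}=\|f^0\|_{M_{E',w}}=\|f\|_{Q_{E',w}}$ for every $f\in(\Lambda_{E,w})'$.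
   Context: $m$ is Lebesgue measure; functions are identified when equal a.e.; ''decreasing'' means non-increasing. $L^0(I)$ is the space of real Lebesgue measurable functions on $I$. For a measure $\mu$ and a $\mu$-measurable $f$ on $\Omega$, $d_f^\mu(s)=\mu\{|f|>s\}$ and $f^{*,\mu}(t)=\inf\{s>0:d_f^\mu(s)\le t\}$ for $0\le t<\mu(\Omega)$; $f^*$ is the rearrangement for $\mu=m$, and $f^{*,w}$ the rearrangement with respect to the measure $w\,dm$ on $I$, a function on $J$. For functions on the same interval ($I$ or $J$), $f\prec g$ means $\int_0^x f^*\,dm\le\int_0^x g^*\,dm$ for all $x$ in the interval. A Banach function space on an interval is a solid linear subspace $E$ of $L^0$ with full support, complete under a monotone norm ($|f|\le|g|$ a.e. implies $\|f\|_E\le\|g\|_E$). It is fully symmetric if equimeasurable functions have equal norms and $f\prec g$, $f\in L^0$, $g\in E$ imply $f\in E$ and $\|f\|_E\le\|g\|_E$. ''Support $J$'' means $\chi_A\in E$ whenever $m(A)<\infty$. The Köthe dual $F'$ of a Banach function space $F$ (on $J$ or $I$, Lebesgue measure) is the set of measurable $f$ with $\|f\|_{F'}=\sup\{\int|fg|\,dm:\|g\|_F\le1\}<\infty$. For a fully symmetric space $F$ on $J$: $F_w=\{f\in L^0(I):f^{*,w}\in F\}$, $\|f\|_{F_w}=\|f^{*,w}\|_F$; $\Lambda_{F,w}=\{f\in L^0(I):f^*\in F_w\}$, $\|f\|_{\Lambda_{F,w}}=\|f^*\|_{F_w}$; $M_{F,w}=\{f\in L^0(I): f^*/w\in F_w\}$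 with gauge $\|f\|_{M_{F,w}}=\|f^*/w\|_{F_w}$. $Q_{F,w}$ is the set of $f\in L^0(I)$ such that $f\prec g$ for some $g\in M_{F,w}$, with norm $\|f\|_{Q_{F,w}}=\inf\{\|g\|_{M_{F,w}}: f\prec g\}$. Level function (Halperin). For $f\in L^0(I)$ with $f^*$ finite and integrable on the finite intervals $(0,t)$, $t\in I$, and $0\le\alpha<\beta<\infty$, $(\alpha,\beta)\subset I$, put $W(\alpha,\beta)=\int_\alpha^\beta w\,dm$, $F(\alpha,\beta)=\int_\alpha^\beta f^*\,dm$, $R(\alpha,\beta)=F(\alpha,\beta)/W(\alpha,\beta)$, and, if $a=\infty$, $R(\alpha,\infty)=\limsup_{t\to\infty}R(\alpha,t)$. An interval $(\alpha,\beta)\subset I$ ($\beta\le\infty$) is a level interval if $R(\alpha,\beta)>0$ and $R(\alpha,t)\le R(\alpha,\beta)$ for each $t\in(\alpha,\beta)$; it is a maximal level interval if not contained in a larger level interval. Maximal level intervals are pairwise disjoint, hence at most countably many. The level function is $f^0(t)=R(\alpha,\beta)w(t)$ if $t$ belongs to a maximal level interval $(\alpha,\beta)$, and $f^0(t)=f^*(t)$ otherwise. It can happen (only for $a=\infty$) that $f^0\equiv\infty$; then $f^0\notin M_{E',w}$. If $f^*$ is not finite and integrable on finite intervals $(0,t)$, $t\in I$, then $f^0$ is not defined and the condition $f^0\in M_{E',w}$ is regarded as failing. *)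

(* Defs.v *)
From HB Require Import structures.
From mathcomp Require Import all_boot all_order all_algebra.
From mathcomp Require Import all_classical all_reals all_analysis.
Set Implicit Arguments.
Unset Strict Implicit.
Unset Printing Implicit Defensive.
Import Order.TTheory GRing.Theory Num.Theory.
Import numFieldNormedType.Exports.
Local Open Scope classical_set_scope.
Local Open Scope ring_scope.

(* The real line with the sigma-algebra of Lebesgue (not only Borel) measurable
   sets; it is convertible to R. *)
Notation lebR R := (caratheodory_type ((@wlength R idfun)^*)%mu).
Notation leb := completed_lebesgue_measure.

Section FunctionSpaces.
Context {R : realType}.
Implicit Types (D I J : set R) (f g : R -> R) (h : R -> \bar R).

Definition oitv (al : R) (be : \bar R) : set R :=
  [set t | al < t /\ (t%:E < be)%E].

(* A function on D is a total function R -> R of which only the values on D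
   matter. *)
Definition L0 D f : Prop := measurable_fun (D : set (lebR R)) (f : lebR R -> R).

Definition ae_on D (P : R -> Prop) : Prop := {ae leb, forall x, D x -> P x}.

Definition wmeas (w : R -> R) (A : set R) : \bar R :=
  (\int[leb]_(t in A) (w t)%:E)%E.

Definition distr (mu : set R -> \bar R) D f (s : R) : \bar R :=
  mu (D `&` [set x | s < `|f x|]).

(* +oo at t when distr mu D f s > t for all s *)
Definition rearr (mu : set R -> \bar R) D f (t : R) : \bar R :=
  ereal_inf [set s%:E | s in [set s | 0 < s /\ (distr mu D f s <= t%:E)%E]].

(* used with D an interval (0, c) *)
Definition submaj D f g : Prop := forall x, D x ->
  (\int[leb]_(t in oitv 0 x%:E) rearr leb D f t <=
   \int[leb]_(t in oitv 0 x%:E) rearr leb D g t)%E.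

Definition equimeasurable D f g : Prop :=
  forall s, 0 <= s -> distr leb D f s = distr leb D g s.

(* A class of functions on D with a gauge; the gauge is meaningful on members
   only. *)
Record fspace D := FSpace {
  fs_mem : (R -> R) -> Prop;
  fs_norm : (R -> R) -> \bar R }.

(* Membership and gauge of an extended real valued function: it has to be
   finite a.e., and is then identified with its finite part. *)
Definition fs_emem D (F : fspace D) h : Prop :=
  ae_on D (fun t => h t \is a fin_num) /\ fs_mem F (fine \o h).
Definition fs_enorm D (F : fspace D) h : \bar R := fs_norm F (fine \o h).

Record banach_function_space D (E : fspace D) : Prop := {
  bfs_meas : forall f, fs_mem E f -> L0 D f;
  bfs_mem0 : fs_mem E (fun=> 0);
  bfs_memD : forall f g, fs_mem E f -> fs_mem E g -> fs_mem E (fun t => f t + g t);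
  bfs_memZ : forall (k : R) f, fs_mem E f -> fs_mem E (fun t => k * f t);
  bfs_norm_fin : forall f, fs_mem E f -> fs_norm E f \is a fin_num;
  bfs_norm_ge0 : forall f, fs_mem E f -> (0 <= fs_norm E f)%E;
  bfs_norm_eq0 : forall f, fs_mem E f ->
    (fs_norm E f = 0%E <-> ae_on D (fun t => f t = 0));
  bfs_normZ : forall (k : R) f, fs_mem E f ->
    fs_norm E (fun t => (k * f t)%R) = (`|k|%:E * fs_norm E f)%E;
  bfs_normD : forall f g, fs_mem E f -> fs_mem E g ->
    (fs_norm E (fun t => (f t + g t)%R) <= fs_norm E f + fs_norm E g)%E;
  bfs_solid : forall f g, L0 D f -> fs_mem E g ->
    ae_on D (fun t => `|f t| <= `|g t|) ->
    fs_mem E f /\ (fs_norm E f <= fs_norm E g)%E;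
  (* no non-null subset of D on which every member vanishes *)
  bfs_full_support : forall A : set R,
    measurable (A : set (lebR R)) -> A `<=` D -> (0 < leb A)%E ->
    exists2 f, fs_mem E f & ~ ae_on A (fun t => f t = 0);
  bfs_complete : forall u : nat -> R -> R, (forall n, fs_mem E (u n)) ->
    (forall e : R, 0 < e -> exists N : nat, forall m n : nat,
       (N <= m)%N -> (N <= n)%N -> (fs_norm E (fun t => (u m t - u n t)%R) <= e%:E)%E) ->
    exists2 f, fs_mem E f &
      (fun n => fs_norm E (fun t => (u n t - f t)%R)) @ \oo --> 0%E }.

Record fully_symmetric D (E : fspace D) : Prop := {
  fsym_bfs : banach_function_space E;
  fsym_equi : forall f g, fs_mem E f -> fs_mem E g -> equimeasurable D f g ->
    fs_norm E f = fs_norm E g;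
  fsym_submaj : forall f g, L0 D f -> fs_mem E g -> submaj D f g ->
    fs_mem E f /\ (fs_norm E f <= fs_norm E g)%E }.

Definition has_support D (E : fspace D) : Prop := forall A : set R,
  measurable (A : set (lebR R)) -> A `<=` D -> (leb A < +oo)%E ->
  fs_mem E \1_A.

Definition kothe_norm D (F : fspace D) f : \bar R :=
  ereal_sup [set (\int[leb]_(t in D) `|f t * g t|%:E)%E |
    g in [set g | fs_mem F g /\ (fs_norm F g <= 1)%E]].

Definition kothe_dual D (F : fspace D) : fspace D :=
  FSpace D (fun f => L0 D f /\ (kothe_norm F f < +oo)%E) (kothe_norm F).

Section Weighted.
Variables (I : set R) (w : R -> R) (J : set R) (F : fspace J).

Definition Fw_space : fspace I :=
  FSpace I (fun f => L0 I f /\ fs_emem F (rearr (wmeas w) I f))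
           (fun f => fs_enorm F (rearr (wmeas w) I f)).

Definition Lambda_space : fspace I :=
  FSpace I (fun f => L0 I f /\ fs_emem Fw_space (rearr leb I f))
           (fun f => fs_enorm Fw_space (rearr leb I f)).

Definition rearr_div f (t : R) : \bar R := (rearr leb I f t / (w t)%:E)%E.

Definition M_space : fspace I :=
  FSpace I (fun f => L0 I f /\ fs_emem Fw_space (rearr_div f))
           (fun f => fs_enorm Fw_space (rearr_div f)).

Definition Q_space : fspace I :=
  FSpace I
    (fun f => L0 I f /\ exists2 g, fs_mem M_space g & submaj I f g)
    (fun f => ereal_inf [set fs_norm M_space g |
       g in [set g | fs_mem M_space g /\ submaj I f g]]).

End Weighted.

Section LevelFunction.
Variables (I : set R) (w f : R -> R).
Local Notation fstar := (rearr leb I f).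

Definition level_defined : Prop :=
  (forall t, I t -> fstar t \is a fin_num) /\
  (forall t, I t -> leb.-integrable (oitv 0 t%:E : set (lebR R)) fstar).

Definition level_ratio_fin (al be : R) : \bar R :=
  ((\int[leb]_(t in oitv al be%:E) fstar t) / wmeas w (oitv al be%:E))%E.

Definition level_ratio (al : R) (be : \bar R) : \bar R :=
  match be with
  | r%:E => level_ratio_fin al r
  | +oo%E => limf_esup (level_ratio_fin al) (pinfty_nbhs R)
  | -oo%E => 0%E (* junk *)
  end.

Definition level_interval (al : R) (be : \bar R) : Prop :=
  [/\ (al%:E < be)%E, oitv al be `<=` I, (0 < level_ratio al be)%E &
      forall t, oitv al be t -> (level_ratio al t%:E <= level_ratio al be)%E].

Definition max_level_interval (al : R) (be : \bar R) : Prop :=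
  level_interval al be /\
  forall al' be', level_interval al' be' ->
    oitv al be `<=` oitv al' be' -> oitv al be = oitv al' be'.

(* Meaningful under level_defined.  Maximal level intervals are pairwise
   disjoint, so the one selected at t is the only one containing t. *)
Definition level_function (t : R) : \bar R :=
  let S := [set p : R * \bar R |
             max_level_interval p.1 p.2 /\ oitv p.1 p.2 t] in
  if `[< S !=set0 >]
  then let p := xget (0, 0%E) S in (level_ratio p.1 p.2 * (w t)%:E)%E
  else fstar t.

Definition level_mem (G : fspace I) : Prop :=
  level_defined /\ fs_emem G level_function.

End LevelFunction.

End FunctionSpaces.

(* Main.v *)
Require Import Defs.
From HB Require Import structures.
From mathcomp Require Import all_boot all_order all_algebra.
From mathcomp Require Import all_classical all_reals all_analysis.
From mathcomp Require Import measurable_realfun ring lra zify.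
Set Implicit Arguments.
Unset Strict Implicit.
Unset Printing Implicit Defensive.
Import Order.TTheory GRing.Theory Num.Theory.
Import numFieldNormedType.Exports.
Local Open Scope classical_set_scope.
Local Open Scope ring_scope.

(* Write F and W for the primitives of f^* and w, and S for the supremum.  For
   each t let k(t) be the least rho >= 0 such that F - rho W attains its maximum
   over I in [0, t]; then k is decreasing and is the slope, with respect to W, of
   the least concave majorant G of F.  The maximal level intervals with slope rho
   span the set where F - rho W is maximal, so f^0 = k w a.e. and
   G(t) = int_0^t k w.

   Upper bound: if f << g then Hardy-Littlewood, used with respect to dt and then
   to w dt, gives int |f h| <= int g^* h^* = int (g^*/w) h^* w <= |g|_M |h|_Lambda.
   Since F <= G means f << f^0, this applies to g = f^0; for arbitrary g it also
   gives the comparison with the norm of Q.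

   Lower bound: a decreasing step function sum c_i 1_(0,t_i) is realized on sets
   A_(t_i) of a chain adapted to the level sets of f, so sum c_i F(t_i) <= S when
   sum c_i 1_(0,W(t_i)) is in the unit ball of E.  Each G(t) is nearly a convex
   combination of two values of F, and averaging the c_i accordingly only decreases
   the step function for <<; hence sum c_i G(t_i) <= S.  Riemann sums in the layer
   cake formula then bound the norm of f^0 by S.

   All integrals of products are computed by the layer cake formula, in which
   decreasing functions have nested level sets; this avoids any change of variables
   by W. *)

(** * Lebesgue measure and the layer cake formula *)

(** Four obstacles shape the proof. If I has infinite length, f^* may have a positive limit at
    infinity, and then no set A of measure t need attain int_A |f| = F(t); so the sets A_t are built
    inside a finite interval (0,c), and I is recovered by monotone convergence in c. The right
    contact of F with a supporting line may escape to the end of I: this is why values of G are only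
    nearly convex combinations of values of F, and why R(alpha,a) must be handled as a limsup. The
    slope k need not be continuous, so G is not differentiated: its increments and those of int k w
    satisfy the same two-sided bounds in terms of k and W, and these bounds determine them. Finally,
    k(t) may fail to exist. Then F/W is unbounded, I itself is a level interval of infinite ratio
    and f^0 is infinite everywhere; a finite S excludes this, since arbitrarily steep chords from 0
    then pass above a fixed abscissa. *)

Lemma measurable_lebR {R : realType} {A : set R} :
  measurable A -> measurable (A : set (lebR R)).
Proof. exact: sub_caratheodory. Qed.

Lemma is_interval_measurable_lebR {R : realType} {A : set R} :
  is_interval A -> measurable (A : set (lebR R)).
Proof. by move=> /is_interval_measurable/measurable_lebR. Qed.

Lemma measurable_id_lebR {R : realType} (D : set R) :
  measurable (D : set (lebR R)) ->
  measurable_fun (D : set (lebR R)) (idfun : lebR R -> R).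
Proof. by move=> mD _ Y mY; apply: measurableI => //; exact: measurable_lebR. Qed.

Lemma oitv_interval {R : realType} (s : R) (c : \bar R) : is_interval (oitv s c).
Proof.
move=> x y [sx _] [_ yc] z /andP[xz zy]; split; first exact: lt_le_trans xz.
by apply: le_lt_trans yc; rewrite lee_fin.
Qed.

Lemma measurable_oitv {R : realType} (s : R) (c : \bar R) :
  measurable (oitv s c : set (lebR R)).
Proof. exact/is_interval_measurable_lebR/oitv_interval. Qed.
#[global] Hint Extern 0 (measurable (oitv _ _)) => exact: measurable_oitv : core.

Lemma leb_oitv_fin {R : realType} (s t : R) : s <= t ->
  leb (oitv s t%:E) = (t - s)%:E.
Proof.
move=> st; have -> : oitv s t%:E = `]s, t[%classic.
  by apply/seteqP; split=> x; rewrite /oitv /= in_itv/= lte_fin;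
    [case=> -> -> | move/andP].
rewrite -[LHS]/(lebesgue_measure `]s, t[%classic) lebesgue_measure_itv/= lte_fin.
case: ltP => // ts.
by rewrite (le_anti (introT andP (conj st ts))) subrr.
Qed.

Lemma leb_oitv0 {R : realType} (c : \bar R) : (0 <= c)%E -> leb (oitv 0 c) = c.
Proof.
case: c => [r| |] //; first by rewrite lee_fin => /leb_oitv_fin ->; rewrite subr0.
move=> _; have -> : oitv 0 +oo%E = `]0, +oo[%classic :> set R.
  by apply/seteqP; split=> x; rewrite /oitv /= in_itv/= andbT ltry => // -[].
by rewrite -[LHS]/(lebesgue_measure `]0, +oo[%classic) lebesgue_measure_itv/= ltry.
Qed.

Section layer_cake.
Context {R : realType}.
Local Open Scope ereal_scope.

(** Tonelli on the region under the graph of [phi]: [phi x] is the length of [oitv 0 (phi x)], also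
    when it is infinite. *)
Lemma layer_cake (D : set (lebR R)) (phi psi : lebR R -> \bar R) :
  measurable D -> measurable_fun D phi -> measurable_fun D psi ->
  (forall x, D x -> 0 <= phi x) -> (forall x, D x -> 0 <= psi x) ->
  \int[leb]_(x in D) (phi x * psi x) =
  \int[leb]_(s in oitv 0%R +oo)
     \int[leb]_(x in D `&` [set x | s%:E < phi x]) psi x.
Proof.
move=> mD mphi mpsi phi0 psi0.
pose P := [set z : lebR R * lebR R |
  (0 < z.2 :> R)%R /\ (z.2 : R)%:E < (phi \_ D) z.1].
have mphi' : measurable_fun setT (phi \_ D).
  by apply/(measurable_restrictT _ _).1.
have mpsi' : measurable_fun setT (psi \_ D).
  by apply/(measurable_restrictT _ _).1.
have phi'0 x : 0 <= (phi \_ D) x.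
  by rewrite patchE; case: ifPn => // /set_mem /phi0.
have psi'0 x : 0 <= (psi \_ D) x.
  by rewrite patchE; case: ifPn => // /set_mem /psi0.
have msnd : measurable_fun (setT : set (lebR R * lebR R)) (fun z => (z.2 : R)%:E).
  apply/measurable_EFinP; apply: (measurableT_comp (f := (idfun : lebR R -> R))).
    exact: measurable_id_lebR.
  exact: measurable_snd.
have mP : measurable P.
  have -> : P = (setT `&` [set z : lebR R * lebR R | cst 0 z < (z.2 : R)%:E]) `&`
     (setT `&` [set z : lebR R * lebR R | (z.2 : R)%:E < (phi \_ D) z.1]).
    by apply/seteqP; split=> z; rewrite /P /= lte_fin; [case|case=> -[_ ?] [_ ?]].
  apply: measurableI; apply: measurable_lte => //.
  exact: (measurableT_comp mphi' measurable_fst).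
pose h (z : lebR R * lebR R) := (psi \_ D) z.1 * (\1_P z)%:E.
have mh : measurable_fun setT h.
  apply: emeasurable_funM; first exact: (measurableT_comp mpsi' measurable_fst).
  exact/measurable_EFinP.
have h0 z : 0 <= h z by rewrite /h mule_ge0// lee_fin.
have mPx x : measurable ((fun y => P (x, y)) : set (lebR R)).
  by have := @measurable_xsection _ _ _ _ _ x mP; rewrite xsectionE.
transitivity (\int[leb]_(x in setT) \int[leb]_(s in setT) h (x, s)).
  rewrite integral_mkcond; apply: eq_integral => x _ /=.
  rewrite /h /=.
  transitivity ((psi \_ D) x * leb (oitv 0%R ((phi \_ D) x))).
    rewrite leb_oitv0// !patchE; case: ifPn => _; last by rewrite mule0.
    by rewrite muleC.
  rewrite ge0_integralZl; [|exact: measurableT| | |exact: psi'0].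
  - by rewrite integral_indic ?setIT//; exact: mPx.
  - by apply/measurable_EFinP; exact: (measurable_indic (mPx x)).
  - by move=> s _; rewrite lee_fin.
rewrite (fubini_tonelli _ mh h0).
rewrite [RHS]integral_mkcond; apply: eq_integral => s _.
rewrite patchE; case: ifPn => [/set_mem [s0 _]|ns]; last first.
  rewrite integral0_eq// => x _; rewrite /h indicE memNset ?mule0// => -[s0 _].
  by move/negP: ns; apply; apply/mem_set; split => //; exact: ltry.
rewrite [RHS]integral_mkcond; apply: eq_integral => x _.
rewrite /h/= !patchE indicE.
have -> : ((x, s) \in P) = (x \in D `&` [set x | s%:E < phi x]).
  apply/idP/idP => /set_mem; last first.
    by move=> [Dx sx]; apply/mem_set; rewrite /P /= patchE mem_set.
  rewrite /P /= patchE; case: ifPn => [/set_mem Dx [_ sx]|_ [_]]; first exact/mem_set.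
  by rewrite lte_fin => /(lt_trans s0); rewrite ltxx.
case: ifPn => [xD|/negbTE xD].
  case: ifPn => _; first by rewrite mule1.
  by rewrite mule0.
case: ifPn => [/set_mem [/mem_set]|_]; first by rewrite xD.
by rewrite mul0e.
Qed.

End layer_cake.

Lemma ae_leb_filter {R : realType} :
  Filter (almost_everywhere (@completed_lebesgue_measure R)).
Proof. exact: ae_filter_ringOfSetsType. Qed.
#[global] Hint Extern 0 (Filter (almost_everywhere completed_lebesgue_measure)) =>
  exact: ae_leb_filter : typeclass_instances.
#[global] Hint Extern 0 (Filter (nbhs (almost_everywhere completed_lebesgue_measure))) =>
  exact: ae_leb_filter : typeclass_instances.

(** * Distribution functions and rearrangements *)

Section density.
Context {R : realType}.
Local Open Scope ereal_scope.
Implicit Types (mu : set R -> \bar R) (D A B : set R) (v f g : R -> R).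

(** One interface for Lebesgue measure and for w dm. The set function [mu] is pinned down only on
    the measurable subsets of [D], so [wmeas w] can be used as it stands. *)
Definition has_density mu D v : Prop :=
  [/\ measurable (D : set (lebR R)),
      measurable_fun (D : set (lebR R)) (v : lebR R -> R),
      forall x, D x -> (0 <= v x)%R &
      forall A, measurable (A : set (lebR R)) -> A `<=` D ->
        mu A = \int[leb]_(x in A) (v x)%:E].

Lemma density_sub {mu D v} D' : has_density mu D v ->
  measurable (D' : set (lebR R)) -> D' `<=` D -> has_density mu D' v.
Proof.
move=> [mD mv v0 muE] mD' D'D; split => //.
- exact: measurable_funS mv.
- by move=> x /D'D /v0.
- by move=> A mA AD'; apply: muE => //; exact: subset_trans D'D.
Qed.

Lemma density_leb D : measurable (D : set (lebR R)) -> has_density leb D (cst 1%R).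
Proof.
move=> mD; split => //= A mA _.
by rewrite integral_cst//= mul1e.
Qed.

Section density_measure.
Context {mu D v} (H : has_density mu D v).
Let mD : measurable (D : set (lebR R)) := let: And4 a _ _ _ := H in a.

Lemma density_ge0 A : measurable (A : set (lebR R)) -> A `<=` D -> 0 <= mu A.
Proof.
case: H => _ mv v0 muE mA AD; rewrite muE//; apply: integral_ge0 => x Ax.
by rewrite lee_fin v0//; exact: AD.
Qed.

Lemma density_set0 : mu set0 = 0.
Proof. by case: H => _ mv v0 muE; rewrite muE// integral_set0. Qed.

Lemma density_le A B : measurable (A : set (lebR R)) ->
  measurable (B : set (lebR R)) -> A `<=` B -> B `<=` D -> mu A <= mu B.
Proof.
case: H => _ mv v0 muE mA mB AB BD; rewrite !muE//; last exact: subset_trans BD.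
apply: ge0_subset_integral; [exact: mA|exact: mB| | |exact: AB].
  exact/measurable_EFinP/(measurable_funS mD BD mv).
by move=> x Bx; rewrite lee_fin v0//; exact: BD.
Qed.

Lemma density_cvg (A : (set R)^nat) : nondecreasing_seq A ->
  (forall n, measurable (A n : set (lebR R))) -> (forall n, A n `<=` D) ->
  mu (A n) @[n --> \oo] --> mu (\bigcup_n A n).
Proof.
case: H => _ mv v0 muE ndA mA AD.
have mU : measurable (\bigcup_n A n : set (lebR R)) by exact: bigcupT_measurable.
rewrite muE//; last by move=> x [n _]; exact: AD.
under eq_fun do rewrite muE//.
apply: (@ge0_nondecreasing_set_cvg_integral _ (lebR R) R A
  (fun x => (v x)%:E) leb).
- exact: ndA.
- exact: mA.
- by move=> n; exact/measurable_EFinP/(measurable_funS mD (AD n) mv).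
- by move=> n x An; rewrite lee_fin v0//; exact: AD An.
Qed.

Lemma density_bigcup_le (A : (set R)^nat) c : nondecreasing_seq A ->
  (forall n, measurable (A n : set (lebR R))) -> (forall n, A n `<=` D) ->
  (forall n, mu (A n) <= c) -> mu (\bigcup_n A n) <= c.
Proof.
move=> ndA mA AD Ac; have muA := density_cvg ndA mA AD.
rewrite -(cvg_lim (@ereal_hausdorff R) muA).
by apply: lime_le; [apply/cvg_ex; eexists; exact: muA|exact: nearW].
Qed.

Lemma density_ae A B : measurable (A : set (lebR R)) ->
  measurable (B : set (lebR R)) -> A `<=` D -> B `<=` D ->
  {ae leb, forall x, D x -> A x <-> B x} -> mu A = mu B.
Proof.
case: H => _ mv v0 muE mA mB AD BD AB; rewrite !muE//.
rewrite [LHS]integral_mkcond [RHS]integral_mkcond.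
apply: ge0_ae_eq_integral.
- exact: measurableT.
- by apply/(measurable_restrictT _ mA).1; exact/measurable_EFinP/(measurable_funS mD AD mv).
- by apply/(measurable_restrictT _ mB).1; exact/measurable_EFinP/(measurable_funS mD BD mv).
- by move=> x _; apply: erestrict_ge0 => y /AD Dy; rewrite lee_fin v0.
- by move=> x _; apply: erestrict_ge0 => y /BD Dy; rewrite lee_fin v0.
apply: filterS AB => x ABx _; rewrite !patchE.
case: ifPn => [/set_mem Ax|nA]; case: ifPn => [/set_mem Bx|nB] //.
  by move: nB; rewrite mem_set//; apply/ABx => //; exact: AD.
by move: nA; rewrite mem_set//; apply/ABx => //; exact: BD.
Qed.

Section distribution.
Context {f} (mf : L0 D f).

Lemma measurable_level s :
  measurable (D `&` [set x | (s < `|f x|)%R] : set (lebR R)).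
Proof.
have : measurable_fun (D : set (lebR R)) (fun x => (`|f x|%R)%:E).
  by apply/measurable_EFinP; exact: measurableT_comp.
by move=> /(emeasurable_fun_o_infty mD)/(_ s%:E); under eq_set do rewrite lte_fin.
Qed.

Lemma distr_ge0 s : 0 <= distr mu D f s.
Proof. by apply: density_ge0 => //; exact: measurable_level. Qed.

Lemma distr_le s t : (s <= t)%R -> distr mu D f t <= distr mu D f s.
Proof.
move=> st; apply: density_le => //; try exact: measurable_level.
by move=> x [Dx /=]; split => //=; exact: le_lt_trans st _.
Qed.

Lemma distr_le_total s : distr mu D f s <= mu D.
Proof. by apply: density_le => //; exact: measurable_level. Qed.

(** [rearr] and [distr] are generalised inverses of each other; nearly every later statement about
    [rearr] goes through this equivalence. Its substance is the right continuity of [distr], which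
    is continuity from below along the levels s + 1/(n+1). *)
Lemma rearr_gt s t : (0 <= s)%R ->
  (s%:E < rearr mu D f t) = (t%:E < distr mu D f s).
Proof.
move=> s0; apply/idP/idP; apply: contraTT; rewrite -!leNgt => h.
  (* [s] may be 0, which the infimum defining [rearr] excludes; hence the passage to [s + e]. *)
  apply/lee_addgt0Pr => e e0; rewrite -EFinD; apply: ereal_inf_lbound.
  exists (s + e)%R => //; split; first by rewrite ltr_wpDl.
  by apply: le_trans h; rewrite distr_le// lerDl ltW.
have sE : D `&` [set x | (s < `|f x|)%R] =
    \bigcup_n (D `&` [set x | (s + n.+1%:R^-1 < `|f x|)%R]).
  apply/seteqP; split => [x [Dx /= sx]|x [n _ [Dx /= sx]]]; last first.
    by split => //=; apply: lt_trans sx; rewrite ltrDl.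
  have := near_infty_natSinv_lt (PosNum (ltac:(by rewrite subr_gt0) : (0 < `|f x| - s)%R)).
  case=> N _ /(_ N (leqnn N)) /= hN.
  by exists N => //; split => //=; rewrite -ltrBrDl.
rewrite /distr sE; apply: density_bigcup_le.
- apply/nondecreasing_seqP => n; apply/subsetPset => x [Dx /= h1]; split => //=.
  by apply: le_lt_trans h1; rewrite lerD2l lef_pV2 ?posrE// ler_nat.
- by move=> n; exact: measurable_level.
- by move=> n x [].
move=> n; have : rearr mu D f t < (s + n.+1%:R^-1)%:E.
  by apply: le_lt_trans h _; rewrite lte_fin ltrDl.
move=> /ereal_inf_lt [_ [s' [s'0 s't] <-]]; rewrite lte_fin => s's.
by apply: le_trans s't; apply: distr_le; exact: ltW.
Qed.

Lemma rearr_ge0 t : 0 <= rearr mu D f t.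
Proof. by apply: le_ereal_inf_tmp => _ [s [/ltW s0 _] <-]; rewrite lee_fin. Qed.

End distribution.

End density_measure.

Lemma rearr_nincr mu D f s t : (s <= t)%R -> rearr mu D f t <= rearr mu D f s.
Proof.
move=> st; apply: ereal_inf_le_tmp => _ [u [u0 us] <-]; exists u => //; split => //.
by apply: le_trans us _; rewrite lee_fin.
Qed.

End density.

(** * Decreasing functions and the Hardy-Littlewood inequality *)

Section monotone.
Context {R : realType}.
Local Open Scope ereal_scope.
Implicit Types (mu : set R -> \bar R) (D A B : set R) (v f g : R -> R).
Implicit Types (phi psi : R -> \bar R).

(** Initial segments of [D], such as the level sets of a decreasing function. Any two of them are
    nested, so the measure of an intersection is the minimum of the measures. *)
Definition downset D A : Prop :=
  A `<=` D /\ forall x y, A x -> D y -> (y <= x)%R -> A y.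

Lemma downset_measurable D A : is_interval D -> downset D A ->
  measurable (A : set (lebR R)).
Proof.
move=> iD [AD Adown]; apply: is_interval_measurable_lebR.
move=> x y Ax Ay z /andP[xz zy]; apply: (Adown y) => //.
by apply: (iD x y); [exact: AD|exact: AD|rewrite xz zy].
Qed.

Lemma downset_total D A B : downset D A -> downset D B -> A `<=` B \/ B `<=` A.
Proof.
move=> [AD Ad] [BD Bd]; have [|/existsNP[x /not_implyP[Ax nBx]]] := pselect (A `<=` B).
  by left.
right=> y By; have [yx|/ltW xy] := leP y x; first exact: Ad Ax (BD _ By) yx.
by exfalso; apply: nBx; exact: Bd By (AD _ Ax) xy.
Qed.

Lemma downset_level D phi (s : \bar R) :
  (forall x y, D x -> D y -> (x <= y)%R -> phi y <= phi x) ->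
  downset D (D `&` [set x | s < phi x]).
Proof.
move=> mphi; split => [x []//|x y [Dx /= sx] Dy yx]; split => //=.
by apply: lt_le_trans sx _; exact: mphi.
Qed.

Lemma downset_oitv (c x : \bar R) : x <= c -> downset (oitv 0%R c) (oitv 0%R x).
Proof.
move=> xc; split => [y [y0 yx]|y z [_ yx] [z0 _] zy]; split => //.
  exact: lt_le_trans xc.
by apply: le_lt_trans yx; rewrite lee_fin.
Qed.

Lemma downset_min mu D v A B : has_density mu D v -> is_interval D ->
  downset D A -> downset D B -> mu (A `&` B) = mine (mu A) (mu B).
Proof.
move=> H iD dA dB.
have mA := downset_measurable iD dA; have mB := downset_measurable iD dB.
case: (downset_total dA dB) => AB.
- by rewrite setIidl// min_l//; apply: (density_le H) => //; case: dB.
- by rewrite setIidr// min_r//; apply: (density_le H) => //; case: dA.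
Qed.

Lemma nincr_measurable D phi : is_interval D ->
  (forall x y, D x -> D y -> (x <= y)%R -> phi y <= phi x) ->
  measurable_fun (D : set (lebR R)) (phi : lebR R -> \bar R).
Proof.
move=> iD mphi mD; apply: (measurability _ (ErealGenOInfty.measurableE R)) => //.
move=> _ [_ [r ->] <-].
rewrite (_ : D `&` _ = D `&` [set x | r%:E < phi x]); last first.
  by apply/seteqP; split=> x /=; rewrite in_itv/= andbT.
by apply: downset_measurable (downset_level _ mphi).
Qed.

Lemma nincr_measurable_fin D f : is_interval D ->
  (forall x y, D x -> D y -> (x <= y)%R -> (f y <= f x)%R) -> L0 D f.
Proof.
by move=> iD mf; apply/measurable_EFinP; exact: nincr_measurable.
Qed.

Local Notation T := (oitv (0 : R)%R +oo).

(** Monotonicity stands in for measurability, which would be awkward to establish directly for the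
    iterated integrals below. *)
Lemma le_integral_nincr phi psi :
  (forall s t, (0 < s)%R -> (s <= t)%R -> phi t <= phi s) ->
  (forall s t, (0 < s)%R -> (s <= t)%R -> psi t <= psi s) ->
  (forall s, (0 < s)%R -> 0 <= phi s <= psi s) ->
  \int[leb]_(s in T) phi s <= \int[leb]_(s in T) psi s.
Proof.
move=> mphi mpsi pp; apply: ge0_le_integral => //.
- by move=> s [/pp/andP[]].
- by apply: nincr_measurable => [|x y [x0 _] _]; [exact: oitv_interval|exact: mphi].
- by apply: nincr_measurable => [|x y [x0 _] _]; [exact: oitv_interval|exact: mpsi].
- by move=> s [/pp/andP[]].
Qed.

(** The integral of the product of two rearrangements, written with the distribution functions
    alone. In this form rearrangements for different measures, on different intervals, can be
    compared. *)
Definition min_integral (d1 d2 : R -> \bar R) : \bar R :=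
  \int[leb]_(s in T) \int[leb]_(r in T) mine (d1 s) (d2 r).

Lemma layer_cake2 mu D v phi psi : has_density mu D v ->
  measurable_fun (D : set (lebR R)) (phi : lebR R -> \bar R) ->
  measurable_fun (D : set (lebR R)) (psi : lebR R -> \bar R) ->
  (forall x, D x -> 0 <= phi x) -> (forall x, D x -> 0 <= psi x) ->
  \int[leb]_(x in D) (phi x * (psi x * (v x)%:E)) =
  \int[leb]_(s in T) \int[leb]_(r in T)
    mu ((D `&` [set x | s%:E < phi x]) `&` [set x | r%:E < psi x]).
Proof.
move=> [mD mv v0 muE] mphi mpsi phi0 psi0.
rewrite (@layer_cake _ D phi); [|exact: mD|exact: mphi| |exact: phi0|].
- apply: eq_integral => s _.
  have mDs : measurable (D `&` [set x | s%:E < phi x] : set (lebR R)).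
    exact: emeasurable_fun_o_infty.
  have DsD : D `&` [set x | s%:E < phi x] `<=` D by move=> x [].
  rewrite (@layer_cake _ _ psi); [|exact: mDs| | | |].
  + apply: eq_integral => r _; rewrite muE//; last by move=> x [] /DsD.
    apply: (emeasurable_fun_o_infty mDs (measurable_funS mD DsD mpsi)).
  + exact: measurable_funS mpsi.
  + by apply/measurable_EFinP; exact: measurable_funS mv.
  + by move=> x /DsD/psi0.
  + by move=> x /DsD /v0; rewrite lee_fin.
- by apply: emeasurable_funM => //; exact/measurable_EFinP.
- by move=> x Dx; rewrite mule_ge0// ?lee_fin; [exact: psi0|exact: v0].
Qed.

Lemma min_integral_le_inner (a b : \bar R) (d d' : R -> \bar R) :
  0 <= a -> (forall r, (0 < r)%R -> 0 <= d r) ->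
  (forall s t, (0 < s)%R -> (s <= t)%R -> d t <= d s) ->
  (forall s t, (0 < s)%R -> (s <= t)%R -> d' t <= d' s) ->
  a <= b -> (forall r, (0 < r)%R -> d r <= d' r) ->
  \int[leb]_(r in T) mine a (d r) <= \int[leb]_(r in T) mine b (d' r).
Proof.
move=> a0 d0 nd nd' ab dd'; apply: le_integral_nincr.
- by move=> s t s0 st; rewrite le_min !ge_min lexx/= (nd s)// orbT.
- by move=> s t s0 st; rewrite le_min !ge_min lexx/= (nd' s)// orbT.
- move=> s s0; rewrite le_min a0 d0//=.
  by rewrite le_min !ge_min ab dd'// orbT.
Qed.

(** After two layer cake decompositions this is the bound of the measure of an intersection of level
    sets by the smaller of the two measures. *)
Lemma hardy_littlewood mu D v f g : has_density mu D v -> L0 D f -> L0 D g ->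
  \int[leb]_(x in D) (`|f x|%:E * (`|g x|%:E * (v x)%:E)) <=
  min_integral (distr mu D f) (distr mu D g).
Proof.
move=> H mf mg; have [mD mv v0 muE] := H.
have mabs h : L0 D h -> measurable_fun (D : set (lebR R)) (fun x => `|h x|%:E).
  by move=> mh; apply/measurable_EFinP; exact: measurableT_comp.
rewrite (layer_cake2 H (mabs _ mf) (mabs _ mg))//.
have mlev h s : L0 D h -> measurable (D `&` [set x | s%:E < `|h x|%:E] : set (lebR R)).
  by move=> mh; apply: emeasurable_fun_o_infty => //; exact: mabs.
have mlev2 s r : measurable ((D `&` [set x | s%:E < `|f x|%:E])
    `&` [set x | r%:E < `|g x|%:E] : set (lebR R)).
  have -> : (D `&` [set x | s%:E < `|f x|%:E]) `&` [set x | r%:E < `|g x|%:E] =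
   (D `&` [set x | s%:E < `|f x|%:E]) `&` (D `&` [set x | r%:E < `|g x|%:E]).
    by apply/seteqP; split => x [[? ?]] => [?|[]].
  by apply: measurableI; exact: mlev.
have dE h s : L0 D h -> distr mu D h s = mu (D `&` [set x | s%:E < `|h x|%:E]).
  by move=> mh; rewrite /distr; congr mu; apply/seteqP; split => x /=; rewrite lte_fin.
have lemin s r : mu ((D `&` [set x | s%:E < `|f x|%:E])
    `&` [set x | r%:E < `|g x|%:E]) <= mine (distr mu D f s) (distr mu D g r).
  rewrite le_min (dE _ _ mf) (dE _ _ mg).
  apply/andP; split.
    by apply: (density_le H); [exact: mlev2|exact: (mlev _ _ mf)|move=> x []|move=> x []].
  apply: (density_le H); [exact: mlev2|exact: (mlev _ _ mg)| |by move=> x []].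
  by move=> x [[? _] ?].
have dens0 s r : 0 <= mu ((D `&` [set x | s%:E < `|f x|%:E])
    `&` [set x | r%:E < `|g x|%:E]).
  by apply: (density_ge0 H) => // x [[]].
have mono s t r r' : (s <= t)%R -> (r <= r')%R ->
   mu ((D `&` [set x | t%:E < `|f x|%:E]) `&` [set x | r'%:E < `|g x|%:E]) <=
   mu ((D `&` [set x | s%:E < `|f x|%:E]) `&` [set x | r%:E < `|g x|%:E]).
  move=> st rr'; apply: (density_le H) => //; last by move=> x [[]].
  move=> x [[Dx /= tx] rx]; split; first split => //=.
    by apply: le_lt_trans tx; rewrite lee_fin.
  by apply: le_lt_trans rx; rewrite lee_fin.
apply: le_integral_nincr.
- move=> s t s0 st; apply: le_integral_nincr => //.
  + by move=> r r' r0 rr'; exact: mono.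
  + by move=> r r' r0 rr'; exact: mono.
  + by move=> r r0; rewrite dens0/=; exact: mono.
- move=> s t s0 st; apply: min_integral_le_inner => //.
  + exact: (distr_ge0 H).
  + by move=> r _; exact: (distr_ge0 H).
  + by move=> r r' _; exact: (distr_le H).
  + by move=> r r' _; exact: (distr_le H).
  + exact: (distr_le H).
- move=> s s0; apply/andP; split; first by apply: integral_ge0.
  apply: le_integral_nincr.
  + by move=> r r' r0 rr'; exact: mono.
  + by move=> r r' r0 rr'; rewrite le_min !ge_min lexx/= (distr_le H)// orbT.
  + by move=> r r0; rewrite dens0/=.
Qed.

(** The equality case of Hardy-Littlewood: level sets of decreasing functions are nested. *)
Lemma min_integral_nincr mu (c : \bar R) v phi psi :
  has_density mu (oitv 0%R c) v ->
  (forall x y, oitv 0%R c x -> oitv 0%R c y -> (x <= y)%R -> phi y <= phi x) ->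
  (forall x y, oitv 0%R c x -> oitv 0%R c y -> (x <= y)%R -> psi y <= psi x) ->
  (forall x, oitv 0%R c x -> 0 <= phi x) -> (forall x, oitv 0%R c x -> 0 <= psi x) ->
  \int[leb]_(x in oitv 0%R c) (phi x * (psi x * (v x)%:E)) =
  min_integral (fun s => mu (oitv 0%R c `&` [set x | s%:E < phi x]))
               (fun r => mu (oitv 0%R c `&` [set x | r%:E < psi x])).
Proof.
move=> H nphi npsi phi0 psi0; have iD := @oitv_interval R 0 c.
rewrite (layer_cake2 H); [|exact: nincr_measurable..|exact: phi0|exact: psi0].
apply: eq_integral => s _; apply: eq_integral => r _.
rewrite -(downset_min H iD (downset_level s%:E nphi) (downset_level r%:E npsi)).
by congr mu; apply/seteqP; split => x [[? ?]] => [?|[]].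
Qed.

(** The same equality, with the indicator of [oitv 0 x] as one of the two decreasing functions. *)
Lemma integral_nincr_prefix mu (c x : \bar R) v phi :
  has_density mu (oitv 0%R c) v -> x <= c ->
  (forall x y, oitv 0%R c x -> oitv 0%R c y -> (x <= y)%R -> phi y <= phi x) ->
  (forall x, oitv 0%R c x -> 0 <= phi x) ->
  \int[leb]_(y in oitv 0%R x) (phi y * (v y)%:E) =
  \int[leb]_(s in T) mine (mu (oitv 0%R x))
     (mu (oitv 0%R c `&` [set y | s%:E < phi y])).
Proof.
move=> H xc nphi phi0; have iD := @oitv_interval R 0 c.
have dx := downset_oitv xc.
have xsub : oitv 0%R x `<=` oitv 0%R c by case: dx.
have [mD mv v0 muE] := H.
have mx : measurable (oitv 0%R x : set (lebR R)) by exact: measurable_oitv.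
rewrite layer_cake; [|exact: mx| | | |].
- apply: eq_integral => s _; rewrite -(downset_min H iD dx (downset_level s%:E nphi)).
  rewrite muE.
  + congr (integral _ _ _); apply/seteqP; split => y [y1 y2]; split => //.
      by split => //; exact: xsub.
    by case: y2.
  + apply: measurableI => //; apply: (downset_measurable iD).
    exact: (downset_level s%:E nphi).
  + by move=> y [/xsub].
- by apply: (measurable_funS mD xsub); exact: nincr_measurable.
- by apply/measurable_EFinP; exact: measurable_funS mv.
- by move=> y /xsub/phi0.
- by move=> y /xsub/v0; rewrite lee_fin.
Qed.

End monotone.

(** * Rearrangements through their level sets *)

Section rearrangement.
Context {R : realType}.
Local Open Scope ereal_scope.
Implicit Types (mu nu : set R -> \bar R) (D A B : set R) (v f g : R -> R).
Implicit Types (phi psi : R -> \bar R) (c : \bar R).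
Local Notation T := (oitv (0 : R)%R +oo).

Lemma countable_negligible A : countable A -> {ae leb, forall x, ~ A x}.
Proof.
move=> cA; exists A; split.
- exact/measurable_lebR/countable_measurable.
- exact: countable_lebesgue_measure0.
- by move=> x /= /contrapT.
Qed.

Lemma ae_eq_distr D f g s : measurable (D : set (lebR R)) -> L0 D f -> L0 D g ->
  ae_on D (fun t => f t = g t) -> distr leb D f s = distr leb D g s.
Proof.
move=> mD mf mg fg; apply: (density_ae (density_leb mD)).
- exact: measurable_level (density_leb mD) _ mf s.
- exact: measurable_level (density_leb mD) _ mg s.
- by move=> x [].
- by move=> x [].
rewrite /ae_on in fg; apply: filterS fg => x fgx Dx; by split => -[_ /= sx]; split => //=;
  rewrite ?fgx // -fgx.
Qed.

Lemma ae_eq_rearr D f g : measurable (D : set (lebR R)) -> L0 D f -> L0 D g ->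
  ae_on D (fun t => f t = g t) -> rearr leb D f = rearr leb D g.
Proof.
move=> mD mf mg fg; apply/funext => t; rewrite /rearr; congr (ereal_inf [set s%:E | s in _]).
by apply/funext => s; rewrite /= (ae_eq_distr s mD mf mg fg).
Qed.

Section one_function.
Context {mu D v f} (H : has_density mu D v) (mf : L0 D f).

(** Any bound [c] of the total mass is allowed, so that a rearrangement may be viewed on an interval
    longer than [mu D]; it vanishes on the rest. *)
Lemma rearr_level c s : mu D <= c -> (0 <= s)%R ->
  oitv 0%R c `&` [set t | s%:E < rearr mu D f t] = oitv 0%R (distr mu D f s).
Proof.
move=> muc s0; apply/seteqP; split => [t [[t0 _] /=]|t [t0 td]].
  by rewrite (rearr_gt H mf)// => td; split.
split; last by rewrite /= (rearr_gt H mf).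
split => //; apply: lt_le_trans td _; apply: le_trans muc.
exact: (distr_le_total H mf).
Qed.

Lemma leb_rearr_level c s : mu D <= c -> (0 <= s)%R ->
  leb (oitv 0%R c `&` [set t | s%:E < rearr mu D f t]) = distr mu D f s.
Proof.
by move=> muc s0; rewrite rearr_level// leb_oitv0//; exact: (distr_ge0 H mf).
Qed.

Lemma integral_rearr_prefix c (x : \bar R) : mu D <= c -> 0 <= x -> x <= c ->
  \int[leb]_(t in oitv 0%R x) rearr mu D f t =
  \int[leb]_(s in T) mine x (distr mu D f s).
Proof.
move=> muc x0 xc; under eq_integral do rewrite -[rearr _ _ _ _]mule1.
rewrite (integral_nincr_prefix (density_leb (measurable_oitv 0%R c)) xc).
- rewrite leb_oitv0//; apply: eq_integral => s /set_mem[s0 _].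
  by rewrite leb_rearr_level// ltW.
- by move=> s t _ _; exact: rearr_nincr.
- by move=> s _; exact: rearr_ge0.
Qed.

(** If f^*(t) < q < r with q rational, then d_f(q) <= t. Equality being excluded, f^* <= q already
    holds from d_f(q) on, which is to the left of t. Rational levels keep the exceptional set of t
    countable. *)
Lemma rearr_left_cont t r : (0 < t)%R ->
  ~ (exists q : rat, distr mu D f (ratr q) = t%:E) ->
  rearr mu D f t < r%:E -> exists2 s, (0 < s < t)%R & rearr mu D f s < r%:E.
Proof.
move=> t0 nt ftr.
have fin : rearr mu D f t \is a fin_num.
  by rewrite ge0_fin_numE ?(lt_trans ftr) ?ltry//; exact: rearr_ge0.
move: (fin) ftr => /fineK <-; rewrite lte_fin => /rat_in_itvoo[q].
rewrite in_itv/= => /andP[fq qr].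
have q0 : (0 <= ratr q :> R)%R.
  by apply: le_trans (ltW fq); rewrite fine_ge0//; exact: rearr_ge0.
have dq : distr mu D f (ratr q) < t%:E.
  rewrite lt_neqAle; apply/andP; split.
    by apply/eqP => e; apply: nt; exists q.
  by rewrite leNgt -(rearr_gt H mf)// -leNgt -(fineK fin) lee_fin ltW.
have dfin : distr mu D f (ratr q) \is a fin_num.
  by rewrite ge0_fin_numE ?(lt_trans dq) ?ltry//; exact: (distr_ge0 H mf).
set d := fine (distr mu D f (ratr q)).
have d0 : (0 <= d)%R by rewrite fine_ge0//; exact: (distr_ge0 H mf).
have dt : (d < t)%R by rewrite -lte_fin /d fineK.
exists ((d + t) / 2)%R.
  apply/andP; split; first by rewrite divr_gt0// ltr_wpDl.
  by rewrite ltr_pdivrMr// mulr_natr mulr2n ltrD2r.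
apply: (@le_lt_trans _ _ (ratr q)%:E); last by rewrite lte_fin.
rewrite leNgt (rearr_gt H mf)// -leNgt -(fineK dfin) lee_fin.
by rewrite ler_pdivlMr// mulr_natr mulr2n lerD2l ltW.
Qed.

Lemma ae_not_jump :
  {ae leb, forall t : R, ~ (exists q : rat, distr mu D f (ratr q) = t%:E)}.
Proof.
have : countable [set t : R | exists q : rat, distr mu D f (ratr q) = t%:E].
  apply: (@sub_countable _ _ _ ((fun q : rat => fine (distr mu D f (ratr q))) @` setT)).
    by apply: subset_card_le => t [q /= qt]; exists q => //; rewrite qt.
  apply: card_le_trans (card_image_le _ _) _; exact: countableP.
exact: countable_negligible.
Qed.

End one_function.

Lemma integral_rearr_prod mu nu D D' v v' f g c :
  has_density mu D v -> has_density nu D' v' -> L0 D f -> L0 D' g ->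
  mu D <= c -> nu D' <= c ->
  \int[leb]_(t in oitv 0%R c) (rearr mu D f t * rearr nu D' g t) =
  min_integral (distr mu D f) (distr nu D' g).
Proof.
move=> H H' mf mg muc nuc.
under eq_integral do rewrite -[rearr nu _ _ _]mule1.
rewrite (min_integral_nincr (density_leb (measurable_oitv 0%R c))).
- apply: eq_integral => s /set_mem[s0 _]; apply: eq_integral => r /set_mem[r0 _].
  by rewrite (leb_rearr_level H mf muc (ltW s0)) (leb_rearr_level H' mg nuc (ltW r0)).
- by move=> s t _ _; exact: rearr_nincr.
- by move=> s t _ _; exact: rearr_nincr.
- by move=> s _; exact: rearr_ge0.
- by move=> s _; exact: rearr_ge0.
Qed.

Section decreasing.
Variables (c : \bar R) (f : R -> R).
Local Notation D := (oitv 0%R c).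
Hypothesis f0 : forall t, D t -> (0 <= f t)%R.
Hypothesis nf : forall s t, D s -> D t -> (s <= t)%R -> (f t <= f s)%R.

Lemma nincr_L0 : L0 D f.
Proof. by apply: nincr_measurable_fin; [exact: oitv_interval|]. Qed.
Let H := density_leb (measurable_oitv (0 : R)%R c).

Lemma nincr_distr mu s :
  distr mu D f s = mu (D `&` [set t | s%:E < (f t)%:E]).
Proof.
rewrite /distr; congr mu; apply/seteqP; split => t [Dt /=];
  by rewrite lte_fin ger0_norm ?f0.
Qed.

Lemma rearr_nincr_le t : D t -> rearr leb D f t <= (f t)%:E.
Proof.
move=> Dt; rewrite leNgt (rearr_gt H nincr_L0) ?f0// -leNgt.
have [t0 tc] := Dt; rewrite -[leRHS]leb_oitv0 ?lee_fin ?(ltW t0)// /distr.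
apply: (density_le H) => //.
- exact: measurable_level H _ nincr_L0 _.
- move=> s [Ds /=]; rewrite ger0_norm ?f0// => fts; split; first by case: Ds.
  by rewrite lte_fin ltNge; apply/negP => /(nf Dt Ds); rewrite leNgt fts.
- by move=> s [s0 st]; split => //; exact: lt_trans tc.
Qed.

(** On [(0,t)] the function is at least [f t], so its rearrangement is at least [f t] at every s <
    t. Off the countable exceptional set left continuity carries this bound to t. *)
Lemma rearr_nincr_ae : ae_on D (fun t => rearr leb D f t = (f t)%:E).
Proof.
rewrite /ae_on; apply: filterS (ae_not_jump (mu := leb) (D := D) (f := f)) => t nt Dt.
apply/eqP; rewrite eq_le rearr_nincr_le//= leNgt; apply/negP => ft.
have [t0 tc] := Dt.
have [s /andP[s0 st]] := rearr_left_cont H nincr_L0 t0 nt ft.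
rewrite ltNge => /negP; apply.
have Ds : D s by split => //; apply: lt_trans tc; rewrite lte_fin.
apply: le_ereal_inf_tmp => _ [u [u0 du] <-]; rewrite lee_fin leNgt; apply/negP => uft.
move: du; rewrite leNgt => /negP; apply.
have tc' : t%:E <= c by exact: ltW.
apply: (@lt_le_trans _ _ t%:E); first by rewrite lte_fin.
rewrite -[leLHS]leb_oitv0 ?lee_fin ?(ltW t0)// /distr.
apply: (density_le H) => //.
- exact: measurable_level H _ nincr_L0 _.
- move=> z [z0 zt]; have Dz : D z by split => //; exact: lt_trans tc.
  split => //=; rewrite ger0_norm ?f0//; apply: lt_le_trans uft _; apply: nf => //.
  by move: zt; rewrite lte_fin => /ltW.
Qed.

Lemma integral_rearr_nincr (x : \bar R) : x <= c ->
  \int[leb]_(t in oitv 0%R x) rearr leb D f t = \int[leb]_(t in oitv 0%R x) (f t)%:E.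
Proof.
move=> xc; apply: ae_eq_integral.
- exact: measurable_oitv.
- apply: nincr_measurable => [|s t _ _]; [exact: oitv_interval|exact: rearr_nincr].
- have [/= xs _] := downset_oitv xc.
  by apply/measurable_EFinP; apply: measurable_funS nincr_L0.
have := rearr_nincr_ae; rewrite /ae_on; apply: filterS => t h xt; apply: h.
by have [xs _] := downset_oitv xc; exact: xs.
Qed.

End decreasing.

End rearrangement.

(** * The least concave majorant and its level intervals *)

Section contact_sets.
Context {R : realType}.
Implicit Types (g : R -> R).

Lemma first_contact g (x y c : R) : continuous g -> x <= y -> g y = c ->
  exists2 m, x <= m <= y & g m = c /\ forall z, x <= z <= y -> g z = c -> m <= z.
Proof.
move=> cg xy gy.
have cZ : closed [set z | g z = c].
  by apply: (@preimage_closed _ _ g [set z | z = c]) => // z _; exact: cg.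
have Z0 : (`[x, y] `&` [set z | g z = c]) !=set0.
  by exists y; split => //=; rewrite in_itv/= xy lexx.
have [m] := compact_EVT_min (f := idfun) Z0
  (compact_closedI (@segment_compact _ x y) cZ) (continuous_subspaceT (fun x => @cvg_id _ (nbhs x))).
move=> /set_mem[/= mxy gm] hm; rewrite in_itv/= in mxy.
by exists m => //; split => // z zxy gz; apply: hm; apply/mem_set; split.
Qed.

Lemma last_contact g (x y c : R) : continuous g -> x <= y -> g x = c ->
  exists2 m, x <= m <= y & g m = c /\ forall z, x <= z <= y -> g z = c -> z <= m.
Proof.
move=> cg xy gy.
have cZ : closed [set z | g z = c].
  by apply: (@preimage_closed _ _ g [set z | z = c]) => // z _; exact: cg.
have Z0 : (`[x, y] `&` [set z | g z = c]) !=set0.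
  by exists x; split => //=; rewrite in_itv/= xy lexx.
have [m] := compact_EVT_max (f := idfun) Z0
  (compact_closedI (@segment_compact _ x y) cZ) (continuous_subspaceT (fun x => @cvg_id _ (nbhs x))).
move=> /set_mem[/= mxy gm] hm; rewrite in_itv/= in mxy.
by exists m => //; split => // z zxy gz; apply: hm; apply/mem_set; split.
Qed.

End contact_sets.

(* A named predicate, so that [lra] ignores these hypotheses on [\bar R]. *)
Definition below {R : realType} (a : \bar R) (t : R) : Prop := (t%:E < a)%E.

Section concave_majorant.
Context {R : realType}.
Variables (a : \bar R) (F W : R -> R).
Local Notation dom t := (0 <= t /\ below a t).
Local Notation psi rho s := (F s - rho * W s).
Hypotheses (F_cont : continuous F) (W_cont : continuous W).
Hypotheses (F0 : F 0 = 0) (W0 : W 0 = 0).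
Hypothesis F_nd : forall s t, 0 <= s -> s <= t -> F s <= F t.
Hypothesis W_incr : forall s t, dom s -> dom t -> s < t -> W s < W t.

Lemma W_le s t : dom s -> dom t -> s <= t -> W s <= W t.
Proof.
by move=> ds dt; rewrite le_eqVlt => /predU1P[->//|/(W_incr ds dt)/ltW].
Qed.

Lemma W_ge0 t : dom t -> 0 <= W t.
Proof.
move=> [t0 ta]; rewrite -W0; apply: W_le => //; split => //; rewrite /below in ta *.
by apply: le_lt_trans ta; rewrite lee_fin.
Qed.

Lemma dom_le s t : dom t -> 0 <= s -> s <= t -> dom s.
Proof. by move=> [_ ta] s0 st; split => //; rewrite /below in ta *; apply: le_lt_trans ta; rewrite lee_fin. Qed.

Lemma psi_cont rho : continuous (fun s => psi rho s).
Proof.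
move=> s; apply: cvgB; first exact: F_cont.
by apply: cvgM; [exact: cvg_cst|exact: W_cont].
Qed.

Lemma psi_max rho (x y : R) : x <= y -> exists2 s, x <= s <= y &
  forall z, x <= z <= y -> psi rho z <= psi rho s.
Proof.
move=> xy; have cp : {within `[x, y], continuous (fun s => psi rho s)}.
  by apply: continuous_subspaceT; exact: psi_cont.
have [s] := EVT_max xy cp; rewrite in_itv/= => sxy h.
by exists s => // z zxy; apply: h; rewrite in_itv.
Qed.

Definition contact (rho s : R) : Prop :=
  dom s /\ forall z, dom z -> psi rho z <= psi rho s.

Definition admissible (t rho : R) : Prop :=
  0 <= rho /\ exists2 s, s <= t & contact rho s.

(** Raising rho penalises large values of W: no point beyond t can overtake the contact point s, and
    so the maximum over [0,t] stays global. *)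
Lemma admissible_up t rho rho' : dom t -> rho <= rho' ->
  admissible t rho -> admissible t rho'.
Proof.
move=> dt rr [rho0 [s st [ds hs]]]; split; first exact: le_trans rr.
have [t0 ta] := dt; have [m /andP[m0 mt] hm] := psi_max rho' t0.
exists m => //; split; first exact: dom_le dt _ _.
move=> z dz; have [zt|/ltW tz] := leP z t.
  by apply: hm; rewrite zt (proj1 dz).
have := hm s; rewrite st (proj1 ds) => /(_ isT) h1.
have h2 := hs z dz; have h3 := W_le ds dz (le_trans st tz).
have : 0 <= (rho' - rho) * (W z - W s) by rewrite mulr_ge0 ?subr_ge0.
lra.
Qed.

(** If the maximum over [0,t] were beaten at some z, it would still be beaten at z after a small
    increase of rho. *)
Lemma admissible_closed t rho : dom t -> 0 <= rho ->
  (forall rho', rho < rho' -> admissible t rho') -> admissible t rho.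
Proof.
move=> dt rho0 H; split => //.
have [t0 ta] := dt; have [m /andP[m0 mt] hm] := psi_max rho t0.
exists m => //; split; first exact: dom_le dt _ _.
move=> z dz; rewrite leNgt; apply/negP => mz.
have W1 : 0 < W z + 1 by have := W_ge0 dz; lra.
(* Raising rho by e lowers the value at z by e * W z, less than half of the gap; the 1 keeps the
   denominator positive. *)
pose e := (psi rho z - psi rho m) / (W z + 1) / 2.
have e0 : 0 < e by rewrite !divr_gt0// subr_gt0.
have eW : e * (W z + 1) * 2 = psi rho z - psi rho m.
  by rewrite /e; field; rewrite gt_eqF.
have [|_ [s st [ds hs]]] := H (rho + e); first by rewrite ltrDl.
have h1 := hs z dz; have := hm s; rewrite st (proj1 ds) => /(_ isT) h2.
have h3 : 0 <= e * W s by rewrite mulr_ge0 ?(ltW e0)// W_ge0.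
lra.
Qed.

Definition slope (t : R) : R := inf [set rho | admissible t rho].

Section has_slope.
Hypothesis has_adm : forall t, 0 < t -> below a t -> exists rho, admissible t rho.
Local Notation I t := (0 < t /\ below a t).

Lemma I_dom t : I t -> dom t. Proof. by case=> /ltW. Qed.

Lemma adm_has_inf t : I t -> has_inf [set rho | admissible t rho].
Proof. by move=> [t0 ta]; split; [exact: has_adm|exists 0 => rho []]. Qed.

Lemma slope_ge0 t : I t -> 0 <= slope t.
Proof.
by move=> It; apply: lb_le_inf; [exact: (adm_has_inf It).1|move=> rho []].
Qed.

Lemma slope_adm t : I t -> admissible t (slope t).
Proof.
move=> It; apply: admissible_closed; [exact: I_dom|exact: slope_ge0|move=> rho].
move=> /(inf_lt (adm_has_inf It).1)[r ar rr].
by apply: admissible_up ar; [exact: I_dom|exact: ltW].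
Qed.

Lemma slope_nincr s t : I s -> I t -> s <= t -> slope t <= slope s.
Proof.
move=> Is It st; apply: ge_inf; first exact: (adm_has_inf It).2.
have [h0 [x xs cx]] := slope_adm Is; split => //; exists x => //.
exact: le_trans st.
Qed.

(** For rho below the slope the maximum over [0,t] is not global. A point that beats it lies beyond
    t, and it beats x as well. *)
Lemma chord_above t x rho : I t -> dom x -> x <= t -> 0 <= rho -> rho < slope t ->
  exists2 s, dom s /\ t < s & rho * (W s - W x) < F s - F x.
Proof.
move=> It dx xt rho0 rt; have nadm : ~ admissible t rho.
  by move=> h; move: rt; rewrite ltNge ge_inf//; exact: (adm_has_inf It).2.
have dt := I_dom It; have [t0 _] := dt.
have [m /andP[m0 mt] hm] := psi_max rho t0.
have /existsNP[s /not_implyP[ds /negP]] : ~ forall z, dom z -> psi rho z <= psi rho m.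
  move=> h; apply: nadm; split => //; exists m => //; split => //.
  exact: dom_le dt _ _.
rewrite -ltNge => ms; exists s.
  split => //; rewrite ltNge; apply/negP => st.
  by move: ms; rewrite ltNge hm// st (proj1 ds).
by have := hm x; rewrite xt (proj1 dx) => /(_ isT); lra.
Qed.

Lemma contact_exists t : I t -> exists2 s, s <= t & contact (slope t) s.
Proof. by case/slope_adm. Qed.

(** Some contact point at or before t, not necessarily the first one; [level_exists] moves to the
    first one. *)
Definition left_contact (t : R) : R :=
  xget 0 [set s | s <= t /\ contact (slope t) s].

Lemma left_contactP t : I t ->
  left_contact t <= t /\ contact (slope t) (left_contact t).
Proof.
move=> /contact_exists[s st cs].
by have := xgetI (P := [set s | s <= t /\ contact (slope t) s]) 0 (conj st cs).
Qed.

Definition majorant (t : R) : R :=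
  F (left_contact t) + slope t * (W t - W (left_contact t)).

Lemma le_majorant t : I t -> F t <= majorant t.
Proof.
move=> It; have [_ [_ /(_ t (I_dom It))]] := left_contactP It.
rewrite /majorant; lra.
Qed.

(** The left end of the chord is the contact point. A contact to the right of t may not exist inside
    I, so the right end comes from a slope slightly below [slope t], at a loss of at most e. *)
Lemma majorant_chord t e : I t -> 0 < e ->
  exists x y l, [/\ dom x, dom y, 0 <= l <= 1,
    l * W x + (1 - l) * W y = W t & majorant t - e <= l * F x + (1 - l) * F y].
Proof.
move=> It e0; have [xt cx] := left_contactP It; set x := left_contact t in xt cx *.
have dt := I_dom It; have dx := proj1 cx.
have k0 := slope_ge0 It; have Wxt := W_le dx dt xt.
(* At slope 0 there is no smaller nonnegative slope to pass to. But F is nondecreasing, so t is as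
   good as the contact point. *)
have [k_eq0|k_neq0] := eqVneq (slope t) 0.
  exists t, t, 1; split => //; first by rewrite ler01 lexx.
    lra.
  by rewrite /majorant k_eq0 -/x; have := F_nd (proj1 dx) xt; lra.
have {}k0 : 0 < slope t by rewrite lt_neqAle eq_sym k_neq0.
(* Lowering the slope by d costs d * (W t - W x) at t; the 1 covers the case x = t, and the minimum
   keeps the lowered slope nonnegative. *)
pose d := Num.min (slope t) (e / (W t - W x + 1)).
have W1 : 0 < W t - W x + 1 by lra.
have d0 : 0 < d by rewrite lt_min k0 divr_gt0.
have dk : d <= slope t by rewrite ge_min lexx.
have de : d * (W t - W x) <= e.
  have : d * (W t - W x + 1) <= e by rewrite -ler_pdivlMr// ge_min lexx orbT.
  lra.
have [||s [ds ts] hs] := @chord_above t x (slope t - d) It dx xt; [lra|lra|].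
have Wxs : 0 < W s - W x by rewrite subr_gt0 W_incr//; exact: le_lt_trans xt ts.
have Wts : 0 < W s - W t by rewrite subr_gt0 W_incr.
pose l := (W s - W t) / (W s - W x).
have lE : l * (W s - W x) = W s - W t by rewrite /l divfK// gt_eqF.
have l1 : 1 - l = (W t - W x) / (W s - W x) by rewrite /l; field; rewrite gt_eqF.
exists x, s, l; split => //.
- apply/andP; split; first by rewrite divr_ge0// ltW.
  by rewrite ler_pdivrMr//; lra.
- lra.
rewrite /majorant -/x.
have h1 : (1 - l) * ((slope t - d) * (W s - W x)) <= (1 - l) * (F s - F x).
  by rewrite ler_wpM2l ?(ltW hs)// l1 divr_ge0 ?(ltW Wxs)// subr_ge0.
have h2 : (1 - l) * (W s - W x) = W t - W x by lra.
have h3 : (1 - l) * ((slope t - d) * (W s - W x)) = (slope t - d) * (W t - W x).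
  by rewrite -h2; ring.
lra.
Qed.

(** Minimality of the majorant: up to e its value is a convex combination of values of F, which lies
    below every affine function of W above F. *)
Lemma majorant_affine t c rho : I t -> 
  (forall s, dom s -> F s <= c + rho * W s) -> majorant t <= c + rho * W t.
Proof.
move=> It h; apply/ler_addgt0Pl => e e0.
have [x [y [l [dx dy /andP[l0 l1] hW hF]]]] := majorant_chord It e0.
have h1 : l * F x <= l * (c + rho * W x) by rewrite ler_wpM2l// h.
have h2 : (1 - l) * F y <= (1 - l) * (c + rho * W y).
  by rewrite ler_wpM2l ?subr_ge0// h.
rewrite -hW; lra.
Qed.

(** The supporting line at [left_contact t] lies above F, hence above the majorant by minimality,
    and meets it at t. *)
Lemma majorant_supergradient s t : I s -> I t ->
  majorant s <= majorant t + slope t * (W s - W t).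
Proof.
move=> Is It; have [_ [dx hx]] := left_contactP It.
have := @majorant_affine s (F (left_contact t) - slope t * W (left_contact t))
  (slope t) Is; rewrite /majorant.
move=> H; have : forall z, dom z -> F z <= F (left_contact t) -
    slope t * W (left_contact t) + slope t * W z by move=> z /hx; lra.
by move=> /H; lra.
Qed.

Lemma majorant_ge0 t : I t -> 0 <= majorant t.
Proof.
move=> It; apply: le_trans (le_majorant It); rewrite -F0.
by apply: F_nd => //; exact: (ltW (proj1 It)).
Qed.

(** The slopes may be unbounded near 0, so one supporting line is fixed, at a small t1. It lies
    above the majorant everywhere, and its intercept is at most F at the contact point, which is
    small. *)
Lemma majorant_near0 e : (0 < a)%E -> 0 < e ->
  exists2 d, 0 < d & forall t, I t -> t < d -> majorant t <= e.
Proof.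
move=> a0 e0.
have small (g : R -> R) : continuous g -> g 0 = 0 -> forall e, 0 < e ->
    exists2 d, 0 < d & forall t, 0 <= t -> t < d -> g t <= e.
  move=> cg g0 e1 e10; have /cvgrPdist_le/(_ e1 e10) := cg 0.
  move=> /nbhs_ballP[d d0 hd]; exists d => // t t0 td.
  have : ball (0 : R) d t by rewrite /ball/= sub0r normrN ger0_norm.
  by move=> /hd /=; rewrite g0 sub0r normrN; apply: le_trans; rewrite ler_norm.
have e20 : 0 < e / 2 by rewrite divr_gt0.
have [d1 d10 hd1] := small F F_cont F0 (e / 2) e20.
have [t1 It1 t1d] : exists2 t1, I t1 & t1 < d1.
  rewrite /below; move: a0; case: a => [r| |] //; rewrite ?lte_fin => r0.
    exists (Num.min r d1 / 2).
      split; first by rewrite divr_gt0// lt_min r0.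
      have : Num.min r d1 <= r by rewrite ge_min lexx.
      by rewrite lte_fin ltr_pdivrMr//; lra.
    have : Num.min r d1 <= d1 by rewrite ge_min lexx orbT.
    by rewrite ltr_pdivrMr//; lra.
  by exists (d1 / 2); [split; [rewrite divr_gt0|rewrite ltry]|rewrite ltr_pdivrMr//; lra].
clear a0; have [xt1 [dx hx]] := left_contactP It1; set x := left_contact t1 in xt1 dx hx.
have k0 := slope_ge0 It1; have k1 : 0 < slope t1 + 1 by lra.
have [d2 d20 hd2] := small W W_cont W0 (e / 2 / (slope t1 + 1)) (divr_gt0 e20 k1).
exists d2 => // t It td2.
have := @majorant_affine t (F x - slope t1 * W x) (slope t1) It.
have h0 z : dom z -> F z <= F x - slope t1 * W x + slope t1 * W z by move=> /hx; lra.
move=> /(_ h0) h1.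
have h2 := hd2 t (ltW (proj1 It)) td2.
have h3 : slope t1 * W t <= e / 2.
  have : (slope t1 + 1) * W t <= e / 2 by rewrite mulrC -ler_pdivlMr.
  by have := W_ge0 (I_dom It); lra.
have h4 : F x <= e / 2.
  by apply: hd1; [case: dx|exact: le_lt_trans xt1 t1d].
have h5 : 0 <= slope t1 * W x by rewrite mulr_ge0// W_ge0.
lra.
Qed.

End has_slope.

(* Bisecting in the variable [W] halves the total error at each step. *)
Lemma sandwich_unique (c : R) (k P Q : R -> R) : 0 <= c ->
  (forall s t, c <= s -> below a t -> s <= t ->
     k t * (W t - W s) <= P t - P s <= k s * (W t - W s)) ->
  (forall s t, c <= s -> below a t -> s <= t ->
     k t * (W t - W s) <= Q t - Q s <= k s * (W t - W s)) ->
  forall s t, c <= s -> below a t -> s <= t -> P t - P s = Q t - Q s.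
Proof.
move=> c0 hP hQ.
have bisect n : forall s t, c <= s -> below a t -> s <= t ->
    `|(P t - P s) - (Q t - Q s)| * 2 ^+ n <= (k s - k t) * (W t - W s).
  elim: n => [|n IH] s t s0 ta st.
    rewrite expr0 mulr1 ler_norml.
    by have /andP[? ?] := hP s t s0 ta st; have /andP[? ?] := hQ s t s0 ta st; lra.
  have dt : dom t by split => //; exact: le_trans c0 (le_trans s0 st).
  have ds : dom s := dom_le dt (le_trans c0 s0) st.
  have Wst := W_le ds dt st.
  have [||m] := @IVT R W s t ((W s + W t) / 2) st.
  - exact: continuous_subspaceT.
  - by rewrite minEle maxEle Wst; lra.
  rewrite in_itv/= => /andP[sm mt] Wm.
  have ma : below a m by apply: le_lt_trans ta; rewrite lee_fin.
  have h1 := IH s m s0 ma sm; have h2 := IH m t (le_trans s0 sm) ta mt.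
  rewrite Wm in h1 h2.
  have -> : (P t - P s) - (Q t - Q s) =
    ((P m - P s) - (Q m - Q s)) + ((P t - P m) - (Q t - Q m)) by ring.
  have := ler_normD ((P m - P s) - (Q m - Q s)) ((P t - P m) - (Q t - Q m)).
  move=> h3; have := ler_wpM2r (exprn_ge0 n (ler0n R 2)) h3.
  rewrite exprS; lra.
move=> s t s0 ta st; apply/eqP; rewrite -subr_eq0 -normr_eq0 eq_le normr_ge0 andbT.
rewrite leNgt; apply/negP => p0.
set A := `|_| in p0; set B := (k s - k t) * (W t - W s).
have B0 : 0 <= B by have := bisect 0%N s t s0 ta st; rewrite expr0 mulr1 -/A -/B; lra.
have [n hn] : exists n : nat, B / A < n%:R.
  by exists (Num.bound (B / A)); apply: archi_boundP; rewrite divr_ge0// ltW.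
have := bisect n s t s0 ta st; rewrite -/A -/B.
have : n%:R <= 2 ^+ n :> R by rewrite -natrX ler_nat; exact: ltnW (ltn_expl _ _).
move: hn; rewrite ltr_pdivrMr// => hn h1 h2.
have := ler_wpM2l (ltW p0) h1; lra.
Qed.

(** * Maximal level intervals and contact points *)

Section level_intervals.
Variables (w f : R -> R).
Local Notation II := (oitv 0 a).
Local Notation ratio := (level_ratio II w f).
Local Notation I t := (0 < t /\ below a t).
Hypothesis a_gt0 : below a 0.
Hypothesis ratio_fin : forall x y, dom x -> dom y -> x < y ->
  ratio x y%:E = ((F y - F x) / (W y - W x))%:E.
(** This and the next hypothesis are the two halves of the limsup that defines the ratio up to an
    infinite end. For finite [a] they follow from continuity, which allows both cases to be treated
    together. *)
Hypothesis ratio_end_lt : forall x rho M, dom x -> dom M -> (rho%:E < ratio x a)%E ->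
  exists s, [/\ dom s, M < s, x < s & rho * (W s - W x) < F s - F x].
Hypothesis ratio_end_gt : forall x rho, dom x -> (ratio x a < rho%:E)%E ->
  exists2 M, dom M & forall s, dom s -> M < s -> x < s ->
    F s - F x <= rho * (W s - W x).

Lemma W_sub_gt0 x y : dom x -> dom y -> x < y -> 0 < W y - W x.
Proof. by move=> dx dy xy; rewrite subr_gt0 W_incr. Qed.

Lemma ereal_dense_above (y : R) (be : \bar R) :
  (y%:E < be)%E -> exists2 x, y < x & (x%:E < be)%E.
Proof.
case: be => [r| |] //; last by exists (y + 1); [rewrite ltrDl|rewrite ltry].
rewrite lte_fin => yr; exists ((y + r) / 2); last rewrite lte_fin.
  by rewrite ltr_pdivlMr//; lra.
by rewrite ltr_pdivrMr//; lra.
Qed.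

Lemma oitv_sub_bounds (x x' : R) (y y' : \bar R) : (x%:E < y)%E ->
  oitv x y `<=` oitv x' y' -> x' <= x /\ (y <= y')%E.
Proof.
move=> xy sub; split.
  rewrite leNgt; apply/negP => xx'.
  have [z xz] : exists2 z, x < z & (z%:E < Order.min y x'%:E)%E.
    by apply: ereal_dense_above; rewrite lt_min xy lte_fin.
  rewrite lt_min lte_fin => /andP[zy zx']; have [] := sub z (conj xz zy).
  by move=> /(lt_trans zx'); rewrite ltxx.
rewrite leNgt; apply/negP; move: sub; case: y' => [r| |] sub yy'.
- have [z] : exists2 z, Num.max x r < z & (z%:E < y)%E.
    by apply: ereal_dense_above; rewrite EFin_max gt_max xy.
  rewrite gt_max => /andP[xz rz] zy; have [_] := sub z (conj xz zy).
  by rewrite lte_fin => /(lt_trans rz); rewrite ltxx.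
- by move: yy'; rewrite ltNge leey.
- by have [z xz zy] := ereal_dense_above xy; have [_] := sub z (conj xz zy).
Qed.

Lemma level_bounds x y : level_interval II w f x y ->
  [/\ (x%:E < y)%E, dom x & (y = a \/ exists2 r, y = r%:E & dom r)].
Proof.
move=> [xy sub _ _]; have [x0 ya] := oitv_sub_bounds xy sub.
have dx : dom x by split => //; rewrite /below; exact: lt_le_trans ya.
split => //; move: ya; rewrite le_eqVlt => /predU1P[->|ya]; first by left.
right; move: xy ya {sub}; case: y => [r| |] //.
  rewrite lte_fin => /ltW xr ra; exists r => //; split => //.
  exact: le_trans xr.
by move=> _; rewrite ltNge leey.
Qed.

Lemma level_le x y t : level_interval II w f x y -> x < t -> (t%:E < y)%E ->
  (((F t - F x) / (W t - W x))%:E <= ratio x y)%E.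
Proof.
move=> L xt ty; have [xy dx yc] := level_bounds L; have [_ sub _] := L.
move=> /(_ t (conj xt ty)); rewrite ratio_fin//.
split; first exact: le_trans (proj1 dx) (ltW xt).
by have [_] := sub t (conj xt ty).
Qed.

(** The chord from x to z has slope at least rho, as z is a contact, and at most the ratio, as the
    interval is a level interval. Chords starting at z have slope at most rho, which pulls the ratio
    down to rho; then the ends lie on the same supporting line. *)
Lemma contact_in_level x y z rho : level_interval II w f x y -> x < z ->
  (z%:E < y)%E -> contact rho z -> [/\ ratio x y = rho%:E, contact rho x &
    y = a \/ exists2 r, y = r%:E & contact rho r].
Proof.
move=> L xz zy [dz hz]; have [xy dx yc] := level_bounds L.
have Wxz := W_sub_gt0 dx dz xz; have Lz := level_le L xz zy.
have hx := hz x dx.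
have cx : ratio x y = rho%:E -> contact rho x.
  move=> e; split => // s ds; have := hz s ds; move: Lz.
  by rewrite e lee_fin ler_pdivrMr//; lra.
have ge : (rho%:E <= ratio x y)%E.
  by apply: le_trans Lz; rewrite lee_fin ler_pdivlMr//; lra.
case: yc => [ya|[r yr dr]].
  suff e : ratio x y = rho%:E by split; [|exact: cx|left].
  apply/eqP; rewrite eq_le ge andbT leNgt; apply/negP => lt.
  have [z' zz' z'a] := ereal_dense_above zy.
  rewrite ya in lt Lz z'a zy.
  have dz' : dom z' by split => //; exact: le_trans (proj1 dz) (ltW zz').
  have Wzz' := W_sub_gt0 dz dz' zz'.
  (* far out the chords from [x] have slope close to the ratio, whereas the
     contact at [z] bounds their slope beyond [z] by [rho] *)
  have step r : rho <= r -> (r%:E < ratio x a)%E ->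
      r * (W z - W x) + (r - rho) * (W z' - W z) <= F z - F x.
    move=> rhor rlt; have [s [ds sz' _ hs]] := ratio_end_lt dx dz' rlt.
    have := hz s ds; have := W_sub_gt0 dz' ds sz' => h1 h2.
    have : 0 <= (r - rho) * (W s - W z') by rewrite mulr_ge0 ?subr_ge0// ltW// -subr_gt0.
    lra.
  move: lt Lz step; case: (ratio x a) => [p| |] //.
    rewrite lte_fin lee_fin ler_pdivrMr// => rp h1 step.
    have pr : 0 < (p - rho) * (W z' - W z) by rewrite mulr_gt0// subr_gt0.
    pose S := W z' - W x; have S0 : 0 < S by rewrite /S; lra.
    (* [step] at p - e gives (p - rho) * (W z' - W z) <= e * S; this e makes the right side at most
       half of the left. *)
    pose e := Num.min (p - rho) ((p - rho) * (W z' - W z) / S / 2).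
    have e0 : 0 < e by rewrite lt_min subr_gt0 rp/= !divr_gt0.
    have e1 : e <= p - rho by rewrite ge_min lexx.
    have e2 : e * S * 2 <= (p - rho) * (W z' - W z).
      have : e <= (p - rho) * (W z' - W z) / S / 2 by rewrite ge_min lexx orbT.
      by rewrite ler_pdivlMr// ler_pdivlMr// mulrAC.
    have : rho <= p - e by lra.
    move=> /step; rewrite lte_fin ltrBlDr ltrDl => /(_ e0).
    by rewrite /S in e2; lra.
  move=> _ _ step.
  (* With an infinite ratio [step] accepts every slope above rho; one unit above both rho and the
     slope of the chord from x to z is already contradictory. *)
  have r1 : rho <= Num.max rho ((F z - F x) / (W z - W x)) by rewrite le_max lexx.
  have r2 : (F z - F x) / (W z - W x) <= Num.max rho ((F z - F x) / (W z - W x)).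
    by rewrite le_max lexx orbT.
  move: r1 r2; set r := Num.max _ _ => r1; rewrite ler_pdivrMr// => r2.
  have := step (r + 1) _ (ltry _); rewrite ler_wpDr// => /(_ isT).
  have : 0 < (r + 1 - rho) * (W z' - W z) by rewrite mulr_gt0//; lra.
  lra.
have xr : x < r by rewrite yr lte_fin in xy.
have zr : z < r by rewrite yr lte_fin in zy.
have Wzr := W_sub_gt0 dz dr zr; have hr := hz r dr.
have Wxr := W_sub_gt0 dx dr xr.
set p := (F r - F x) / (W r - W x).
have pE : p * (W r - W x) = F r - F x by rewrite /p divfK// gt_eqF.
have rp : ratio x y = p%:E by rewrite yr ratio_fin.
rewrite rp !lee_fin in ge Lz; rewrite ler_pdivrMr// in Lz.
have pe : p = rho.
  apply/eqP; rewrite eq_le ge andbT -(ler_pM2r Wzr); lra.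
rewrite pe in pE rp; split => //; first exact: cx.
right; exists r => //; split => // s ds; have := hz s ds.
rewrite pe in Lz; lra.
Qed.

Section no_slope.
Variable t0 : R.
Hypotheses (It0 : I t0) (nadm : ~ exists rho, admissible t0 rho).

(** F - rho * W vanishes at 0, and a point that beats its maximum over [0,t0] beats 0 too. *)
Lemma unbounded_chords rho : 0 <= rho ->
  exists s, [/\ dom s, t0 < s & rho * W s < F s].
Proof.
move=> rho0; have dt0 := I_dom It0; have [m /andP[m0 mt] hm] := psi_max rho (proj1 dt0).
have /existsNP[s /not_implyP[ds /negP]] : ~ forall z, dom z -> psi rho z <= psi rho m.
  move=> h; apply: nadm; exists rho; split => //; exists m => //; split => //.
  exact: dom_le dt0 _ _.
rewrite -ltNge => ms; exists s; split => //.
  rewrite ltNge; apply/negP => st.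
  by move: ms; rewrite ltNge hm// st (proj1 ds).
have := hm 0; rewrite lexx (proj1 dt0) F0 W0 => /(_ isT); lra.
Qed.

Lemma ratio_unbounded : ratio 0 a = +oo%E.
Proof.
have d0 : dom (0 : R) by split.
apply/eqP; rewrite -leye_eq leNgt; apply/negP => lt.
have [r ra] : exists r : R, (ratio 0 a < r%:E)%E.
  move: lt; case: (ratio 0 a) => [p| |] //=.
    by exists (p + 1); rewrite lte_fin ltrDl.
  by exists 0; rewrite ltNyr.
have [M dM hM] := ratio_end_gt d0 ra.
have Wt0 : 0 < W t0 by rewrite -W0 W_incr//; [exact: I_dom|case: It0].
(* The bound r rules out s beyond M. For s up to M, F s <= F M <= rho * W t0 <= rho * W s does. *)
pose rho := Num.max 0 (Num.max r (F M / W t0)).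
have rho0 : 0 <= rho by rewrite le_max lexx.
have rho1 : r <= rho by rewrite !le_max lexx orbT.
have rho2 : F M <= rho * W t0 by rewrite -ler_pdivrMr// !le_max lexx !orbT.
have [s [ds ts hs]] := unbounded_chords rho0.
have Ws : W t0 <= W s by apply: W_le => //; [exact: I_dom|exact: ltW].
have [Ms|sM] := ltP M s.
  have := hM s ds Ms (lt_trans (proj1 It0) ts); rewrite F0 W0 !subr0 => h.
  have : 0 <= (rho - r) * W s by rewrite mulr_ge0 ?W_ge0// subr_ge0.
  lra.
have := F_nd (proj1 ds) sM.
have : 0 <= rho * (W s - W t0) by rewrite mulr_ge0// subr_ge0.
lra.
Qed.

(** [I] itself is a level interval, its ratio being infinite, so the maximal level interval selected
    at t must be all of [I]. *)
Lemma level_function_unbounded t : I t -> 0 < w t ->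
  level_function II w f t = +oo%E.
Proof.
move=> It wt.
have L0a : level_interval II w f 0 a.
  by split => //; [rewrite ratio_unbounded|move=> s _; rewrite ratio_unbounded leey].
have ML : max_level_interval II w f 0 a.
  by split => // x y [_ sub _ _] sub'; apply/seteqP.
rewrite /level_function; set S := (X in `[< X !=set0 >]).
have St : S (0, a) by split.
rewrite asboolT; last by exists (0, a).
have [[L maxL] pt] : S (xget (0, 0%E) S) by exact: xgetI St.
move: L maxL pt; case: (xget _ _) => x y /= L maxL pt.
have [_ sub _ _] := L; have e := maxL _ _ L0a sub.
have [xy _ _] := level_bounds L.
have [x0 ay] : x <= 0 /\ (a <= y)%E by apply: oitv_sub_bounds; rewrite ?e.
have [x0' ya] := oitv_sub_bounds xy sub.
have -> : x = 0 by apply/le_anti/andP.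
have -> : y = a by apply/le_anti/andP.
by rewrite ratio_unbounded gt0_mulye// lte_fin.
Qed.

End no_slope.

Hypothesis has_adm : forall t, 0 < t -> below a t -> exists rho, admissible t rho.

Lemma not_contact_slope_gt0 t : I t -> ~ contact (slope t) t -> 0 < slope t.
Proof.
move=> It nc; rewrite lt_neqAle slope_ge0// andbT; apply/eqP => k0; apply: nc.
have [xt [dx hx]] := left_contactP has_adm It; split; first exact: I_dom.
move=> z /hx; rewrite -k0 => h.
by have := F_nd (proj1 dx) xt; lra.
Qed.

(** The interval runs from the first contact of slope [slope t] to the last one, or to [a] when the
    ratio up to [a] still equals that slope. *)
Lemma level_exists t : I t -> ~ contact (slope t) t -> exists x y,
  [/\ max_level_interval II w f x y, oitv x y t, ratio x y = (slope t)%:E,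
      contact (slope t) x & y = a \/ exists2 r, y = r%:E & contact (slope t) r].
Proof.
move=> It nc; have rho0 := not_contact_slope_gt0 It nc.
have [x0t cx0] := left_contactP has_adm It.
set rho := slope t in rho0 nc cx0 *; set x0 := left_contact t in x0t cx0.
have dt := I_dom It.
have [x /andP[x_ge0 xx0] [gx minx]] := first_contact (@psi_cont rho)
  (proj1 (proj1 cx0)) (erefl (psi rho x0)).
have dx : dom x := dom_le (proj1 cx0) x_ge0 xx0.
have cx : contact rho x by split => // z dz; rewrite gx; exact: (proj2 cx0).
have minx' z : contact rho z -> x <= z.
  move=> [dz hz]; have [zx0|/ltW x0z] := leP z x0; last exact: le_trans x0z.
  apply: minx; first by rewrite zx0 (proj1 dz).
  by apply/eqP; rewrite eq_le (proj2 cx0 z dz) hz//; case: cx0.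
have xt : x < t.
  have := le_trans xx0 x0t; rewrite le_eqVlt => /predU1P[e|//].
  by exfalso; apply: nc; rewrite -e.
have le_rho s : dom s -> x < s -> (F s - F x) / (W s - W x) <= rho.
  move=> ds xs; rewrite ler_pdivrMr; last exact: W_sub_gt0.
  by have := proj2 cx s ds; lra.
have ra : (ratio x a <= rho%:E)%E.
  rewrite leNgt; apply/negP => /(ratio_end_lt dx dx)[s [ds xs _]].
  by have := proj2 cx s ds; lra.
have dom_in y s : (y <= a)%E -> oitv x y s -> dom s.
  move=> ya [xs sy]; split; first exact: le_trans (ltW xs).
  exact: lt_le_trans ya.
have level y : (y <= a)%E -> (x%:E < y)%E -> ratio x y = rho%:E ->
    level_interval II w f x y.
  move=> ya xy e; split => //.
  - move=> s [xs sy]; split; first exact: le_lt_trans xs.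
    exact: lt_le_trans ya.
  - by rewrite e lte_fin.
  - move=> s xys; have ds := dom_in _ _ ya xys; have [xs _] := xys.
    by rewrite e ratio_fin// lee_fin le_rho.
(* A level interval starting further left would contain the contact x, and its left end would be an
   earlier contact. *)
have left_end x' y' : level_interval II w f x' y' -> x' <= x -> (x%:E < y')%E ->
    x' = x.
  move=> L'; rewrite le_eqVlt => /predU1P[//|x'x] xy'.
  have [_ cx' _] := contact_in_level L' x'x xy' cx.
  by move: x'x; rewrite ltNge minx'.
have [re|re] := eqVneq (ratio x a) rho%:E.
  exists x, a; split => //; [|by split => //; case: It|by left].
  split; first by apply: level => //; exact: proj2 dx.
  move=> x' y' L' sub; have [x'x ay'] := oitv_sub_bounds (proj2 dx) sub.
  have [x'y' sub' _ _] := L'; have [_ y'a] := oitv_sub_bounds x'y' sub'.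
  by rewrite (left_end x' y' L' x'x (lt_le_trans (proj2 dx) ay'))
    (le_anti (introT andP (conj ay' y'a))).
have {}ra : (ratio x a < rho%:E)%E by rewrite lt_neqAle re.
(* Beyond some M all chords from x have slope at most rho1 < rho. This confines the contacts to
   [0,M], so that a last one can exist. *)
have [rho1 ra1 rho1_lt] : exists2 r, (ratio x a < r%:E)%E & r < rho.
  move: ra; case: (ratio x a) => [p| |] //=.
    rewrite lte_fin => prho; exists ((p + rho) / 2); rewrite ?lte_fin;
    [rewrite ltr_pdivlMr//|rewrite ltr_pdivrMr//]; lra.
  by exists (rho - 1); [rewrite ltNyr|rewrite ltrBlDr ltrDl].
have [M0 dM0 hM0] := ratio_end_gt dx ra1.
pose M := Num.max M0 t.
have dM : dom M by rewrite /M; case: (leP M0 t).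
have tM : t <= M by rewrite le_max lexx orbT.
have hM s : dom s -> M < s -> F s - F x <= rho1 * (W s - W x).
  rewrite gt_max => ds /andP[h1 h2]; apply: hM0 => //; exact: lt_trans h2.
have noM z : contact rho z -> z <= M.
  move=> [dz hz]; rewrite leNgt; apply/negP => Mz.
  have xz : x < z by apply: lt_trans Mz; apply: lt_le_trans tM.
  have h1 := hM z dz Mz; have h2 := hz x dx; have h3 := W_sub_gt0 dx dz xz.
  have : 0 < (rho - rho1) * (W z - W x) by rewrite mulr_gt0// subr_gt0.
  lra.
have [s0 /andP[ts0 s0M] hs0] := psi_max rho tM.
have ds0 : dom s0 := dom_le dM (le_trans (proj1 dt) ts0) s0M.
(* The maximum over [t,M] is global. Otherwise a slope r just below rho gives a chord from x to some
   s > t steeper than r; s cannot exceed M because rho1 <= r, and r is close enough to rho for s to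
   beat s0. *)
have cs0 : contact rho s0.
  split => // z dz; apply: le_trans (proj2 cx z dz) _.
  rewrite leNgt; apply/negP => lt.
  have WM : 0 < W M - W x by apply: W_sub_gt0 => //; exact: lt_le_trans tM.
  pose d := psi rho x - psi rho s0; have d0 : 0 < d by rewrite subr_gt0.
  pose r := Num.max 0 (Num.max rho1 (rho - d / (W M - W x))).
  have r0 : 0 <= r by rewrite le_max lexx.
  have r1 : rho1 <= r by rewrite !le_max lexx orbT.
  have r2 : rho - d / (W M - W x) <= r by rewrite !le_max lexx !orbT.
  have rr : r < rho by rewrite !gt_max rho0 rho1_lt/= ltrBlDr ltrDl divr_gt0.
  have [s [ds ts] hs] := chord_above has_adm It dx (ltW xt) r0 rr.
  have xs : x < s := lt_trans xt ts; have Wxs := W_sub_gt0 dx ds xs.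
  have [sM|Ms] := leP s M.
    have h1 := hs0 s; rewrite sM (ltW ts) in h1; have {}h1 := h1 isT.
    have h2 : (rho - r) * (W s - W x) <= d.
      have h3 : (rho - r) * (W M - W x) <= d by rewrite -ler_pdivlMr//; lra.
      apply: le_trans h3; rewrite ler_pM2l ?subr_gt0// lerB//.
      exact: W_le.
    by rewrite /d in h2; lra.
  have := hM s ds Ms; have : 0 <= (r - rho1) * (W s - W x).
    by rewrite mulr_ge0 ?(ltW Wxs)// subr_ge0.
  lra.
have [y /andP[s0y yM] [gy maxy]] := last_contact (@psi_cont rho) s0M
  (erefl (psi rho s0)).
have dy : dom y := dom_le dM (le_trans (proj1 ds0) s0y) yM.
have cy : contact rho y by split => // z dz; rewrite gy; exact: (proj2 cs0).
have maxy' z : contact rho z -> z <= y.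
  move=> cz; have [s0z|/ltW zs0] := leP s0 z; last exact: le_trans s0y.
  apply: maxy; first by rewrite s0z noM.
  by apply/eqP; rewrite eq_le (proj2 cs0 z (proj1 cz)) (proj2 cz).
have ty : t < y.
  have := le_trans ts0 s0y; rewrite le_eqVlt => /predU1P[e|//].
  by exfalso; apply: nc; rewrite e.
have xy : x < y := lt_trans xt ty.
have e : ratio x y%:E = rho%:E.
  rewrite ratio_fin//; congr (_%:E); apply/eqP; rewrite eq_le le_rho//=.
  rewrite ler_pdivlMr; last exact: W_sub_gt0.
  by have := proj2 cy x dx; lra.
exists x, y%:E; split => //; last by right; exists y.
have xyE : (x%:E < y%:E)%E by rewrite lte_fin.
split; first by apply: level => //; exact: ltW (proj2 dy).
move=> x' y' L' sub; have [x'x yy'] := oitv_sub_bounds xyE sub.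
have x'E : x' = x by apply: left_end L' x'x _; exact: lt_le_trans yy'.
rewrite {x'x sub}x'E in L' *; congr (oitv _ _); apply/eqP.
rewrite eq_le yy' /= leNgt; apply/negP => {}yy'.
have [e' _ [y'a|[r y'r cr]]] := contact_in_level L' xy yy' cy.
  by move: e' re; rewrite y'a => ->; rewrite eqxx.
by move: yy'; rewrite y'r lte_fin ltNge maxy'.
Qed.

(** A contact of slope [slope t] inside (x,y) settles the ratio. If neither t, nor [left_contact t],
    nor an end of the interval of [level_exists] is such a point, then (x,y) lies in that interval,
    and maximality makes them equal. *)
Lemma level_unique x y t : I t -> max_level_interval II w f x y -> oitv x y t ->
  ratio x y = (slope t)%:E.
Proof.
move=> It [L maxL] [xt ty].
have [x0t cx0] := left_contactP has_adm It; set x0 := left_contact t in x0t cx0.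
have [xx0|x0x] := ltP x x0.
  have x0y : (x0%:E < y)%E by apply: le_lt_trans ty; rewrite lee_fin.
  by have [] := contact_in_level L xx0 x0y cx0.
have [c|nc] := pselect (contact (slope t) t).
  by have [] := contact_in_level L xt ty c.
have [x' [y' [[L' _] [x't ty'] e' cx' yc']]] := level_exists It nc.
have [x'y' dx' _] := level_bounds L'.
have [xy dx yc] := level_bounds L.
have [xx'|x'x] := ltP x x'.
  have x'_lt : (x'%:E < y)%E by apply: lt_trans ty; rewrite lte_fin.
  by have [] := contact_in_level L xx' x'_lt cx'.
have [y'y|yy'] := ltP y' y.
  case: yc' => [y'a|[r y'r cr]].
    have [_ sub _ _] := L; have [_ ya] := oitv_sub_bounds xy sub.
    by move: y'y; rewrite y'a ltNge ya.
  have xr : x < r by move: ty'; rewrite y'r lte_fin; exact: lt_trans.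
  by rewrite y'r in y'y; have [] := contact_in_level L xr y'y cr.
have sub : oitv x y `<=` oitv x' y'.
  by move=> z [xz zy]; split; [exact: le_lt_trans xz|exact: lt_le_trans yy'].
have eqs := maxL _ _ L' sub.
have [xx' y'y] : x <= x' /\ (y' <= y)%E by apply: (oitv_sub_bounds x'y'); rewrite eqs.
by rewrite (le_anti (introT andP (conj x'x xx'))) in e' *;
   rewrite (le_anti (introT andP (conj yy' y'y))).
Qed.

Lemma level_functionE t : I t ->
  level_function II w f t = (slope t * w t)%:E \/
  level_function II w f t = rearr leb II f t /\ contact (slope t) t.
Proof.
move=> It; rewrite /level_function; set S := (X in `[< X !=set0 >]).
case: asboolP => [[p Sp]|nS].
  have [L pt] : S (xget (0, 0%E) S) by exact: xgetI Sp.
  by left; rewrite (level_unique It L pt) EFinM.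
right; split => //; have [//|nc] := pselect (contact (slope t) t).
by have [x [y [L xyt _ _ _]]] := level_exists It nc; exfalso; apply: nS; exists (x, y).
Qed.

End level_intervals.

End concave_majorant.

(** * Primitives of decreasing functions *)

Section primitive.
Context {R : realType}.
Variable v : R -> R.
Hypothesis v_ge0 : forall t, 0 < t -> 0 <= v t.
Hypothesis v_nincr : forall s t, 0 < s -> s <= t -> v t <= v s.
Local Notation T := (oitv (0 : R) +oo%E).

Lemma wmeas_density : has_density (wmeas v) T v.
Proof.
split => //; last by move=> x [/v_ge0].
by apply: nincr_measurable_fin => [|x y [x0 _] _]; [exact: oitv_interval|exact: v_nincr].
Qed.

Lemma oitv_sub_T (s : R) (c : \bar R) : 0 <= s -> oitv s c `<=` T.
Proof. by move=> s0 x [sx _]; split; [exact: le_lt_trans sx|exact: ltry]. Qed.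

Lemma wmeas_split s t : 0 <= s -> s <= t -> wmeas v (oitv 0 t%:E) =
  (wmeas v (oitv 0 s%:E) + wmeas v (oitv s t%:E))%E.
Proof.
move=> s0 st; have [mT mv vT _] := wmeas_density.
have mv' A : A `<=` T -> measurable_fun (A : set (lebR R)) (fun x => (v x)%:E).
  by move=> AT; apply/measurable_EFinP; exact: measurable_funS mv.
have v0' A : A `<=` T -> forall x, A x -> (0 <= (v x)%:E)%E.
  by move=> AT x /AT/vT; rewrite lee_fin.
have subt : oitv 0 t%:E `<=` T by exact: oitv_sub_T.
rewrite /wmeas (@ge0_negligible_integral _ _ _ leb (oitv 0 t%:E) [set s] _); first last.
- exact: (@lebesgue_measure_set1 R s).
- exact: v0'.
- exact: mv'.
- exact: measurable_oitv.
- exact/measurable_lebR.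
- have -> : oitv 0 t%:E `\` [set s] = oitv 0 s%:E `|` oitv s t%:E.
    apply/seteqP; split => x; rewrite /oitv /= !lte_fin.
      by move=> [[x0 xt] /eqP xs]; have [] := ltgtP x s; [left|right|move: xs => /eqP].
    move=> [[x0 xs]|[sx xt]]; split.
    + by split => //; exact: lt_le_trans st.
    + by apply/eqP; rewrite lt_eqF.
    + by split => //; exact: le_lt_trans sx.
    + by apply/eqP; rewrite gt_eqF.
  have sub : oitv 0 s%:E `|` oitv s t%:E `<=` T.
    by move=> x [|]; exact: oitv_sub_T.
  rewrite ge0_integral_setU; [by []|exact: measurable_oitv|exact: measurable_oitv|exact: mv'|exact: v0'|].
  rewrite disj_set2E; apply/eqP/seteqP; split => // x [[_ xs] [sx _]].
  by move: xs; rewrite lte_fin ltNge (ltW sx).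
Qed.

Lemma wmeas_bounds s t : 0 < s -> s <= t ->
  ((v t * (t - s))%:E <= wmeas v (oitv s t%:E) <= (v s * (t - s))%:E)%E.
Proof.
move=> s0 st; have [mT mv vT _] := wmeas_density.
have cstE (c : R) : ((c * (t - s))%:E = \int[leb]_(x in oitv s t%:E) c%:E)%E.
  by rewrite integral_cst//= leb_oitv_fin// EFinM.
have sub : oitv s t%:E `<=` T by apply: oitv_sub_T; exact: ltW.
have mv' : measurable_fun (oitv s t%:E : set (lebR R)) (fun x => (v x)%:E).
  by apply/measurable_EFinP; exact: measurable_funS mv.
rewrite !cstE /wmeas; apply/andP; split; apply: ge0_le_integral => //.
- by move=> x _; rewrite lee_fin v_ge0//; exact: lt_le_trans st.
- move=> x [sx]; rewrite lte_fin lee_fin => /ltW xt.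
  by apply: v_nincr => //; exact: lt_trans sx.
- by move=> x /sub/vT; rewrite lee_fin.
- by move=> x [/ltW sx _]; rewrite lee_fin v_nincr.
Qed.

Variable t0 : R.
Hypotheses (t0_gt0 : 0 < t0) (fin_t0 : (wmeas v (oitv 0 t0%:E) < +oo)%E).

Lemma wmeas_oitv_ge0 s c : 0 <= s -> (0 <= wmeas v (oitv s c))%E.
Proof.
by move=> s0; apply: (density_ge0 wmeas_density) => //; exact: oitv_sub_T.
Qed.

Lemma wmeas_fin t : wmeas v (oitv 0 t%:E) \is a fin_num.
Proof.
rewrite ge0_fin_numE; last exact: wmeas_oitv_ge0.
have [t_le|/ltW tt] := leP t t0.
  apply: le_lt_trans fin_t0; apply: (density_le wmeas_density) => //.
    by move=> x [x0 xt]; split => //; apply: lt_le_trans xt _; rewrite lee_fin.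
  exact: oitv_sub_T.
rewrite (wmeas_split (ltW t0_gt0) tt) lte_add_pinfty//.
have /andP[_ h] := wmeas_bounds t0_gt0 tt.
by apply: le_lt_trans h _; rewrite ltry.
Qed.

Definition primitive (t : R) : R := fine (wmeas v (oitv 0 t%:E)).

Lemma primitiveE t : wmeas v (oitv 0 t%:E) = (primitive t)%:E.
Proof. by rewrite fineK// wmeas_fin. Qed.

Lemma primitive_sub s t : 0 <= s -> s <= t ->
  wmeas v (oitv s t%:E) = (primitive t - primitive s)%:E.
Proof.
move=> s0 st; have := wmeas_split s0 st; rewrite !primitiveE.
move=> e; rewrite EFinB e addeAC subee// add0e//.
Qed.

Lemma primitive_bounds s t : 0 < s -> s <= t ->
  v t * (t - s) <= primitive t - primitive s <= v s * (t - s).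
Proof.
move=> s0 st; rewrite -!lee_fin -primitive_sub ?(ltW s0)//; exact: wmeas_bounds.
Qed.

Lemma primitive_nd s t : 0 <= s -> s <= t -> primitive s <= primitive t.
Proof.
move=> s0 st; rewrite -subr_ge0 -lee_fin -primitive_sub//.
exact: wmeas_oitv_ge0.
Qed.

Lemma primitive0 t : t <= 0 -> primitive t = 0.
Proof.
move=> t_le0; rewrite /primitive (_ : oitv 0 t%:E = set0).
  by rewrite (density_set0 wmeas_density).
apply/seteqP; split => // x [x0]; rewrite lte_fin => xt.
by have := lt_le_trans (lt_trans x0 xt) t_le0; rewrite ltxx.
Qed.

Lemma primitive_ge0 t : 0 <= primitive t.
Proof. by rewrite fine_ge0// wmeas_oitv_ge0. Qed.

(** [v] may be unbounded at 0, so no Lipschitz bound applies there; continuity from below along the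
    intervals (t0/(n+1), t0) does. *)
Lemma primitive_near0 e : 0 < e -> exists2 d, 0 < d & primitive d <= e.
Proof.
move=> e0; pose A n := oitv (t0 / n.+1%:R) t0%:E.
have An0 n : 0 < t0 / n.+1%:R by rewrite divr_gt0.
have Ant n : t0 / n.+1%:R <= t0 by rewrite ler_pdivrMr// ler_peMr ?(ltW t0_gt0)// ler1n.
have : wmeas v (A n) @[n --> \oo] --> wmeas v (\bigcup_n A n).
  apply: (density_cvg wmeas_density);
    [|by move=> n; exact: measurable_oitv|by move=> n; apply: oitv_sub_T; exact: ltW].
  apply/nondecreasing_seqP => n; apply/subsetPset => x [nx xt]; split => //.
  apply: le_lt_trans nx; rewrite ler_pM2l// lef_pV2 ?posrE// ler_nat//.
have -> : \bigcup_n A n = oitv 0 t0%:E.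
  apply/seteqP; split => x.
    by move=> [n _ [nx xt]]; split => //; exact: lt_trans nx.
  move=> [x0 xt]; have [n hn] : exists n : nat, t0 / x < n%:R.
    by exists (Num.bound (t0 / x)); apply: archi_boundP; rewrite divr_ge0 ?ltW.
  exists n => //; split => //; rewrite ltr_pdivrMr//.
  move: hn; rewrite ltr_pdivrMr// mulrC => /lt_trans; apply.
  by rewrite ltr_pM2l// ltr_nat.
rewrite primitiveE.
under eq_fun do rewrite /A primitive_sub ?(ltW (An0 _))//.
move=> /fine_cvgP[_ /cvgrPdist_le /(_ e e0)[N _ /(_ N (leqnn N))]] /=.
rewrite opprB addrC subrK ger0_norm ?primitive_ge0// => h.
by exists (t0 / N.+1%:R).
Qed.

Lemma primitive_continuous : continuous primitive.
Proof.
move=> t; apply/cvgrPdist_le => e e0.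
have [t_lt0|] := ltP t 0.
  near=> s; have s0 : s < 0 by near: s; exact: lt_nbhsl.
  by rewrite !primitive0 ?subrr ?normr0 ?(ltW e0)// ltW.
rewrite le_eqVlt => /predU1P[<-|t_gt0].
  have [d d0 hd] := primitive_near0 e0.
  near=> s; rewrite primitive0// sub0r normrN ger0_norm ?primitive_ge0//.
  have [s0|/ltW s0] := leP s 0; first by rewrite primitive0// ltW.
  apply: le_trans hd; apply: primitive_nd => //.
  by apply: ltW; near: s; exact: lt_nbhsl.
(* To the right of t/2 the primitive is Lipschitz with constant v (t/2). *)
have v0 := v_ge0 (divr_gt0 t_gt0 (ltr0Sn R 1)).
near=> s.
have s2 : t / 2 < s.
  by near: s; apply: lt_nbhsr; rewrite ltr_pdivrMr// ltr_pMr// ltr1n.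
have hb x y : t / 2 < x -> x <= y -> `|primitive y - primitive x| <= v (t / 2) * (y - x).
  move=> tx xy; have x0 : 0 < x by apply: lt_trans tx; rewrite divr_gt0.
  have /andP[_ h] := primitive_bounds x0 xy.
  rewrite ger0_norm ?subr_ge0; last exact: primitive_nd (ltW x0) xy.
  apply: le_trans h _; rewrite ler_wpM2r ?subr_ge0// v_nincr ?divr_gt0//.
  exact: ltW.
have : `|t - s| <= e / (v (t / 2) + 1).
  near: s; apply/nbhs_ballP; exists (e / (v (t / 2) + 1)) => /=.
    by rewrite divr_gt0// ltr_pwDr.
  by move=> s /ltW.
rewrite ler_pdivlMr ?ltr_pwDr// mulrDr mulr1 => hs.
apply: (@le_trans _ _ (v (t / 2) * `|t - s|)); last first.
  by rewrite mulrC; apply: le_trans hs; rewrite lerDl.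
have [st|/ltW ts] := leP s t.
  by rewrite (ger0_norm (x := t - s)) ?subr_ge0//; exact: hb.
rewrite distrC (distrC t) (ger0_norm (x := s - t)) ?subr_ge0//; apply: hb => //.
by rewrite ltr_pdivrMr// ltr_pMr// ltr1n.
Unshelve. all: by end_near. Qed.

End primitive.

Lemma oitv_exhaust {R : realType} (a : \bar R) : (0 < a)%E ->
  exists t : nat -> R, [/\ nondecreasing_seq t,
    forall n, 0 < t n /\ ((t n)%:E < a)%E & oitv 0 a = \bigcup_n oitv 0 (t n)%:E].
Proof.
case: a => [r| |] //; rewrite ?lte_fin => r0.
  (* With n+1 in place of n+2 the first point would be 0, outside the open interval. *)
  exists (fun n => r - r / n.+2%:R); split.
  - apply/nondecreasing_seqP => n; rewrite lerD2l lerN2 ler_pM2l//.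
    by rewrite lef_pV2 ?posrE// ler_nat.
  - move=> n; split; first by rewrite subr_gt0 ltr_pdivrMr// ltr_pMr// ltr1n.
    by rewrite lte_fin ltrBlDr ltrDl divr_gt0.
  - apply/seteqP; split => x; rewrite /oitv /= lte_fin.
      move=> [x0 xr]; have [n hn] : exists n : nat, r / (r - x) < n%:R.
        exists (Num.bound (r / (r - x))); apply: archi_boundP.
        by rewrite divr_ge0 ?subr_ge0 ?ltW.
      exists n => //; split => //=; rewrite lte_fin ltrBrDl -ltrBrDr.
      rewrite ltr_pdivrMr//; move: hn; rewrite ltr_pdivrMr ?subr_gt0// mulrC.
      move=> /lt_trans; apply; rewrite ltr_pM2l ?subr_gt0// ltr_nat.
      by rewrite ltnS leqnSn.
    move=> [n _ [x0 /=]]; rewrite lte_fin => xn; split => //; apply: lt_trans xn _.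
    by rewrite ltrBlDr ltrDl divr_gt0.
exists (fun n => n.+1%:R); split.
- by apply/nondecreasing_seqP => n; rewrite ler_nat.
- by move=> n; split => //; exact: ltry.
- apply/seteqP; split => x; last by move=> [n _ [x0 _]]; split => //; exact: ltry.
  move=> [x0 _].
  exists (Num.bound x) => //; split => //=; rewrite lte_fin.
  apply: lt_trans (archi_boundP (ltW x0)) _; by rewrite ltr_nat.
Qed.

Section scale.
Context {R : realType}.
Variables (D : set R) (v v' : R -> R) (c : R).
Hypotheses (Hv : has_density (wmeas v) D v) (Hv' : has_density (wmeas v') D v').
Hypothesis c0 : 0 <= c.

Let scaleE : (c%:E * wmeas v D = \int[leb]_(x in D) (c * v x)%:E)%E.
Proof.
have [mD mv v0 _] := Hv.
rewrite /wmeas -(@ge0_integralZl_EFin _ (lebR R) R leb); first by [].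
- exact: mD.
- by move=> x /v0; rewrite lee_fin.
- exact/measurable_EFinP.
- exact: c0.
Qed.

Let scale_measurable : measurable_fun (D : set (lebR R)) (fun x => (c * v x)%:E).
Proof. by have [mD mv v0 _] := Hv; apply/measurable_EFinP; exact: measurable_funM. Qed.

Lemma wmeas_ge_scale : (forall x, D x -> c * v x <= v' x) ->
  (c%:E * wmeas v D <= wmeas v' D)%E.
Proof.
have [mD mv v0 _] := Hv; have [_ mv' v'0 _] := Hv'.
move=> h; rewrite scaleE; apply: ge0_le_integral.
- exact: mD.
- by move=> x Dx; rewrite lee_fin mulr_ge0// v0.
- exact: scale_measurable.
- exact/measurable_EFinP.
- by move=> x Dx; rewrite lee_fin h.
Qed.

Lemma wmeas_le_scale : (forall x, D x -> v' x <= c * v x) ->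
  (wmeas v' D <= c%:E * wmeas v D)%E.
Proof.
have [mD mv v0 _] := Hv; have [_ mv' v'0 _] := Hv'.
move=> h; rewrite scaleE; apply: ge0_le_integral.
- exact: mD.
- by move=> x Dx; rewrite lee_fin v'0.
- exact/measurable_EFinP.
- exact: scale_measurable.
- by move=> x Dx; rewrite lee_fin h.
Qed.

End scale.

Lemma supergradient_bounds {R : realType} (x y p q u v : R) :
  x <= y + q * (u - v) -> y <= x + p * (v - u) -> q * (v - u) <= y - x <= p * (v - u).
Proof. by lra. Qed.

(** * The weight, the ratios and the density of the majorant *)

Section weight.
Context {R : realType}.
Variables (a : \bar R) (w : R -> R).
Hypothesis a_gt0 : (0 < a)%E.
Local Notation I := (oitv 0 a).
Hypothesis w_gt0 : forall t, I t -> 0 < w t.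
Hypothesis w_decr : forall s t, I s -> I t -> s <= t -> w t <= w s.
Hypothesis W_fin : forall t, I t -> (wmeas w (oitv 0 t%:E) < +oo)%E.
Local Notation dom t := (0 <= t /\ below a t).

(** Beyond [a] the values of [w] are arbitrary. Extending by 0 gives a decreasing function on the
    half line, whose primitive is continuous on all of R. *)
Definition weight0 (t : R) : R := if (t%:E < a)%E then w t else 0.

Lemma weight0E t : below a t -> weight0 t = w t.
Proof. by rewrite /weight0 /below => ->. Qed.

Lemma weight0_ge0 t : 0 < t -> 0 <= weight0 t.
Proof.
by move=> t0; rewrite /weight0; case: ifP => // ta; apply: ltW; exact: w_gt0.
Qed.

Lemma weight0_nincr s t : 0 < s -> s <= t -> weight0 t <= weight0 s.
Proof.
move=> s0 st; rewrite {1}/weight0; case: ifP => [ta|_]; last exact: weight0_ge0.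
have sa : below a s by apply: le_lt_trans ta; rewrite lee_fin.
by rewrite weight0E// w_decr//; split => //; exact: lt_le_trans st.
Qed.

Lemma wmeas_weight0 A : A `<=` I -> wmeas weight0 A = wmeas w A.
Proof.
move=> AI; apply: eq_integral => x /set_mem/AI[_ xa].
by rewrite weight0E.
Qed.

Lemma weight_density : has_density (wmeas w) I w.
Proof.
split => //; last by move=> x /w_gt0/ltW.
by apply: nincr_measurable_fin => //; exact: oitv_interval.
Qed.

Lemma I_nonempty : exists2 t, 0 < t & below a t.
Proof.
have [t [_ h _]] := oitv_exhaust a_gt0; have [h0 h1] := h 0%N.
by exists (t 0%N).
Qed.

Lemma oitv_dom_sub x (c : \bar R) : 0 <= x -> (c <= a)%E -> oitv x c `<=` I.
Proof.
by move=> x0 ca y [xy yc]; split; [exact: le_lt_trans xy|exact: lt_le_trans yc ca].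
Qed.

Lemma weight0_fin : exists2 t0, 0 < t0 & (wmeas weight0 (oitv 0 t0%:E) < +oo)%E.
Proof.
have [t t0 ta] := I_nonempty; exists t => //; rewrite wmeas_weight0.
  exact: W_fin.
by apply: oitv_dom_sub => //; exact: ltW.
Qed.

Definition cumul : R -> R := primitive weight0.
Local Notation W := cumul.

Lemma cumul_sub x t : 0 <= x -> x <= t -> (t%:E <= a)%E ->
  wmeas w (oitv x t%:E) = (W t - W x)%:E.
Proof.
move=> x0 xt ta; have [t0 t0_gt0 fin] := weight0_fin.
rewrite -wmeas_weight0; last exact: oitv_dom_sub.
by rewrite (primitive_sub weight0_ge0 weight0_nincr t0_gt0 fin x0 xt).
Qed.

Lemma cumul0 t : t <= 0 -> W t = 0.
Proof. by rewrite /cumul; apply (primitive0 weight0_ge0 weight0_nincr). Qed.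

Lemma cumul_0 : W 0 = 0. Proof. exact: cumul0. Qed.

Lemma cumulE t : 0 <= t -> (t%:E <= a)%E -> wmeas w (oitv 0 t%:E) = (W t)%:E.
Proof. by move=> t0 ta; rewrite cumul_sub// cumul_0 subr0. Qed.

Lemma cumul_continuous : continuous W.
Proof.
have [t0 t0_gt0 fin] := weight0_fin.
rewrite /cumul; apply (primitive_continuous weight0_ge0 weight0_nincr t0_gt0 fin).
Qed.

Lemma cumul_bounds s t : 0 < s -> s <= t -> below a t ->
  w t * (t - s) <= W t - W s <= w s * (t - s).
Proof.
move=> s0 st ta; have [t0 t0_gt0 fin] := weight0_fin.
have sa : below a s by apply: le_lt_trans ta; rewrite lee_fin.
rewrite -(weight0E ta) -(weight0E sa).
rewrite /cumul; apply (primitive_bounds weight0_ge0 weight0_nincr t0_gt0 fin s0 st).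
Qed.

Lemma cumul_incr s t : dom s -> dom t -> s < t -> W s < W t.
Proof.
move=> [s0 sa] [t0 ta] st.
(* s may be 0, where [cumul_bounds] does not apply; an intermediate point yields the strict
   increase. *)
have [m sm mt] : exists2 m, s < m & m < t.
  by exists ((s + t) / 2); [rewrite ltr_pdivlMr//; lra|rewrite ltr_pdivrMr//; lra].
have m0 : 0 < m := le_lt_trans s0 sm.
have It : I t by split => //; exact: lt_trans mt.
have [t1 t1_gt0 fin] := weight0_fin.
have h : W s <= W m by rewrite /cumul; apply (primitive_nd weight0_ge0 weight0_nincr t1_gt0 fin s0 (ltW sm)).
apply: (le_lt_trans h); rewrite -subr_gt0.
have /andP[h1 _] := cumul_bounds m0 (ltW mt) ta.
by apply: lt_le_trans h1; rewrite mulr_gt0 ?w_gt0// subr_gt0.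
Qed.

Lemma cumul_nd s t : 0 <= s -> s <= t -> W s <= W t.
Proof.
have [t1 t1_gt0 fin] := weight0_fin.
rewrite /cumul; apply (primitive_nd weight0_ge0 weight0_nincr t1_gt0 fin).
Qed.

Lemma cumul_ge0 t : 0 <= t -> 0 <= W t.
Proof. by move=> t0; rewrite -cumul_0 cumul_nd. Qed.

Local Notation b := (wmeas w I).

Lemma cumul_lt t : dom t -> ((W t)%:E < b)%E.
Proof.
move=> [t0 ta]; have [s ts sa] := ereal_dense_above ta.
apply: (@lt_le_trans _ _ (W s)%:E).
  by rewrite lte_fin cumul_incr//; split => //; exact: le_trans (ltW ts).
have s0 : 0 <= s := le_trans t0 (ltW ts).
rewrite -cumulE ?(ltW sa)//; apply: (density_le weight_density) => //.
by apply: oitv_dom_sub => //; exact: ltW.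
Qed.

Lemma total_gt0 : (0 < b)%E.
Proof.
have h := @cumul_lt 0 (conj (lexx 0) a_gt0).
by rewrite cumul_0 in h.
Qed.

Lemma cumul_onto u : 0 <= u -> (u%:E < b)%E -> exists2 t, dom t & W t = u.
Proof.
move=> u0 ub; have [t [nd ht Ie]] := oitv_exhaust a_gt0.
have [n hn] : exists n, u < W (t n).
  apply/not_existsP => h; move: ub; rewrite ltNge => /negP; apply.
  rewrite [X in wmeas w X]Ie.
  apply: (density_bigcup_le weight_density) => //.
  - move=> m n mn; apply/subsetPset => x [x0 xm]; split => //.
    by apply: lt_le_trans xm _; rewrite lee_fin nd.
  - by move=> n; apply: oitv_dom_sub => //; exact: ltW (proj2 (ht n)).
  - move=> n; rewrite cumulE; [|exact: ltW (proj1 (ht n))|exact: ltW (proj2 (ht n))].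
    by rewrite lee_fin leNgt; apply/negP; exact: h.
have [tn0 tna] := ht n.
have [||s] := @IVT R W 0 (t n) u (ltW tn0).
- exact/continuous_subspaceT/cumul_continuous.
- rewrite cumul_0 minEle maxEle (cumul_ge0 (ltW tn0)) u0 /=; exact: ltW.
rewrite in_itv/= => /andP[s0 st] Ws; exists s => //; split => //.
by apply: le_lt_trans tna; rewrite lee_fin.
Qed.

Lemma cumul_lt_mono s t : 0 < s -> below a s -> dom t -> (W s < W t) = (s < t).
Proof.
move=> s0 sa dt; have ds : dom s by split => //; exact: ltW.
have [st|ts|->] := ltgtP s t; last by rewrite ltxx.
  exact: cumul_incr.
by apply/negbTE; rewrite -leNgt ltW// cumul_incr.
Qed.

Section ratio.
Variable f : R -> R.
Hypothesis mf : L0 I f.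
Local Notation fstar := (rearr leb I f).
Let H := density_leb (measurable_oitv 0 a).
Hypothesis fstar_int : forall t, I t -> (\int[leb]_(s in oitv 0 t%:E) fstar s < +oo)%E.

Lemma fstar_fin t : 0 < t -> fstar t \is a fin_num.
Proof.
move=> t0; rewrite ge0_fin_numE ?rearr_ge0//.
have [s s0 sa] := I_nonempty.
pose m := Num.min s t; have m0 : 0 < m by rewrite lt_min s0.
have mI : I m by split => //; apply: le_lt_trans sa; rewrite lee_fin ge_min lexx.
apply: le_lt_trans (rearr_nincr leb I f (_ : m <= t)) _; first by rewrite ge_min lexx orbT.
have h : (fstar m * m%:E <= \int[leb]_(s in oitv 0 m%:E) fstar s)%E.
  have -> : (fstar m * m%:E = \int[leb]_(s in oitv 0 m%:E) fstar m)%E.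
    by rewrite integral_cst//= leb_oitv_fin ?(ltW m0)// subr0.
  apply: ge0_le_integral => //.
  - by move=> x _; exact: rearr_ge0.
  - apply: nincr_measurable => [|x y _ _]; [exact: oitv_interval|exact: rearr_nincr].
  - by move=> x [_]; rewrite lte_fin => /ltW; exact: rearr_nincr.
rewrite ltey; apply/eqP => e; move: h; rewrite e gt0_mulye// leye_eq => /eqP e'.
by have := fstar_int mI; rewrite e'.
Qed.

Definition rearr_real (t : R) : R := fine (fstar t).

Lemma rstarE t : 0 < t -> fstar t = (rearr_real t)%:E.
Proof. by move=> t0; rewrite fineK// fstar_fin. Qed.

Lemma rearr_real_ge0 t : 0 < t -> 0 <= rearr_real t.
Proof. by move=> _; rewrite fine_ge0// rearr_ge0. Qed.

Lemma rearr_real_nincr s t : 0 < s -> s <= t -> rearr_real t <= rearr_real s.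
Proof.
move=> s0 st; rewrite -lee_fin -!rstarE ?rearr_nincr//.
exact: lt_le_trans st.
Qed.

Lemma wmeas_rstar x c : 0 <= x ->
  wmeas rearr_real (oitv x c) = (\int[leb]_(t in oitv x c) fstar t)%E.
Proof.
move=> x0; apply: eq_integral => t /set_mem[xt _]; rewrite rstarE//.
exact: le_lt_trans xt.
Qed.

Definition rearr_prim : R -> R := primitive rearr_real.
Local Notation F := rearr_prim.

Lemma rearr_real_fin : exists2 t0, 0 < t0 & (wmeas rearr_real (oitv 0 t0%:E) < +oo)%E.
Proof.
have [t t0 ta] := I_nonempty; exists t => //; rewrite wmeas_rstar//.
exact: fstar_int.
Qed.

Lemma rearr_prim_sub s t : 0 <= s -> s <= t ->
  (\int[leb]_(x in oitv s t%:E) fstar x = (F t - F s)%:E)%E.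
Proof.
move=> s0 st; have [t0 t0_gt0 fin] := rearr_real_fin.
rewrite -wmeas_rstar//.
by rewrite (primitive_sub rearr_real_ge0 rearr_real_nincr t0_gt0 fin s0 st).
Qed.

Lemma rearr_prim_0 : F 0 = 0.
Proof. by rewrite /rearr_prim; apply (primitive0 rearr_real_ge0 rearr_real_nincr (lexx 0)). Qed.

Lemma rprimE t : 0 <= t -> (\int[leb]_(x in oitv 0 t%:E) fstar x = (F t)%:E)%E.
Proof. by move=> t0; rewrite rearr_prim_sub// rearr_prim_0 subr0. Qed.

Lemma rearr_prim_continuous : continuous F.
Proof.
have [t0 t0_gt0 fin] := rearr_real_fin.
rewrite /rearr_prim; apply (primitive_continuous rearr_real_ge0 rearr_real_nincr t0_gt0 fin).
Qed.

Lemma rearr_prim_nd s t : 0 <= s -> s <= t -> F s <= F t.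
Proof.
have [t0 t0_gt0 fin] := rearr_real_fin.
rewrite /rearr_prim; apply (primitive_nd rearr_real_ge0 rearr_real_nincr t0_gt0 fin).
Qed.

Lemma rearr_prim_bounds s t : 0 < s -> s <= t ->
  rearr_real t * (t - s) <= F t - F s <= rearr_real s * (t - s).
Proof.
have [t0 t0_gt0 fin] := rearr_real_fin.
rewrite /rearr_prim; apply (primitive_bounds rearr_real_ge0 rearr_real_nincr t0_gt0 fin).
Qed.

Lemma level_ratio_finE x y : 0 <= x -> (y%:E <= a)%E -> x < y ->
  0 < W y - W x -> level_ratio_fin I w f x y = ((F y - F x) / (W y - W x))%:E.
Proof.
move=> x0 ya xy Wxy; rewrite /level_ratio_fin rearr_prim_sub//; last exact: ltW.
by rewrite cumul_sub ?(ltW xy)// inver gt_eqF// EFinM.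
Qed.

Local Notation ratio := (level_ratio I w f).

Lemma ratio_finE x y : dom x -> dom y -> x < y ->
  ratio x y%:E = ((F y - F x) / (W y - W x))%:E.
Proof.
move=> dx dy xy; rewrite /level_ratio level_ratio_finE//; first by case: dx.
  exact: ltW (proj2 dy).
by rewrite subr_gt0 cumul_incr.
Qed.

(** The end point a is outside the domain of strict monotonicity, so a point between x and a is
    inserted. *)
Lemma cumul_lt_end x r : dom x -> a = r%:E -> 0 < W r - W x.
Proof.
move=> dx ar; have [x0 xa] := dx; have [s xs sa] := ereal_dense_above xa.
have s0 : 0 <= s := le_trans x0 (ltW xs).
have h := cumul_incr dx (conj s0 sa) xs.
rewrite subr_gt0; apply: lt_le_trans h _; apply: cumul_nd => //.
by move: sa; rewrite ar lte_fin => /ltW.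
Qed.

(** For infinite [a] this unfolds the limsup; for finite [a], F - rho * W is continuous at [a] and
    larger there than at x, hence also at points s just before [a]. *)
Lemma ratio_end_lt x rho M : dom x -> dom M -> (rho%:E < ratio x a)%E ->
  exists s, [/\ dom s, M < s, x < s & rho * (W s - W x) < F s - F x].
Proof.
move=> dx dM; pose m := Num.max M x.
have dm : dom m by rewrite /m; case: (leP M x).
have [m0 ma] := dm.
have Mm : M <= m by rewrite le_max lexx.
have xm : x <= m by rewrite le_max lexx orbT.
case: (eqVneq a +oo%E) => [aE|an].
  have -> : ratio x a = limf_esup (level_ratio_fin I w f x) (pinfty_nbhs R).
    by rewrite /level_ratio; set K := oitv 0 a; rewrite aE.
  move=> rho_lt.
  have /ereal_sup_gt[_ [s /= ms <-]] :
      (rho%:E < ereal_sup (level_ratio_fin I w f x @` [set s : R | (m < s)%R]))%E.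
    apply: lt_le_trans rho_lt _; apply: ereal_inf_lbound.
    by exists [set s : R | m < s] => //; exists m; split => //; exact: num_real.
  have ds : dom s by split; [exact: le_trans (ltW ms)|rewrite /below aE ltry].
  have xs : x < s := le_lt_trans xm ms.
  have Wxs : 0 < W s - W x by rewrite subr_gt0 cumul_incr.
  rewrite level_ratio_finE//; [|by case: dx|exact: ltW (proj2 ds)].
  rewrite lte_fin ltr_pdivlMr// => h; exists s; split => //.
  exact: le_lt_trans Mm ms.
have [r ar] : exists r, a = r%:E.
  by move: a_gt0 an; case: (a) => [r| |] // _ _; exists r.
have Wxr := cumul_lt_end dx ar.
have -> : ratio x a = level_ratio_fin I w f x r.
  by rewrite /level_ratio; set K := oitv 0 a; rewrite ar.
have ra : (r%:E <= a)%E by rewrite ar.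
have xr : x < r by move: (proj2 dx); rewrite /below ar lte_fin.
rewrite level_ratio_finE//; last by case: dx.
rewrite lte_fin ltr_pdivlMr// => rho_lt.
have mr : m < r by move: ma; rewrite /below ar lte_fin.
have [d d0 hd] : exists2 d, 0 < d & forall s, `|r - s| < d ->
    F x - rho * W x < F s - rho * W s.
  have /cvgr_gt : (fun s => F s - rho * W s) @ r --> F r - rho * W r.
    apply: cvgB; first exact: rearr_prim_continuous.
    by apply: cvgM; [exact: cvg_cst|exact: cumul_continuous].
  move=> /(_ (F x - rho * W x)); case; first lra.
  by move=> d /= d0 hd; exists d => // s; exact: hd.
pose s := Num.max ((m + r) / 2) (r - d / 2).
have ms : m < s by rewrite lt_max ltr_pdivlMr//; apply/orP; left; lra.
have sr : s < r.
  by rewrite gt_max ltr_pdivrMr// ltrBlDr ltrDl divr_gt0// andbT; lra.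
have : r - d / 2 <= s by rewrite le_max lexx orbT.
move=> h; have := hd s; rewrite ger0_norm ?subr_ge0 ?(ltW sr)// => h2.
exists s; split.
- by split; [exact: le_trans (ltW ms)|rewrite /below ar lte_fin].
- exact: le_lt_trans Mm ms.
- exact: le_lt_trans xm ms.
- have : r - s < d by lra.
  by move=> /h2; lra.
Qed.

Lemma ratio_end_gt x rho : dom x -> (ratio x a < rho%:E)%E ->
  exists2 M, dom M & forall s, dom s -> M < s -> x < s ->
    F s - F x <= rho * (W s - W x).
Proof.
move=> dx.
case: (eqVneq a +oo%E) => [aE|an].
  have -> : ratio x a = limf_esup (level_ratio_fin I w f x) (pinfty_nbhs R).
    by rewrite /level_ratio; set K := oitv 0 a; rewrite aE.
  move=> /ereal_inf_lt[_ [V [M0 [_ hM0]] <-] hV].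
  exists (Num.max 0 M0); first by split; [rewrite le_max lexx|rewrite /below aE ltry].
  move=> s ds; rewrite gt_max => /andP[_ Ms] xs.
  have Wxs : 0 < W s - W x by rewrite subr_gt0 cumul_incr.
  have : (level_ratio_fin I w f x s <= rho%:E)%E.
    by apply: le_trans (ltW hV); apply: ereal_sup_ubound; exists s => //; exact: hM0.
  rewrite level_ratio_finE//; [|by case: dx|exact: ltW (proj2 ds)].
  by rewrite lee_fin ler_pdivrMr.
have [r ar] : exists r, a = r%:E.
  by move: a_gt0 an; case: (a) => [r| |] // _ _; exists r.
have Wxr := cumul_lt_end dx ar.
have xr : x < r by move: (proj2 dx); rewrite /below ar lte_fin.
have -> : ratio x a = level_ratio_fin I w f x r.
  by rewrite /level_ratio; set K := oitv 0 a; rewrite ar.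
have ra : (r%:E <= a)%E by rewrite ar.
rewrite level_ratio_finE//; last by case: dx.
rewrite lte_fin ltr_pdivrMr// => rho_lt.
have [d d0 hd] : exists2 d, 0 < d & forall s, `|r - s| < d ->
    F s - rho * W s < F x - rho * W x.
  have /cvgr_lt : (fun s => F s - rho * W s) @ r --> F r - rho * W r.
    apply: cvgB; first exact: rearr_prim_continuous.
    by apply: cvgM; [exact: cvg_cst|exact: cumul_continuous].
  move=> /(_ (F x - rho * W x)); case; first lra.
  by move=> d /= d0 hd; exists d => // s; exact: hd.
exists (Num.max x (r - d / 2)).
  split; first by rewrite le_max; apply/orP; left; case: dx.
  by rewrite /below ar lte_fin gt_max xr ltrBlDr ltrDl divr_gt0.
move=> s ds; rewrite gt_max => /andP[_ rs] xs.
have sr : s < r by move: (proj2 ds); rewrite /below ar lte_fin.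
have := hd s; rewrite ger0_norm ?subr_ge0 ?(ltW sr)// => h2.
have : r - s < d by lra.
by move=> /h2; lra.
Qed.

Section slope_density.
Local Notation adm t rho := (admissible a F W t rho).
Hypothesis has_adm : forall t, 0 < t -> below a t -> exists rho, adm t rho.
Local Notation k := (slope a F W).
Local Notation G := (majorant a F W).

Definition level_density (t : R) : R := if (t%:E < a)%E then k t * w t else 0.
Local Notation kappa := level_density.

Lemma level_slope_ge0 t : I t -> 0 <= k t.
Proof. by move=> It; apply (slope_ge0 has_adm It). Qed.

Lemma level_slope_nincr s t : I s -> I t -> s <= t -> k t <= k s.
Proof.
move=> Is It st.
apply (slope_nincr rearr_prim_continuous cumul_continuous cumul_0 cumul_incr has_adm Is It st).
Qed.

Lemma level_densityE t : below a t -> kappa t = k t * w t.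
Proof. by rewrite /level_density /below => ->. Qed.

Lemma level_density_ge0 t : 0 < t -> 0 <= kappa t.
Proof.
move=> t0; rewrite /level_density; case: ifP => // ta.
by rewrite mulr_ge0 ?level_slope_ge0// ltW// w_gt0.
Qed.

Lemma level_density_nincr s t : 0 < s -> s <= t -> kappa t <= kappa s.
Proof.
move=> s0 st; rewrite {1}/level_density; case: ifP => [ta|_]; last exact: level_density_ge0.
have sa : below a s by apply: le_lt_trans ta; rewrite lee_fin.
have It : I t by split => //; exact: lt_le_trans st.
rewrite level_densityE// ler_pM ?level_slope_ge0 ?level_slope_nincr ?w_decr//.
exact: ltW (w_gt0 It).
Qed.

Lemma wmeas_level_density_bounds s t : 0 < s -> s <= t -> below a t ->
  ((k t * (W t - W s))%:E <= wmeas kappa (oitv s t%:E) <= (k s * (W t - W s))%:E)%E.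
Proof.
move=> s0 st ta; have It : I t by split => //; exact: lt_le_trans st.
have Is : I s by split => //; apply: le_lt_trans ta; rewrite lee_fin.
have sub : oitv s t%:E `<=` I by apply: oitv_dom_sub; exact: ltW.
have dk := density_sub (wmeas_density level_density_ge0 level_density_nincr)
  (measurable_oitv s t%:E) (oitv_sub_T (ltW s0)).
have dw := density_sub (weight_density) (measurable_oitv s t%:E) sub.
have kw x : oitv s t%:E x -> k t * w x <= kappa x <= k s * w x.
  move=> xst; have Ix := sub _ xst; have [sx] := xst; rewrite lte_fin => xt.
  rewrite level_densityE; last by case: Ix.
  by rewrite !ler_wpM2r ?(ltW (w_gt0 Ix))// level_slope_nincr// ltW.
have h x : oitv s t%:E x -> k t * w x <= kappa x by move=> /kw/andP[].
have h' x : oitv s t%:E x -> kappa x <= k s * w x by move=> /kw/andP[].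
rewrite !EFinM -(cumul_sub (ltW s0) st (ltW ta)).
by rewrite (wmeas_ge_scale dw dk (level_slope_ge0 It) h) (wmeas_le_scale dw dk (level_slope_ge0 Is) h').
Qed.

Lemma majorant_bounds s t : I s -> I t -> s <= t ->
  k t * (W t - W s) <= G t - G s <= k s * (W t - W s).
Proof.
move=> Is It st.
apply: supergradient_bounds;
  apply (majorant_supergradient rearr_prim_continuous cumul_continuous cumul_0 rearr_prim_nd
    cumul_incr has_adm) => //.
Qed.

(** The increments of both sides lie between k t * (W t - W s) and k s * (W t - W s), because k is
    decreasing and is a supergradient of G. By [sandwich_unique] they coincide. *)
Lemma wmeas_level_density_sub s t : 0 < s -> s <= t -> below a t ->
  wmeas kappa (oitv s t%:E) = (G t - G s)%:E.
Proof.
move=> s0 st ta.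
have Is : I s by split => //; apply: le_lt_trans ta; rewrite lee_fin.
(* truncating at height [kappa s] makes the primitive finite near 0 *)
pose kappa' x := kappa (Num.max s x).
have kge0 x : 0 < x -> 0 <= kappa' x.
  by move=> x0; rewrite /kappa' level_density_ge0// lt_max s0.
have knincr x y : 0 < x -> x <= y -> kappa' y <= kappa' x.
  move=> x0 xy; apply: level_density_nincr; first by rewrite lt_max s0.
  by rewrite ge_max le_max lexx /= le_max xy orbT.
have fin : (wmeas kappa' (oitv 0 s%:E) < +oo)%E.
  rewrite /wmeas; apply: (@le_lt_trans _ _ (\int[leb]_(x in oitv 0 s%:E) (kappa s)%:E)%E).
    apply: ge0_le_integral; first exact: measurable_oitv.
    - by move=> x [x0 _]; rewrite lee_fin kge0.
    - apply: nincr_measurable => [|x y [x0 _] _ xy]; first exact: oitv_interval.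
      by rewrite lee_fin knincr.
    - exact: measurable_cst.
    - move=> x [x0]; rewrite lte_fin => /ltW xs.
      by rewrite /kappa' /Num.max; case: ltP => // sx; rewrite (le_anti (introT andP (conj xs (ltW sx)))).
  by rewrite integral_cst//= leb_oitv_fin ?(ltW s0)// -EFinM ltry.
have kE x y : s <= x -> wmeas kappa' (oitv x y) = wmeas kappa (oitv x y).
  move=> sx; apply: eq_integral => z /set_mem[xz _]; rewrite /kappa' max_r//.
  exact: le_trans sx (ltW xz).
have psub x y : s <= x -> x <= y ->
    wmeas kappa (oitv x y%:E) = (primitive kappa' y - primitive kappa' x)%:E.
  move=> sx xy; rewrite -kE//.
  by rewrite (primitive_sub kge0 knincr s0 fin (le_trans (ltW s0) sx) xy).
rewrite psub//; congr (_%:E).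
apply: (@sandwich_unique R a W cumul_continuous cumul_incr s k) => //; first exact: ltW.
- move=> x y sx ya xy; rewrite -!lee_fin -psub//.
  by apply: wmeas_level_density_bounds => //; exact: lt_le_trans sx.
- move=> x y sx ya xy; have x0 : 0 < x := lt_le_trans s0 sx.
  apply: majorant_bounds => //.
    by split => //; apply: le_lt_trans ya; rewrite lee_fin.
  by split => //; exact: lt_le_trans xy.
Qed.

(** The left end 0 is reached by a limit: one inequality uses G >= 0, the other the fact that G
    tends to 0 at 0. *)
Lemma wmeas_level_density t : I t -> wmeas kappa (oitv 0 t%:E) = (G t)%:E.
Proof.
move=> It; have [t0 ta] := It.
have dens := wmeas_density level_density_ge0 level_density_nincr.
have G0 s : I s -> 0 <= G s.
  move=> Is; apply (majorant_ge0 rearr_prim_continuous cumul_continuous rearr_prim_0 cumul_0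
    rearr_prim_nd cumul_incr has_adm Is).
apply/eqP; rewrite eq_le; apply/andP; split.
  pose A n := oitv (t / n.+1%:R) t%:E.
  have An0 n : 0 < t / n.+1%:R by rewrite divr_gt0.
  have Ant n : t / n.+1%:R <= t by rewrite ler_pdivrMr// ler_peMr ?(ltW t0)// ler1n.
  have -> : oitv 0 t%:E = \bigcup_n A n.
    apply/seteqP; split => x.
      move=> [x0 xt]; have [n hn] : exists n : nat, t / x < n%:R.
        by exists (Num.bound (t / x)); apply: archi_boundP; rewrite divr_ge0 ?ltW.
      exists n => //; split => //; rewrite ltr_pdivrMr//.
      move: hn; rewrite ltr_pdivrMr// mulrC => /lt_trans; apply.
      by rewrite ltr_pM2l// ltr_nat.
    by move=> [n _ [nx xt]]; split => //; exact: lt_trans nx.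
  apply: (density_bigcup_le dens).
  - apply/nondecreasing_seqP => n; apply/subsetPset => x [nx xt]; split => //.
    by apply: le_lt_trans nx; rewrite ler_pM2l// lef_pV2 ?posrE// ler_nat.
  - by move=> n; exact: measurable_oitv.
  - by move=> n; apply: oitv_sub_T; exact: ltW.
  - move=> n; rewrite wmeas_level_density_sub// lee_fin lerBlDr lerDl G0//.
    by split => //; apply: le_lt_trans ta; rewrite lee_fin.
apply/lee_addgt0Pr => e e0.
have [d d0 hd] := majorant_near0 rearr_prim_continuous cumul_continuous rearr_prim_0 
  cumul_0 rearr_prim_nd cumul_incr has_adm a_gt0 e0.
pose s := Num.min t (d / 2).
have s0 : 0 < s by rewrite lt_min t0 divr_gt0.
have st : s <= t by rewrite ge_min lexx.
have sd : s < d.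
  by apply: (@le_lt_trans _ _ (d / 2)); [rewrite ge_min lexx orbT|rewrite ltr_pdivrMr//; lra].
have sa : below a s by apply: le_lt_trans ta; rewrite lee_fin.
have hs := hd s (conj s0 sa) sd.
apply: (@le_trans _ _ (wmeas kappa (oitv s t%:E) + e%:E)%E).
  by rewrite wmeas_level_density_sub// -EFinD lee_fin -addrA lerDl addrC subr_ge0.
rewrite leeD2r//; apply: (density_le dens) => //; last exact: oitv_sub_T.
by move=> x [sx xt]; split => //; exact: lt_trans sx.
Qed.

(** On maximal level intervals this is [level_functionE]. Elsewhere t is a contact, and the
    maximality of F - k t * W at t forces f^*(t) = k t * w t when f^* is continuous at t. *)
Lemma level_function_ae :
  ae_on I (fun t => level_function I w f t = (kappa t)%:E).
Proof.
rewrite /ae_on; apply: filterS (ae_not_jump (mu := leb) (D := I) (f := f)) => t nj It.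
have [t0 ta] := It; rewrite level_densityE//.
have [//|[-> [_ ct]]] := level_functionE rearr_prim_continuous cumul_continuous
  cumul_0 rearr_prim_nd cumul_incr ratio_finE ratio_end_lt ratio_end_gt has_adm It.
have kw0 : 0 <= k t * w t by rewrite mulr_ge0 ?level_slope_ge0// ltW// w_gt0.
apply/eqP; rewrite eq_le; apply/andP; split; rewrite leNgt; apply/negP.
  (* By right continuity f^* exceeds k t * w t up to some s > t; as w decreases, F - k t * W would
     be larger at s than at t. *)
  rewrite (rearr_gt H mf)// => td.
  have [s] : exists2 s, t < s & (s%:E < mine (distr leb I f (k t * w t)) a)%E.
    by apply: ereal_dense_above; rewrite lt_min td.
  move=> ts; rewrite lt_min => /andP[]; rewrite -(rearr_gt H mf)// => fs sa.
  have s0 : 0 < s := lt_trans t0 ts.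
  rewrite rstarE// lte_fin in fs.
  have /andP[h1 _] := rearr_prim_bounds t0 (ltW ts).
  have h2 := ct s (conj (ltW s0) sa).
  have /andP[_ h3] := cumul_bounds t0 (ltW ts) sa.
  have h4 : k t * (W s - W t) <= k t * (w t * (s - t)) by rewrite ler_wpM2l// level_slope_ge0.
  have : 0 < (rearr_real s - k t * w t) * (s - t) by rewrite mulr_gt0 ?subr_gt0.
  lra.
(* The mirror image to the left of t, where left continuity requires t to avoid the exceptional
   set. *)
move=> /(rearr_left_cont H mf t0 nj)[s /andP[s0 st]].
rewrite rstarE// lte_fin => fs.
have sa : below a s by apply: le_lt_trans ta; rewrite lee_fin ltW.
have /andP[_ h1] := rearr_prim_bounds s0 (ltW st).
have h2 := ct s (conj (ltW s0) sa).
have /andP[h3 _] := cumul_bounds s0 (ltW st) ta.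
have h4 : k t * (w t * (t - s)) <= k t * (W t - W s) by rewrite ler_wpM2l// level_slope_ge0.
have : 0 < (k t * w t - rearr_real s) * (t - s) by rewrite mulr_gt0 ?subr_gt0.
lra.
Qed.

End slope_density.

End ratio.
End weight.

(** * The upper bound *)

Section submajorization.
Context {R : realType}.
Variables (a : \bar R).
Hypothesis a_gt0 : (0 < a)%E.
Local Notation I := (oitv 0 a).
Let H := density_leb (measurable_oitv (0 : R) a).

Lemma leb_I_le : (leb I <= a)%E.
Proof. by rewrite leb_oitv0// ltW. Qed.

Lemma rearr_measurable (mu : set R -> \bar R) D f (s : R) (c : \bar R) :
  measurable_fun (oitv s c : set (lebR R)) (rearr mu D f).
Proof. by apply: nincr_measurable => [|x y _ _]; [exact: oitv_interval|exact: rearr_nincr]. Qed.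

Lemma rearr_fine_L0 (mu : set R -> \bar R) D f (s : R) (c : \bar R) :
  L0 (oitv s c) (fine \o rearr mu D f).
Proof.
apply: measurableT_comp; first exact: fine_measurable.
exact: rearr_measurable.
Qed.

Lemma L0_abs D (f : R -> R) : L0 D f -> L0 D (fun x => `|f x|).
Proof. by move=> mf; exact: measurableT_comp. Qed.

Lemma L0_mul D (f g : R -> R) : L0 D f -> L0 D g -> L0 D (fun x => f x * g x).
Proof. exact: measurable_funM. Qed.

(** [submaj] speaks of points of [I] only; the full interval is reached by monotone convergence. *)
Lemma submaj_le f g (c : \bar R) : submaj I f g -> (c <= a)%E ->
  (\int[leb]_(t in oitv 0 c) rearr leb I f t <=
   \int[leb]_(t in oitv 0 c) rearr leb I g t)%E.
Proof.
move=> fg; rewrite le_eqVlt => /predU1P[->|ca]; last first.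
  have [c0|c0] := leP c 0%E.
    rewrite (_ : oitv 0 c = set0) ?integral_set0//.
    apply/seteqP; split => // x [x0 /lt_le_trans/(_ c0)].
    by rewrite lte_fin ltNge (ltW x0).
  move: ca c0; case: c => [r ra|ya|_].
  - by rewrite lte_fin => r0; apply: fg; split.
  - by exfalso; clear fg; move: ya; rewrite ltNge leey.
  - by move=> n0; exfalso; clear fg; move: n0; rewrite ltNge leNye.
have [t [nd ht Ie]] := oitv_exhaust a_gt0.
have lim h : (\int[leb]_(x in oitv 0 (t n)%:E) rearr leb I h x)%E @[n --> \oo]
    --> (\int[leb]_(x in I) rearr leb I h x)%E.
  rewrite [X in integral _ X]Ie.
  apply: (@ge0_nondecreasing_set_cvg_integral _ (lebR R) R
    (fun n => oitv 0 (t n)%:E) (rearr leb I h) leb).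
  - move=> m n mn; apply/subsetPset => x [x0 xm]; split => //.
    by apply: lt_le_trans xm _; rewrite lee_fin nd.
  - by move=> n; exact: measurable_oitv.
  - by move=> n; exact: rearr_measurable.
  - by move=> n x _; exact: rearr_ge0.
rewrite -[leLHS](cvg_lim (@ereal_hausdorff R) (lim f)).
rewrite -[leRHS](cvg_lim (@ereal_hausdorff R) (lim g)).
apply: lee_lim; [apply/cvg_ex; eexists; exact: lim|apply/cvg_ex; eexists; exact: lim|].
by apply: nearW => n; apply: fg; exact: ht.
Qed.

Lemma integral_mul_le_rearr f h : L0 I f -> L0 I h ->
  (\int[leb]_(x in I) `|f x * h x|%:E <=
   \int[leb]_(x in I) (rearr leb I f x * rearr leb I h x))%E.
Proof.
move=> mf mh; rewrite (integral_rearr_prod H H mf mh leb_I_le leb_I_le).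
apply: le_trans (hardy_littlewood H mf mh).
by rewrite le_eqVlt; apply/orP; left; apply/eqP; apply: eq_integral => x _;
   rewrite /= mule1 normrM EFinM.
Qed.

(** The level sets of h^* are the intervals from 0 to d_h(s), and on each of them submajorization is
    exactly the required comparison. *)
Lemma submaj_integral_le f g h : L0 I h -> submaj I f g ->
  (\int[leb]_(x in I) (rearr leb I f x * rearr leb I h x) <=
   \int[leb]_(x in I) (rearr leb I g x * rearr leb I h x))%E.
Proof.
move=> mh fg.
have lc k : (\int[leb]_(x in I) (rearr leb I k x * rearr leb I h x) =
    \int[leb]_(s in oitv 0%R +oo) \int[leb]_(x in oitv 0%R (distr leb I h s)) rearr leb I k x)%E.
  under eq_integral do rewrite muleC.
  rewrite layer_cake; [|exact: measurable_oitv|exact: rearr_measurable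
    |exact: rearr_measurable|by move=> x _; exact: rearr_ge0|by move=> x _; exact: rearr_ge0].
  apply: eq_integral => s /set_mem[s0 _].
  by rewrite (rearr_level H mh leb_I_le (ltW s0)).
rewrite !lc.
have mono k s t : 0 < s -> s <= t ->
    (\int[leb]_(x in oitv 0%R (distr leb I h t)) rearr leb I k x <=
     \int[leb]_(x in oitv 0%R (distr leb I h s)) rearr leb I k x)%E.
  move=> s0 st; apply: ge0_subset_integral.
  - exact: measurable_oitv.
  - exact: measurable_oitv.
  - exact: rearr_measurable.
  - by move=> x _; exact: rearr_ge0.
  - move=> x [x0 xt]; split; first exact: x0.
    apply: lt_le_trans xt _; exact: (distr_le H mh st).
apply: le_integral_nincr; [exact: mono|exact: mono|move=> s s0].
apply/andP; split; first by apply: integral_ge0 => x _; exact: rearr_ge0.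
apply: submaj_le => //; apply: le_trans leb_I_le.
exact: (distr_le_total H mh).
Qed.

Variable w : R -> R.
Hypothesis w_gt0 : forall t, I t -> 0 < w t.
Hypothesis w_decr : forall s t, I s -> I t -> s <= t -> w t <= w s.
Local Notation b := (wmeas w I).

Lemma integral_mul_le_norm (E : fspace (oitv 0 b)) f g h :
  L0 I f -> submaj I f g -> fs_mem (M_space I w (kothe_dual E)) g ->
  fs_mem (Lambda_space I w E) h -> (fs_norm (Lambda_space I w E) h <= 1)%E ->
  (\int[leb]_(x in I) `|f x * h x|%:E <= fs_norm (M_space I w (kothe_dual E)) g)%E.
Proof.
move=> mf fg [mg [Afin [mA [Awfin [mAw _]]]]] [mh [Bfin [mB [Bwfin BwE]]]] Bw1.
set A := fine \o rearr_div I w g in Afin mA Awfin mAw *.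
set B := fine \o rearr leb I h in Bfin mB Bwfin BwE Bw1.
have Hw := weight_density w_gt0 w_decr.
apply: (le_trans (integral_mul_le_rearr mf mh)).
apply: (le_trans (submaj_integral_le mh fg)).
have -> : (\int[leb]_(x in I) (rearr leb I g x * rearr leb I h x) =
    \int[leb]_(x in I) (`|A x|%:E * (`|B x|%:E * (w x)%:E)))%E.
  apply: ae_eq_integral.
  - exact: measurable_oitv.
  - by apply: emeasurable_funM; exact: rearr_measurable.
  - have [_ mw _ _] := Hw.
    apply/measurable_EFinP; apply: (L0_mul (L0_abs mA)).
    exact: (L0_mul (L0_abs mB) mw).
  rewrite /ae_on in Afin Bfin; apply: filterS2 Afin Bfin => x Ax Bx Ix.
  have w0 := w_gt0 Ix.
  have rd0 : (0 <= rearr_div I w g x)%E.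
    by rewrite mule_ge0 ?rearr_ge0// inver gt_eqF// lee_fin invr_ge0 ltW.
  rewrite /A /B /= !ger0_norm ?fine_ge0 ?rearr_ge0//.
  rewrite (fineK (Ax Ix)) (fineK (Bx Ix)) /rearr_div.
  rewrite (muleC (rearr leb I h x)) muleA -(muleA (rearr leb I g x)).
  by rewrite inver gt_eqF// -EFinM mulVf ?gt_eqF// mule1.
(* The weight now counts as part of the measure. Rearranging with respect to w dm moves the integral
   from [I] to [J], where the duality between [E] and its Koethe dual applies. *)
apply: (le_trans (hardy_littlewood Hw mA mB)).
rewrite -(integral_rearr_prod Hw Hw mA mB (lexx _) (lexx _)).
have -> : (\int[leb]_(t in oitv 0 b) (rearr (wmeas w) I A t * rearr (wmeas w) I B t) =
   \int[leb]_(t in oitv 0 b) `|(fine \o rearr (wmeas w) I A) t *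
      (fine \o rearr (wmeas w) I B) t|%:E)%E.
  apply: ae_eq_integral.
  - exact: measurable_oitv.
  - by apply: emeasurable_funM; exact: rearr_measurable.
  - by apply/measurable_EFinP; apply: L0_abs; apply: L0_mul; exact: rearr_fine_L0.
  rewrite /ae_on in Awfin Bwfin; apply: filterS2 Awfin Bwfin => x Ax Bx Ix.
  rewrite /= ger0_norm; last by rewrite mulr_ge0// fine_ge0 ?rearr_ge0.
  rewrite EFinM (fineK (Ax Ix)) (fineK (Bx Ix)); reflexivity.
by apply: ereal_sup_ubound; exists (fine \o rearr (wmeas w) I B).
Qed.

End submajorization.

(** * Sets adapted to the level sets of a function *)

Section chain.
Context {R : realType}.
Variables (c : R) (f : R -> R).
Hypothesis c_gt0 : 0 < c.
Local Notation D := (oitv 0 c%:E).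
Hypothesis mf : L0 D f.
Let H := density_leb (measurable_oitv (0 : R) c%:E).

(** Superlevel sets of |f| with ties broken by position. They form a chain containing the sets {|f|
    > v}, and moving r through a plateau of |f| changes the measure continuously. *)
Definition lex_set (v r : R) : set R :=
  D `&` [set x | v < `|f x| \/ v = `|f x| /\ x < r].

Lemma lex_set_total v r v' r' : lex_set v r `<=` lex_set v' r' \/
  lex_set v' r' `<=` lex_set v r.
Proof.
have [vv'|v'v|->] := ltgtP v v'.
- right=> x [Dx /= h]; split => //=; left.
  by case: h => [/(lt_trans vv')//|[<- _]].
- left=> x [Dx /= h]; split => //=; left.
  by case: h => [/(lt_trans v'v)//|[<- _]].
have [rr'|/ltW r'r] := leP r r'; [left|right] => x [Dx /= h]; split => //=;
  by case: h => [|[? xr]]; [left|right; split => //; exact: lt_le_trans xr _].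
Qed.

Lemma lex_set_level v : lex_set v 0 = D `&` [set x | v < `|f x|].
Proof.
apply/seteqP; split => x [Dx /= h]; split => //=; last by left.
by case: h => // -[_ x0]; have [/(lt_trans x0)] := Dx; rewrite ltxx.
Qed.

Lemma measurable_lex_set v r : measurable (lex_set v r : set (lebR R)).
Proof.
have mabs : measurable_fun (D : set (lebR R)) (fun x => `|f x|%:E).
  exact/measurable_EFinP/L0_abs.
have -> : lex_set v r = (D `&` [set x | (v%:E < `|f x|%:E)%E]) `|`
    ((D `&` [set x | (v%:E <= `|f x|%:E)%E]) `&` oitv 0 r%:E).
  apply/seteqP; split => x.
    move=> [[x0 xc] /= [vf|[vf xr]]]; first by left; split => //=; rewrite lte_fin.
    by right; split; split => //=; rewrite ?lee_fin ?vf ?lte_fin.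
  move=> [[Dx /=]|[[Dx /= vf] [_ xr]]].
    by rewrite lte_fin => vf; split => //=; left.
  move: vf xr; rewrite lee_fin lte_fin le_eqVlt => /predU1P[vf xr|vf _].
    by split => //=; right.
  by split => //=; left.
apply: measurableU; first exact: emeasurable_fun_o_infty.
by apply: measurableI => //; exact: emeasurable_fun_c_infty.
Qed.

Lemma lex_set_sub v r : lex_set v r `<=` D.
Proof. by move=> x []. Qed.

Lemma leb_sub_fin A : measurable (A : set (lebR R)) -> A `<=` D ->
  leb A \is a fin_num.
Proof.
move=> mA AD; rewrite ge0_fin_numE; last exact: (density_ge0 H mA AD).
apply: (@le_lt_trans _ _ (leb D)); first exact: (density_le H mA (measurable_oitv _ _) AD).
by rewrite leb_oitv_fin ?(ltW c_gt0)// ltry.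
Qed.

Lemma leb_compl A : measurable (A : set (lebR R)) -> A `<=` D ->
  leb A = (c%:E - leb (D `\` A))%E.
Proof.
move=> mA AD; have mDA : measurable (D `\` A : set (lebR R)) by exact: measurableD.
have e : (leb A + leb (D `\` A) = c%:E)%E.
  rewrite -measureU//; last by rewrite setDIK.
  rewrite setDUK// -[LHS]/(leb D) leb_oitv_fin ?subr0//; exact: ltW.
by rewrite -[X in (X - _)%E]e addeK// leb_sub_fin// => x [].
Qed.

Lemma distr_small t : 0 < t -> exists n : nat, (distr leb D f n%:R <= t%:E)%E.
Proof.
move=> t0; apply/not_existsP => h.
pose A n := D `\` (D `&` [set x | n%:R < `|f x|]).
have mA n : measurable (A n : set (lebR R)).
  by apply: measurableD => //; exact: measurable_level H _ mf _.
have : (leb D <= c%:E - t%:E)%E.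
  have -> : D = \bigcup_n A n.
    apply/seteqP; split => [x Dx|x [n _ []]//].
    exists (Num.bound `|f x|) => //; split => // -[_ /=].
    by rewrite ltNge (ltW (archi_boundP (normr_ge0 _))).
  apply: (density_bigcup_le H) => //.
  - apply/nondecreasing_seqP => n; apply/subsetPset => x [Dx nx]; split => //.
    move=> [_ /= h1]; apply: nx; split => //=; apply: lt_trans h1.
    by rewrite ltr_nat.
  - by move=> n x [].
  - move=> n; rewrite leb_compl//; last by move=> x [].
    rewrite leeB// /A setDD setIA setIid; apply/ltW; rewrite ltNge.
    by apply/negP; exact: h.
rewrite leb_oitv_fin ?(ltW c_gt0)// -EFinB lee_fin subr0 lerBrDr gerDl.
by rewrite leNgt t0.
Qed.

(** With v = f^*(t), the set {|f| > v} has measure at most t and {|f| >= v} at least t. Moving r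
    from 0 to c interpolates between the two. *)
Lemma chain_value t : 0 < t -> t < c -> exists v r, leb (lex_set v r) = t%:E.
Proof.
move=> t0 tc.
have fin : rearr leb D f t \is a fin_num.
  rewrite ge0_fin_numE ?rearr_ge0//; have [n hn] := distr_small t0.
  apply: (@le_lt_trans _ _ n%:R%:E); last exact: ltry.
  by rewrite leNgt (rearr_gt H mf)// -leNgt.
pose v := fine (rearr leb D f t).
have v0 : 0 <= v by rewrite fine_ge0// rearr_ge0.
have vE : v%:E = rearr leb D f t by rewrite fineK.
have dv : (distr leb D f v <= t%:E)%E by rewrite leNgt -(rearr_gt H mf)// vE ltxx.
(* Every level u < v lies below f^*(t), so {|f| > u} has measure above t; passing to complements,
   continuity from below lets u tend to v. *)
have full : (t%:E <= leb (lex_set v c))%E.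
  rewrite leb_compl; [|exact: measurable_lex_set|exact: lex_set_sub].
  have -> : D `\` lex_set v c = D `&` [set x | `|f x| < v].
    apply/seteqP; split => [x [Dx nx]|x [Dx /= fv]]; split => //=.
      rewrite ltNge; apply/negP; rewrite le_eqVlt => /predU1P[vf|vf]; apply: nx.
        by split => //=; right; split => //; case: Dx.
      by split => //=; left.
    by move=> [_ /= [/(lt_trans fv)|[e _]]]; rewrite ?e ltxx// -e ltxx in fv *.
  suff h : (leb (D `&` [set x | (`|f x| < v)%R]) <= c%:E - t%:E)%E.
    have := leeB (lexx c%:E) h; apply: le_trans.
    by rewrite -!EFinB lee_fin opprB addrC subrK.
  have [v_gt0|v_le0] := ltP 0 v; last first.
    rewrite (_ : D `&` _ = set0) ?measure0 -?EFinB ?lee_fin ?subr_ge0 ?(ltW tc)//.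
    apply/seteqP; split => // x [_ /=]; rewrite ltNge => /negP; apply.
    exact: le_trans v_le0 _.
  (* The maximum with 0 is there because [rearr_gt] needs nonnegative levels. *)
  pose u n := Num.max 0 (v - n.+1%:R^-1).
  have u0 n : 0 <= u n by rewrite le_max lexx.
  have uv n : u n < v.
    by rewrite /u gt_max v_gt0 /= ltrBlDr ltrDl invr_gt0.
  have und m n : (m <= n)%N -> u m <= u n.
    move=> mn; rewrite ge_max u0 /= le_max; apply/orP; right.
    by rewrite lerD2l lerN2 lef_pV2 ?posrE// ler_nat.
  have mlev s : measurable (D `&` [set x | s < `|f x|] : set (lebR R)).
    exact: measurable_level H _ mf _.
  have -> : D `&` [set x | `|f x| < v] =
      \bigcup_n (D `\` (D `&` [set x | u n < `|f x|])).
    apply/seteqP; split => [x [Dx /= fv]|x [n _ [Dx nx]]]; last first.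
      split => //=; apply: le_lt_trans (uv n); rewrite leNgt; apply/negP => h.
      by apply: nx.
    have fv0 : 0 < v - `|f x| by rewrite subr_gt0.
    have [n _ /(_ n (leqnn n)) /= hn] := near_infty_natSinv_lt (PosNum fv0).
    exists n => //; split => // -[_ /=]; rewrite ltNge => /negP; apply.
    by rewrite le_max lerBrDr -lerBrDl (ltW hn) orbT.
  apply: (density_bigcup_le H).
  - move=> m n mn; apply/subsetPset => x [Dx nx]; split => // -[_ /= h1].
    by apply: nx; split => //=; exact: le_lt_trans (und _ _ mn) h1.
  - by move=> n; exact: measurableD.
  - by move=> n x [].
  - move=> n; rewrite leb_compl; [|exact: measurableD|by move=> x []].
    rewrite setDD setIA setIid leeB// ltW//.
    by rewrite -[X in (_ < X)%E]/(distr leb D f (u n)) -(rearr_gt H mf)// -vE lte_fin.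
pose phi r := fine (leb (lex_set v r)).
have phiE r : leb (lex_set v r) = (phi r)%:E.
  by rewrite fineK// leb_sub_fin//; [exact: measurable_lex_set|exact: lex_set_sub].
(* The part added between r and r' lies in an interval of length r' - r, so the measure is
   1-Lipschitz in r. *)
have lip r r' : r <= r' -> phi r <= phi r' <= phi r + (r' - r).
  move=> rr'; rewrite -!lee_fin EFinD -!phiE; apply/andP; split.
    apply: (density_le H); [exact: measurable_lex_set|exact: measurable_lex_set| |exact: lex_set_sub].
    move=> x [Dx /= h]; split => //=; case: h => [|[? xr]]; first by left.
    by right; split => //; exact: lt_le_trans xr _.
  have mrr : measurable (`[r, r'[%classic : set (lebR R)).
    by apply: is_interval_measurable_lebR; exact: interval_is_interval.
  have -> : ((r' - r)%:E = leb `[r, r'[%classic)%E.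
    rewrite -[RHS]/(lebesgue_measure `[r, r'[%classic) lebesgue_measure_itv/= lte_fin.
    case: ltP => [_|r'r]; first by rewrite EFinB.
    by rewrite (le_anti (introT andP (conj rr' r'r))) subrr.
  apply: le_trans (measureU2 leb (measurable_lex_set v r) mrr).
  apply: (density_le (density_leb (D := setT) measurableT)) => //;
    [exact: measurable_lex_set|by apply: measurableU => //; exact: measurable_lex_set|].
  move=> x [Dx /= h]; case: h => [vf|[vf xr]]; first by left; split => //=; left.
  have [xr'|rx] := ltP x r; first by left; split => //=; right.
  by right; rewrite /= in_itv/= rx xr.
have phic : continuous phi.
  move=> r; apply/cvgrPdist_le => e e0; apply/nbhs_ballP; exists e => //= r' /ltW rr'.
  apply: le_trans rr'; have [h|/ltW h] := leP r r'.
    have /andP[h1 h2] := lip _ _ h.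
    by rewrite distrC (distrC r) !ger0_norm ?subr_ge0// lerBlDl.
  have /andP[h1 h2] := lip _ _ h.
  by rewrite !ger0_norm ?subr_ge0// lerBlDl.
have [||r] := @IVT R phi 0 c t (ltW c_gt0); first exact: continuous_subspaceT.
  have phi0 : phi 0 <= t by rewrite -lee_fin -phiE lex_set_level.
  have phic' : t <= phi c by rewrite -lee_fin -phiE.
  by rewrite minEle maxEle (le_trans phi0 phic') phi0.
by move=> _ phir; exists v, r; rewrite phiE phir.
Qed.

Definition chain_set (t : R) : set R :=
  let p := xget (0, 0) [set p : R * R | leb (lex_set p.1 p.2) = t%:E] in
  if 0 < t then lex_set p.1 p.2 else set0.

Lemma chain_setE t : 0 < t -> t < c -> exists v r,
  leb (lex_set v r) = t%:E /\ chain_set t = lex_set v r.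
Proof.
move=> t0 tc; have [v [r vr]] := chain_value t0 tc.
pose S := [set p : R * R | leb (lex_set p.1 p.2) = t%:E].
have Sx : S (xget (0, 0) S) by apply: (@xgetI _ (0, 0) S (v, r)).
by exists (xget (0, 0) S).1, (xget (0, 0) S).2; rewrite /chain_set t0.
Qed.

Lemma chain_set_le0 t : t <= 0 -> chain_set t = set0.
Proof. by move=> t0; rewrite /chain_set ltNge t0. Qed.

Lemma chain_set_sub t : chain_set t `<=` D.
Proof. by rewrite /chain_set; case: ifP => // _; exact: lex_set_sub. Qed.

Lemma measurable_chain_set t : 0 <= t -> t < c ->
  measurable (chain_set t : set (lebR R)).
Proof.
rewrite le_eqVlt => /predU1P[<- _|t0 tc]; first by rewrite chain_set_le0//.
by have [v [r [_ ->]]] := chain_setE t0 tc; exact: measurable_lex_set.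
Qed.

Lemma leb_chain_set t : 0 <= t -> t < c -> leb (chain_set t) = t%:E.
Proof.
rewrite le_eqVlt => /predU1P[<- _|t0 tc]; first by rewrite chain_set_le0// measure0.
by have [v [r [e ->]]] := chain_setE t0 tc.
Qed.

Lemma chain_set_mono s t : s <= t -> t < c -> chain_set s `<=` chain_set t.
Proof.
move=> st tc; have [s0|s0] := ltP 0 s; last by rewrite chain_set_le0.
have t0 := lt_le_trans s0 st; have sc := le_lt_trans st tc.
move: st; rewrite le_eqVlt => /predU1P[->//|st].
have [v [r [e ->]]] := chain_setE s0 sc; have [v' [r' [e' ->]]] := chain_setE t0 tc.
have [//|h] := lex_set_total v r v' r'; exfalso.
have := density_le H (measurable_lex_set v' r') (measurable_lex_set v r) h (@lex_set_sub v r).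
by rewrite e e' lee_fin leNgt st.
Qed.

(** Level sets of |f| belong to the chain, hence are nested with [chain_set t]. Integrated over s,
    this makes the integral of |f| over [chain_set t] the largest possible. *)
Lemma leb_chain_set_level s t : 0 <= t -> t < c ->
  leb (chain_set t `&` [set x | s < `|f x|]) = mine t%:E (distr leb D f s).
Proof.
have mlev : measurable (D `&` [set x | s < `|f x|] : set (lebR R)).
  exact: measurable_level H _ mf _.
rewrite le_eqVlt => /predU1P[<- _|t0 tc].
  by rewrite chain_set_le0// set0I measure0 min_l// (distr_ge0 H mf).
have [v [r [e ->]]] := chain_setE t0 tc; rewrite -e.
have -> : lex_set v r `&` [set x | s < `|f x|] = lex_set v r `&` lex_set s 0.
  rewrite lex_set_level; apply/seteqP; split => x [h]; last by case.
  by move=> ?; split => //; split => //; case: h.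
rewrite /distr -lex_set_level in mlev *.
have ms := measurable_lex_set v r; have [h|h] := lex_set_total v r s 0.
  by rewrite setIidl// min_l//; apply: (density_le H) => //; exact: lex_set_sub.
by rewrite setIidr// min_r//; apply: (density_le H) => //; exact: lex_set_sub.
Qed.

Lemma integral_chain_set t : 0 <= t -> t < c ->
  (\int[leb]_(x in chain_set t) `|f x|%:E =
   \int[leb]_(x in oitv 0%R t%:E) rearr leb D f x)%E.
Proof.
move=> t0 tc; have mA := measurable_chain_set t0 tc.
under eq_integral do rewrite -[(`|f _|)%:E]mule1.
have mfA : measurable_fun (chain_set t : set (lebR R)) (fun x => `|f x|%:E).
  apply/measurable_EFinP/L0_abs; apply: measurable_funS mf; last exact: chain_set_sub.
  exact: measurable_oitv.
rewrite layer_cake; [|exact: mA|exact: mfA|exact: measurable_cst|by move=> x _; rewrite lee_fin..].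
have Dc : (leb D <= c%:E)%E by rewrite leb_oitv_fin ?subr0// ltW.
rewrite (integral_rearr_prefix H mf Dc)//; last by rewrite lee_fin ltW.
apply: eq_integral => s _; rewrite integral_cst ?mul1e.
  by rewrite -(leb_chain_set_level s t0 tc); congr leb.
exact: (emeasurable_fun_o_infty mA mfA).
Qed.

End chain.

(** * Testing against step functions *)

Section step_functions.
Context {R : realType}.
Implicit Types (s : seq (R * R)) (A : R -> set R).

Definition step s (x : R) : R := \sum_(p <- s) p.1 * (x < p.2)%R%:R.

Definition step_on A s (x : R) : R := \sum_(p <- s) p.1 * \1_(A p.2) x.

Lemma step_ge0 s x : (forall p, p \in s -> 0 <= p.1) -> 0 <= step s x.
Proof. by move=> h; rewrite /step big_seq sumr_ge0// => p /h p0; rewrite mulr_ge0. Qed.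

Lemma step_on_ge0 A s x : (forall p, p \in s -> 0 <= p.1) -> 0 <= step_on A s x.
Proof.
by move=> h; rewrite /step_on big_seq sumr_ge0// => p /h p0; rewrite mulr_ge0.
Qed.

Lemma step_nincr s x y : (forall p, p \in s -> 0 <= p.1) -> x <= y ->
  step s y <= step s x.
Proof.
move=> h xy; rewrite /step big_seq [leRHS]big_seq ler_sum// => p /h p0.
rewrite ler_wpM2l// ler_nat; case: (ltP y p.2) => // yp.
by rewrite (le_lt_trans xy yp).
Qed.

Lemma step_on_L0 (D : set R) A s : measurable (D : set (lebR R)) ->
  (forall p, p \in s -> measurable (A p.2 : set (lebR R))) -> L0 D (step_on A s).
Proof.
move=> mD; elim: s => [|p s IH] mA.
  rewrite (_ : step_on A [::] = cst 0); first exact: measurable_cst.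
  by apply/funext => x; rewrite /step_on big_nil.
rewrite (_ : step_on A (p :: s) = (fun x => p.1 * \1_(A p.2) x + step_on A s x)); last first.
  by apply/funext => x; rewrite /step_on big_cons.
apply: measurable_funD; last by apply: IH => q qs; apply: mA; rewrite in_cons qs orbT.
apply: measurable_funM; first exact: measurable_cst.
by apply: measurable_indic; apply: mA; rewrite mem_head.
Qed.

Lemma integral_step_on (D : set R) A s f : measurable (D : set (lebR R)) ->
  L0 D f -> (forall p, p \in s -> 0 <= p.1) ->
  (forall p, p \in s -> measurable (A p.2 : set (lebR R)) /\ A p.2 `<=` D) ->
  (\int[leb]_(x in D) `|f x * step_on A s x|%:E =
   \sum_(p <- s) p.1%:E * \int[leb]_(x in A p.2) `|f x|%:E)%E.
Proof.
move=> mD mf; elim: s => [|p s IH] s0 mA.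
  rewrite big_nil; apply: integral0_eq => x _.
  by rewrite /step_on big_nil mulr0 normr0.
have s0' q : q \in s -> 0 <= q.1 by move=> qs; apply: s0; rewrite in_cons qs orbT.
have mA' q : q \in s -> measurable (A q.2 : set (lebR R)) /\ A q.2 `<=` D.
  by move=> qs; apply: mA; rewrite in_cons qs orbT.
have p0 : 0 <= p.1 by apply: s0; rewrite mem_head.
have [mAp ApD] := mA p (mem_head _ _).
rewrite big_cons -(IH s0' mA').
have mabs := L0_abs mf.
have -> : (\int[leb]_(x in A p.2) `|f x|%:E =
    \int[leb]_(x in D) (`|f x| * \1_(A p.2) x)%:E)%E.
  rewrite -[in LHS](setIidr ApD) integral_mkcondr; apply: eq_integral => x _.
  by rewrite patchE indicE; case: ifP => _; rewrite ?mulr1 ?mulr0.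
have mfi : L0 D (fun x => `|f x| * \1_(A p.2) x).
  by apply: L0_mul => //; exact: measurable_indic.
rewrite -(@ge0_integralZl_EFin _ (lebR R) R leb); first last.
- exact: p0.
- exact/measurable_EFinP.
- by move=> x _; rewrite lee_fin mulr_ge0.
- exact: mD.
rewrite -(@ge0_integralD _ (lebR R) R leb); first last.
- apply/measurable_EFinP/L0_abs/L0_mul => //; apply: step_on_L0 => //.
  by move=> q /mA'[].
- by move=> x _; rewrite lee_fin.
- apply/measurable_EFinP; apply: measurable_funM; first exact: measurable_cst.
  exact: mfi.
- by move=> x _; rewrite lee_fin !mulr_ge0.
- exact: mD.
apply: eq_integral => x _; rewrite -EFinD; congr (_%:E).
have h1 := step_on_ge0 A x s0'.
have h2 : 0 <= p.1 * \1_(A p.2) x by rewrite mulr_ge0.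
have -> : step_on A (p :: s) x = p.1 * \1_(A p.2) x + step_on A s x.
  by rewrite /step_on big_cons.
by rewrite !normrM (ger0_norm h1) (ger0_norm (addr_ge0 h2 h1)) mulrDr mulrCA.
Qed.

(* Where [step_on A s] exceeds [step s y], one of the sets [A t] with [t <= y]
   is met. *)
Lemma rearr_step_on_le A s (D D' : set R) (c y : R) : 0 < y ->
  measurable (D : set (lebR R)) ->
  D' `<=` D -> measurable (D' : set (lebR R)) -> leb D' = c%:E ->
  (forall t, 0 <= t -> t < c -> leb (A t) = t%:E /\ measurable (A t : set (lebR R))) ->
  (forall t t', t <= t' -> t' < c -> A t `<=` A t') ->
  (forall t, A t `<=` D') ->
  (forall p, p \in s -> 0 <= p.1 /\ 0 <= p.2 < c) ->
  (rearr leb D (step_on A s) y <= (step s y)%:E)%E.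
Proof.
move=> y0 mD D'D mD' D'c lA mA AD' hs.
have s1 p : p \in s -> 0 <= p.1 by move=> /hs[].
have mS : L0 D (step_on A s).
  by apply: step_on_L0 => // p /hs[_ /andP[p0 pc]]; case: (lA _ p0 pc).
have H := density_leb mD.
rewrite leNgt (rearr_gt H mS) ?step_ge0// -leNgt.
pose B := if y < c then A y else D'.
have [By mB BD] : [/\ (leb B <= y%:E)%E, measurable (B : set (lebR R)) & B `<=` D].
  rewrite /B; case: ltP => [yc|cy].
    have [e m] := lA y (ltW y0) yc; rewrite e; split => //.
    exact: subset_trans D'D.
  by rewrite D'c lee_fin.
apply: le_trans By; apply: (density_le H) => //; first exact: measurable_level H _ mS _.
move=> x [Dx /=]; rewrite ger0_norm; last exact: step_on_ge0.
apply: contraPP => nBx /=; apply/negP; rewrite -leNgt /step_on /step.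
rewrite big_seq [leRHS]big_seq; apply: ler_sum => p ps.
have [p0 /andP[p20 pc]] := hs p ps.
rewrite ler_wpM2l// indicE ler_nat; case: (ltP y p.2) => [_|py]; first by case: (_ \in _).
rewrite memNset// => Ax; apply: nBx; rewrite /B; case: ltP => [yc|_].
  exact: mA py yc _ Ax.
exact: AD' Ax.
Qed.

End step_functions.

(** * Test functions in the unit ball of the Lorentz space *)

Section test_functions.
Context {R : realType}.
Variables (a : \bar R) (w : R -> R).
Hypothesis a_gt0 : (0 < a)%E.
Local Notation I := (oitv 0 a).
Hypothesis w_gt0 : forall t, I t -> 0 < w t.
Hypothesis w_decr : forall s t, I s -> I t -> s <= t -> w t <= w s.
Hypothesis W_fin : forall t, I t -> (wmeas w (oitv 0 t%:E) < +oo)%E.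
Local Notation dom t := (0 <= t /\ below a t).
Local Notation W := (cumul a w).
Local Notation b := (wmeas w I).
Local Notation J := (oitv 0 b).
Variable E : fspace J.
Hypothesis E_bfs : banach_function_space E.
Variable s : seq (R * R).
Hypothesis hs : forall p, p \in s -> 0 <= p.1 /\ dom p.2.
Local Notation Ws := [seq (p.1, W p.2) | p <- s].
Hypothesis Ws_mem : fs_mem E (step Ws).
Hypothesis Ws_le1 : (fs_norm E (step Ws) <= 1)%E.

Let s0 p : p \in s -> 0 <= p.1. Proof. by move=> /hs[]. Qed.

Let Ws0 p : p \in Ws -> 0 <= p.1. Proof. by case/mapP => q /hs[q0 _] ->. Qed.

Lemma step_cumul y : I y -> step Ws (W y) = step s y.
Proof.
move=> [y0 ya]; rewrite /step big_map big_seq [RHS]big_seq; apply: eq_bigr => p /hs[_ dp].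
by rewrite /= (cumul_lt_mono a_gt0 w_gt0 w_decr W_fin y0 ya dp).
Qed.

(** Where g^* exceeds [step s y] one is to the left of y, a set of w-measure at most [W y]. So the
    rearrangement of g^* for w dm is at most [step Ws], and solidity of [E] gives the norm bound. *)
Lemma step_mem_Lambda g : L0 I g ->
  (forall y, I y -> (rearr leb I g y <= (step s y)%:E)%E) ->
  fs_mem (Lambda_space I w E) g /\ (fs_norm (Lambda_space I w E) g <= 1)%E.
Proof.
move=> mg hg.
have Hw := weight_density w_gt0 w_decr.
have gfin y : I y -> rearr leb I g y \is a fin_num.
  move=> Iy; rewrite ge0_fin_numE ?rearr_ge0//.
  by apply: le_lt_trans (hg y Iy) _; exact: ltry.
set G := fine \o rearr leb I g.
have mG : L0 I G by exact: rearr_fine_L0.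
have GE y : I y -> `|G y| <= step s y.
  move=> Iy; rewrite /G /= ger0_norm ?fine_ge0 ?rearr_ge0//.
  by rewrite -lee_fin fineK ?gfin// hg.
have hG u : J u -> (rearr (wmeas w) I G u <= (step Ws u)%:E)%E.
  move=> [u0 ub]; have [y dy Wy] := cumul_onto a_gt0 w_gt0 w_decr W_fin (ltW u0) ub.
  have y0 : 0 < y.
    rewrite lt_neqAle (proj1 dy) andbT; apply/eqP => y0; move: u0.
    by rewrite -Wy -y0 (cumul_0 w_gt0 w_decr) ltxx.
  have Iy : I y by split => //; case: dy.
  rewrite -Wy step_cumul//.
  rewrite leNgt (rearr_gt Hw mG) ?step_ge0// -leNgt.
  rewrite -(cumulE a_gt0 w_gt0 w_decr W_fin (ltW y0) (ltW (proj2 Iy))).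
  apply: (density_le Hw) => //; first exact: measurable_level Hw _ mG _.
    move=> x [Ix /= sG]; split; first by case: Ix.
    rewrite lte_fin ltNge; apply/negP => yx; move: sG.
    by rewrite ltNge (le_trans (GE x Ix))// step_nincr.
  by apply: oitv_dom_sub => //; exact: ltW (proj2 Iy).
have Gfin u : J u -> rearr (wmeas w) I G u \is a fin_num.
  move=> Ju; rewrite ge0_fin_numE ?rearr_ge0//.
  by apply: le_lt_trans (hG u Ju) _; exact: ltry.
have [mem1 norm1] : fs_mem E (fine \o rearr (wmeas w) I G) /\
    (fs_norm E (fine \o rearr (wmeas w) I G) <= fs_norm E (step Ws))%E.
  apply: (bfs_solid E_bfs) => //; first exact: rearr_fine_L0.
  apply: aeW => u Ju; rewrite /= ger0_norm ?fine_ge0 ?rearr_ge0//.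
  rewrite ger0_norm; last exact: step_ge0.
  by rewrite -lee_fin fineK ?hG// Gfin.
split; last exact: le_trans norm1 Ws_le1.
split => //; split; first exact: aeW.
by split => //; split => //; exact: aeW.
Qed.

(** The test function lives on chain sets of f inside [(0,c)], so the rearrangement that appears is
    that of f restricted to [(0,c)]. *)
Lemma step_integral_le_trunc f c : L0 I f -> I c ->
  (forall p, p \in s -> p.2 < c) ->
  (\sum_(p <- s) p.1%:E * \int[leb]_(x in oitv 0%R p.2%:E) rearr leb (oitv 0%R c%:E) f x
   <= kothe_norm (Lambda_space I w E) f)%E.
Proof.
move=> mf [c0 ca] sc; have DI : oitv 0 c%:E `<=` I by apply: oitv_dom_sub => //; exact: ltW.
have mI : measurable (I : set (lebR R)) by exact: measurable_oitv.
have mfD : L0 (oitv 0 c%:E) f by exact: measurable_funS mf.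
pose A := chain_set c f.
have lebD : leb (oitv 0 c%:E) = c%:E by rewrite leb_oitv_fin ?subr0// ltW.
have mg : L0 I (step_on A s).
  by apply: step_on_L0 => // p ps; apply: measurable_chain_set => //;
    [case: (hs ps) => _ []|exact: sc].
have [gmem gnorm] : fs_mem (Lambda_space I w E) (step_on A s) /\
    (fs_norm (Lambda_space I w E) (step_on A s) <= 1)%E.
  apply: step_mem_Lambda => // y [y0 ya].
  apply: (@rearr_step_on_le R A s I (oitv 0 c%:E) c y) => //.
  - by move=> t t0 tc; split; [exact: leb_chain_set|exact: measurable_chain_set].
  - by move=> t t'; exact: chain_set_mono.
  - by move=> t; exact: chain_set_sub.
  - move=> p ps; have [p0 [p20 _]] := hs ps; split => //.
    by rewrite p20 sc.
apply: (@le_trans _ _ (\int[leb]_(x in I) `|f x * step_on A s x|%:E)%E).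
  rewrite integral_step_on//.
    rewrite big_seq [leRHS]big_seq; apply: lee_sum => p ps.
    have [p0 [p20 _]] := hs ps.
    by rewrite integral_chain_set// sc.
  move=> p ps; have [p0 [p20 _]] := hs ps; split.
    by apply: measurable_chain_set => //; exact: sc.
  by apply: subset_trans DI; exact: chain_set_sub.
by apply: ereal_sup_ubound; exists (step_on A s).
Qed.

End test_functions.

Lemma cvg_mine_nd {R : realType} (x l : \bar R) (u : nat -> \bar R) :
  nondecreasing_seq u -> u @ \oo --> l ->
  (fun n => mine x (u n)) @ \oo --> mine x l.
Proof.
move=> nu ul.
have nmu : nondecreasing_seq (fun n => mine x (u n)).
  by move=> m n mn; rewrite le_min !ge_min lexx/= (nu _ _ mn) orbT.
have lE : l = ereal_sup (range u).
  by rewrite -(cvg_lim (@ereal_hausdorff R) ul);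
     apply/cvg_lim => //; exact: ereal_nondecreasing_cvgn.
suff -> : mine x l = ereal_sup (range (fun n => mine x (u n))).
  exact: ereal_nondecreasing_cvgn.
apply/eqP; rewrite eq_le; apply/andP; split; last first.
  apply: ge_ereal_sup => _ [n _ <-]; rewrite le_min !ge_min lexx/=.
  have h : (u n <= l)%E by rewrite lE; apply: ereal_sup_ubound; exists n.
  by rewrite h orbT.
rewrite leNgt; apply/negP; rewrite lt_min => /andP[hx].
rewrite {1}lE => /ereal_sup_gt[_ [n _ <-]] hu.
have : (mine x (u n) <= ereal_sup (range (fun n => mine x (u n))))%E.
  by apply: ereal_sup_ubound; exists n.
by rewrite leNgt lt_min hx hu.
Qed.

(** * Exhaustion of I by finite intervals *)

Section truncation.
Context {R : realType}.
Variables (a : \bar R) (t : nat -> R) (f : R -> R).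
Local Notation I := (oitv 0 a).
Hypothesis nt : nondecreasing_seq t.
Hypothesis It : I = \bigcup_n oitv 0 (t n)%:E.
Hypothesis mf : L0 I f.
Local Notation D n := (oitv 0 (t n)%:E).

Let DI n : D n `<=` I. Proof. by rewrite It => x Dx; exists n. Qed.

Let DD m n : (m <= n)%N -> D m `<=` D n.
Proof.
by move=> mn x [x0 xm]; split => //; apply: lt_le_trans xm _; rewrite lee_fin nt.
Qed.

Let mfD n : L0 (D n) f.
Proof. by apply: measurable_funS (mf); [exact: measurable_oitv|exact: DI]. Qed.

Let H := density_leb (measurable_oitv (0 : R) a).
Let Hn n := density_leb (measurable_oitv (0 : R) (t n)%:E).

Lemma distr_trunc_nd u : nondecreasing_seq (fun n => distr leb (D n) f u).
Proof.
move=> m n mn; apply: (density_le H).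
- exact: measurable_level (Hn m) _ (@mfD m) _.
- exact: measurable_level (Hn n) _ (@mfD n) _.
- by move=> x [/(DD mn)].
- by move=> x [/DI].
Qed.

Lemma distr_trunc_cvg u :
  (fun n => distr leb (D n) f u) @ \oo --> distr leb I f u.
Proof.
rewrite /distr [X in X `&` _]It setI_bigcupl.
apply: (density_cvg H).
- by move=> m n mn; apply/subsetPset => x [/(DD mn)].
- by move=> n; exact: measurable_level (Hn n) _ (@mfD n) _.
- by move=> n x [/DI].
Qed.

(** Written with distribution functions, the integrals are those of min(y, d_n(u)) over u, where the
    distributions d_n of the truncations increase; monotone convergence applies. *)
Lemma integral_rearr_trunc_cvg y : 0 <= y ->
  (\int[leb]_(x in oitv 0%R y%:E) rearr leb (D n) f x)%E @[n --> \oo] -->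
  (\int[leb]_(x in oitv 0%R y%:E) rearr leb I f x)%E.
Proof.
move=> y0.
rewrite (integral_rearr_prefix H mf (leey _) _ (leey _)) ?lee_fin//.
under eq_fun do rewrite (integral_rearr_prefix (Hn _) (@mfD _) (leey _) _ (leey _)) ?lee_fin//.
have -> : (\int[leb]_(u in oitv 0%R +oo) mine y%:E (distr leb I f u) =
  \int[leb]_(u in oitv 0%R +oo) limn (fun n => mine y%:E (distr leb (D n) f u)))%E.
  apply: eq_integral => u _; apply/esym/cvg_lim => //.
  by apply: cvg_mine_nd; [exact: distr_trunc_nd|exact: distr_trunc_cvg].
apply: (@cvg_monotone_convergence _ (lebR R) R leb).
- exact: measurable_oitv.
- move=> n; apply: nincr_measurable => [|u v _ _ uv]; first exact: oitv_interval.
  by rewrite le_min !ge_min lexx/= (distr_le (Hn n) (@mfD n) uv) orbT.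
- move=> n u _; rewrite le_min lee_fin y0/=.
  exact: (distr_ge0 (Hn n) (@mfD n)).
- move=> u _ m n mn; rewrite le_min !ge_min lexx/=.
  by rewrite (distr_trunc_nd u mn) orbT.
Qed.

End truncation.

Section lower_bound.
Context {R : realType}.
Variables (a : \bar R) (w : R -> R).
Hypothesis a_gt0 : (0 < a)%E.
Local Notation I := (oitv 0 a).
Hypothesis w_gt0 : forall t, I t -> 0 < w t.
Hypothesis w_decr : forall s t, I s -> I t -> s <= t -> w t <= w s.
Hypothesis W_fin : forall t, I t -> (wmeas w (oitv 0 t%:E) < +oo)%E.
Local Notation dom t := (0 <= t /\ below a t).
Local Notation W := (cumul a w).
Local Notation b := (wmeas w I).
Local Notation J := (oitv 0 b).
Variable E : fspace J.
Hypothesis E_bfs : banach_function_space E.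
Local Notation Wmap s := [seq (p.1, W p.2) | p <- s].
Local Notation S f := (kothe_norm (Lambda_space I w E) f).

Lemma step_integral_le s f : L0 I f ->
  (forall p, p \in s -> 0 <= p.1 /\ dom p.2) ->
  fs_mem E (step (Wmap s)) -> (fs_norm E (step (Wmap s)) <= 1)%E ->
  (\sum_(p <- s) p.1%:E * \int[leb]_(x in oitv 0%R p.2%:E) rearr leb I f x
   <= S f)%E.
Proof.
move=> mf hs mem norm; have [t [nt ht It]] := oitv_exhaust a_gt0.
have [N hN] : exists N, forall p, p \in s -> p.2 < t N.
  elim: s {mem norm} hs => [_|p s IH hs]; first by exists 0%N.
  have [|N hN] := IH; first by move=> q qs; apply: hs; rewrite in_cons qs orbT.
  have [p0 [p20 pa]] := hs p (mem_head _ _).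
  have [y py ya] := ereal_dense_above pa.
  have : I y by split => //; exact: le_lt_trans py.
  rewrite It => -[m _ [_]]; rewrite lte_fin => ym.
  exists (maxn m N) => q; rewrite in_cons => /predU1P[->|/hN qN].
    by apply: lt_trans py (lt_le_trans ym _); apply: nt; rewrite leq_maxl.
  by apply: lt_le_trans qN _; apply: nt; rewrite leq_maxr.
have lim : (\sum_(p <- s | p \in s) p.1%:E * \int[leb]_(x in oitv 0%R p.2%:E)
      rearr leb (oitv 0%R (t n)%:E) f x)%E @[n --> \oo] -->
    (\sum_(p <- s | p \in s) p.1%:E * \int[leb]_(x in oitv 0%R p.2%:E) rearr leb I f x)%E.
  apply: cvg_nnesum => p /hs[p0 [p20 _]].
    apply: nearW => n; rewrite mule_ge0 ?lee_fin// integral_ge0// => x _.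
    exact: rearr_ge0.
  by apply: cvgeZl => //; exact: integral_rearr_trunc_cvg.
rewrite big_seq -[leLHS](cvg_lim (@ereal_hausdorff R) lim).
apply: lime_le; first by apply/cvg_ex; eexists; exact: lim.
exists N => // n /= Nn; rewrite -big_seq.
apply: (step_integral_le_trunc a_gt0 w_gt0 w_decr W_fin E_bfs hs mem norm mf (ht n)).
by move=> p /hN pN; apply: lt_le_trans pN _; exact: nt.
Qed.

End lower_bound.

Section step_integrals.
Context {R : realType}.
Implicit Type s : seq (R * R).

Lemma step_L0 s (c : \bar R) : (forall p, p \in s -> 0 <= p.1) ->
  L0 (oitv 0 c) (step s).
Proof.
move=> s0; apply: nincr_measurable_fin => [|x y _ _]; first exact: oitv_interval.
exact: step_nincr.
Qed.

(** The right side is concave in the points [p.2], which is what makes averaging of steps work in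
    [chord_sum_le]. *)
Lemma integral_step s u : 0 <= u ->
  (forall p, p \in s -> 0 <= p.1 /\ 0 <= p.2) ->
  (\int[leb]_(y in oitv 0%R u%:E) (step s y)%:E =
   (\sum_(p <- s) p.1 * Num.min u p.2)%:E)%E.
Proof.
move=> u0 hs; pose A t := oitv 0 (Num.min u t)%:E.
have s0 p : p \in s -> 0 <= p.1 by move=> /hs[].
have AD t : A t `<=` oitv 0 u%:E.
  by move=> x [x0 xt]; split => //; apply: lt_le_trans xt _; rewrite lee_fin ge_min lexx.
have -> : (\int[leb]_(y in oitv 0%R u%:E) (step s y)%:E =
    \int[leb]_(y in oitv 0%R u%:E) `|(cst 1%R y) * step_on A s y|%:E)%E.
  apply: eq_integral => y /set_mem[y0 yu]; congr (_%:E).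
  rewrite mul1r ger0_norm; last exact: step_on_ge0.
  apply: eq_bigr => p _; congr (_ * _); rewrite indicE.
  congr (_%:R); congr nat_of_bool; apply/idP/idP => [yp|/set_mem[_]].
    by apply/mem_set; split => //; rewrite lte_fin lt_min yp andbT.
  by rewrite lte_fin lt_min => /andP[].
rewrite integral_step_on//; [|exact: measurable_cst|]; last by move=> p _; split; [exact: measurable_oitv|exact: AD].
rewrite -sumEFin big_seq [RHS]big_seq; apply: eq_bigr => p /hs[p0 p20].
have -> : (\int[leb]_(x in A p.2) `|cst 1%R x|%:E = leb (A p.2))%E.
  transitivity (\int[leb]_(x in A p.2) (cst 1%E) x)%E.
    by apply: eq_integral => x _; rewrite /= normr1.
  by rewrite integral_cst ?mul1e//; exact: measurable_oitv.
by rewrite leb_oitv_fin ?subr0 ?EFinM// le_min u0.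
Qed.

Local Notation co x y := [set` `[x%R, y%R[%R].

(** Upper sums of a decreasing function without the cell [0,c). Leaving that cell out lets the
    matching staircase stay below the function that it approximates, see [staircase_le]. *)
Lemma riemann_le (Q : R -> \bar R) (c : R) (N : nat) : 0 < c ->
  (forall u, 0 < u -> (0 <= Q u)%E) ->
  (forall u v, 0 < u -> u <= v -> (Q v <= Q u)%E) ->
  (\int[leb]_(u in co c (c * N.+1%:R)) Q u <=
   \sum_(i < N) c%:E * Q (c * i.+1%:R)%R)%E.
Proof.
move=> c0 Q0 nQ; elim: N => [|N IH].
  rewrite mulr1 set_itvE integral_set0 big_ord0//.
have mitv x y : measurable (`[x, y[%classic : set (lebR R)).
  by apply: is_interval_measurable_lebR; exact: interval_is_interval.
have cN n : 0 < c * n.+1%:R by rewrite mulr_gt0.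
have mQ x y : 0 < x -> measurable_fun (`[x, y[%classic : set (lebR R)) Q.
  move=> x0; apply: nincr_measurable; first exact: interval_is_interval.
  move=> u v; rewrite /= !in_itv/= => /andP[xu _] _; apply: nQ.
  exact: lt_le_trans xu.
have Q0' x y u : 0 < x -> `[x, y[%classic u -> (0 <= Q u)%E.
  by move=> x0; rewrite /= in_itv/= => /andP[xu _]; apply: Q0; exact: lt_le_trans xu.
have le1 : c <= c * N.+1%:R by rewrite ler_peMr ?(ltW c0)// ler1n.
have le2 : c * N.+1%:R <= c * N.+2%:R by rewrite ler_pM2l// ler_nat.
have -> : `[c, (c * N.+2%:R)[%classic =
    `[c, (c * N.+1%:R)[%classic `|` `[(c * N.+1%:R), (c * N.+2%:R)[%classic :> set R.
  apply/seteqP; split => x /=; rewrite !in_itv/=.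
    move=> /andP[cx xN]; have [h|h] := ltP x (c * N.+1%:R); first by left; rewrite cx.
    by right; rewrite xN.
  move=> [/andP[cx xN]|/andP[Nx xN]].
    by rewrite cx (lt_le_trans xN le2).
  by rewrite xN (le_trans le1 Nx).
rewrite ge0_integral_setU; first last.
- rewrite disj_set2E; apply/eqP/seteqP; split => // x [/=]; rewrite !in_itv/=.
  by move=> /andP[_ h] /andP[h' _]; move: (lt_le_trans h h'); rewrite ltxx.
- by move=> x [|]; apply: Q0'.
- by apply/measurable_funU => //; split; exact: mQ.
- exact: mitv.
- exact: mitv.
rewrite big_ord_recr/=; apply: leeD => //.
have -> : (c%:E * Q (c * N.+1%:R)%R =
    \int[leb]_(u in co (c * N.+1%:R) (c * N.+2%:R)) Q (c * N.+1%:R)%R)%E.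
  rewrite integral_cst; last exact: mitv.
  rewrite -[X in _ = (_ * X)%E]/(lebesgue_measure (co (c * N.+1%:R) (c * N.+2%:R))).
  rewrite lebesgue_measure_itv/= lte_fin ltr_pM2l// ltr_nat ltnSn.
  by rewrite -EFinB -mulrBr -natrB// subSnn mulr1 muleC.
apply: ge0_le_integral.
- exact: mitv.
- by move=> u; apply: Q0'.
- exact: mQ.
- exact: measurable_cst.
- move=> u /=; rewrite in_itv/= => /andP[hu _]; exact: nQ.
Qed.

End step_integrals.

(** * From values of F to points below its chords *)

Section chords.
Context {R : realType}.
Variables (a : \bar R) (w : R -> R).
Hypothesis a_gt0 : (0 < a)%E.
Local Notation I := (oitv 0 a).
Hypothesis w_gt0 : forall t, I t -> 0 < w t.
Hypothesis w_decr : forall s t, I s -> I t -> s <= t -> w t <= w s.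
Hypothesis W_fin : forall t, I t -> (wmeas w (oitv 0 t%:E) < +oo)%E.
Local Notation dom t := (0 <= t /\ below a t).
Local Notation W := (cumul a w).
Local Notation b := (wmeas w I).
Local Notation J := (oitv 0 b).
Variable E : fspace J.
Hypothesis E_fsym : fully_symmetric E.
Local Notation Wmap s := [seq (p.1, W p.2) | p <- s].
Local Notation S f := (kothe_norm (Lambda_space I w E) f).
Variable f : R -> R.
Hypothesis mf : L0 I f.
Hypothesis f_int : forall t, I t ->
  (\int[leb]_(s in oitv 0 t%:E) rearr leb I f s < +oo)%E.
Local Notation F := (rearr_prim a f).

Definition chord_pair (t X : R) (q : R * R * R) : Prop :=
  [/\ dom q.1.1, dom q.1.2, 0 <= q.2 <= 1,
      q.2 * W q.1.1 + (1 - q.2) * W q.1.2 = W t &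
      X <= q.2 * F q.1.1 + (1 - q.2) * F q.1.2].

(** Each step ending at W t is split into two steps ending at W x and W y, with weights l and 1 - l.
    As min(u, .) is concave and W t is the average, the new step function is submajorized by the old
    one, so full symmetry keeps it in the unit ball. *)
Lemma chord_sum_le (s : seq (R * R)) (X : R -> R) :
  (forall p, p \in s -> 0 <= p.1 /\ dom p.2) ->
  fs_mem E (step (Wmap s)) -> (fs_norm E (step (Wmap s)) <= 1)%E ->
  (forall p, p \in s -> exists q, chord_pair p.2 (X p.2) q) ->
  ((\sum_(p <- s) p.1 * X p.2)%:E <= S f)%E.
Proof.
move=> hs mem norm hX.
have [ch hch] : exists ch : R * R -> R * R * R,
    forall p, p \in s -> chord_pair p.2 (X p.2) (ch p).
  exists (fun p => xget (0, 0, 0) (chord_pair p.2 (X p.2))) => p /hX[q hq].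
  exact: xgetI hq.
pose x p := (ch p).1.1; pose y p := (ch p).1.2; pose l p := (ch p).2.
pose s' := flatten [seq [:: (p.1 * l p, x p); (p.1 * (1 - l p), y p)] | p <- s].
have split_sum (V : nmodType) (phi : R * R -> V) : \sum_(q <- s') phi q =
    \sum_(p <- s) (phi (p.1 * l p, x p) + phi (p.1 * (1 - l p), y p)).
  by rewrite /s' big_flatten big_map; apply: eq_bigr => p _; rewrite big_cons big_seq1.
have hs' q : q \in s' -> 0 <= q.1 /\ dom q.2.
  move=> /flattenP[_ /mapP[p ps ->]]; have [p0 _] := hs p ps.
  have [dx dy /andP[l0 l1] _ _] := hch p ps.
  rewrite !inE => /orP[/eqP->|/eqP->] /=; split => //.
    by rewrite mulr_ge0.
  by rewrite mulr_ge0// subr_ge0.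
have Wm (r : seq (R * R)) : (forall p, p \in r -> 0 <= p.1 /\ dom p.2) ->
    forall p, p \in Wmap r -> 0 <= p.1 /\ 0 <= p.2.
  move=> hr _ /mapP[p /hr[p0 [p20 _]] ->]; split => //=.
  exact: cumul_ge0 a_gt0 w_gt0 w_decr W_fin _ p20.
have mL (r : seq (R * R)) : (forall p, p \in r -> 0 <= p.1 /\ dom p.2) ->
    L0 J (step (Wmap r)).
  by move=> /Wm hr; apply: step_L0 => p /hr[].
have rI (r : seq (R * R)) u : (forall p, p \in r -> 0 <= p.1 /\ dom p.2) -> J u ->
    (\int[leb]_(t in oitv 0%R u%:E) rearr leb J (step (Wmap r)) t =
     (\sum_(p <- r) p.1 * Num.min u (W p.2))%:E)%E.
  move=> hr [u0 ub]; have hWr := Wm _ hr.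
  rewrite integral_rearr_nincr; first last.
  - exact: ltW ub.
  - by move=> v v' _ _; apply: step_nincr => p /hWr[].
  - by move=> v _; apply: step_ge0 => p /hWr[].
  by rewrite integral_step ?(ltW u0)// big_map.
have [mem' norm'] : fs_mem E (step (Wmap s')) /\
    (fs_norm E (step (Wmap s')) <= fs_norm E (step (Wmap s)))%E.
  apply: (fsym_submaj E_fsym); [exact: mL|exact: mem|].
  move=> u Ju; rewrite (rI _ _ hs' Ju) (rI _ _ hs Ju) lee_fin split_sum.
  rewrite big_seq [leRHS]big_seq; apply: ler_sum => p ps; have [p0 _] := hs p ps.
  have [_ _ /andP[l0 l1] <- _] := hch p ps; rewrite -!mulrA -mulrDr ler_wpM2l//=.
  rewrite -/(l p) -/(x p) -/(y p) in l0 l1 *; rewrite le_min; apply/andP; split.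
    have h1 : l p * Num.min u (W (x p)) <= l p * u by rewrite ler_wpM2l// ge_min lexx.
    have h2 : (1 - l p) * Num.min u (W (y p)) <= (1 - l p) * u.
      by rewrite ler_wpM2l ?subr_ge0// ge_min lexx.
    by apply: le_trans (lerD h1 h2) _; rewrite -mulrDl addrC subrK mul1r.
  by apply: lerD; rewrite ler_wpM2l ?subr_ge0// ge_min lexx orbT.
have := step_integral_le a_gt0 w_gt0 w_decr W_fin (fsym_bfs E_fsym) mf hs' mem'
  (le_trans norm' norm).
apply: le_trans; rewrite split_sum -sumEFin big_seq [leRHS]big_seq.
apply: lee_sum => p ps; have [p0 _] := hs p ps.
have [[x0 _] [y0 _] _ _ hXp] := hch p ps.
rewrite /= !(rprimE a_gt0 f_int)// -!EFinM -EFinD lee_fin -!mulrA -mulrDr.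
exact: ler_wpM2l.
Qed.

End chords.

(** * The lower bound *)

(** The sum is c times a number of positive multiples of c below r. *)
Lemma staircase_le {R : realType} (c r : R) (N : nat) : 0 < c -> 0 <= r ->
  \sum_(i < N) c * (c * i.+1%:R < r)%R%:R <= r.
Proof.
move=> c0 r0; elim: N => [|N IH]; first by rewrite big_ord0.
rewrite big_ord_recr /=; have [lt|_] := ltP (c * N.+1%:R) r; last first.
  by rewrite mulr0 addr0.
apply: le_trans (ltW lt); rewrite mulr1 -natr1 mulrDr mulr1 lerD2r.
apply: (@le_trans _ _ (\sum_(i < N) c)).
  by apply: ler_sum => i _; rewrite ler_piMr ?(ltW c0)//; case: (_ < _).
by rewrite sumr_const card_ord mulr_natr.
Qed.

Section norm_lower_bound.
Context {R : realType}.
Variables (a : \bar R) (w : R -> R).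
Hypothesis a_gt0 : (0 < a)%E.
Local Notation I := (oitv 0 a).
Hypothesis w_gt0 : forall t, I t -> 0 < w t.
Hypothesis w_decr : forall s t, I s -> I t -> s <= t -> w t <= w s.
Hypothesis W_fin : forall t, I t -> (wmeas w (oitv 0 t%:E) < +oo)%E.
Local Notation dom t := (0 <= t /\ below a t).
Local Notation W := (cumul a w).
Local Notation b := (wmeas w I).
Local Notation J := (oitv 0 b).
Variable E : fspace J.
Hypothesis E_fsym : fully_symmetric E.
Local Notation Wmap s := [seq (p.1, W p.2) | p <- s].
Local Notation S f := (kothe_norm (Lambda_space I w E) f).
Variable f : R -> R.
Hypothesis mf : L0 I f.
Hypothesis f_int : forall t, I t ->
  (\int[leb]_(s in oitv 0 t%:E) rearr leb I f s < +oo)%E.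
Local Notation F := (rearr_prim a f).
Hypothesis has_adm : forall t, 0 < t -> below a t -> exists rho, admissible a F W t rho.
Local Notation kappa := (level_density a w f).
Local Notation k := (slope a F W).

Lemma step_level_le (s : seq (R * R)) :
  (forall p, p \in s -> 0 <= p.1 /\ dom p.2) ->
  fs_mem E (step (Wmap s)) -> (fs_norm E (step (Wmap s)) <= 1)%E ->
  (\sum_(p <- s) p.1%:E * wmeas kappa (oitv 0 p.2%:E) <= S f)%E.
Proof.
move=> hs mem norm.
(* The points of s may be 0, where the majorant is not controlled; its limit 0 is used there. *)
pose G0 t := if 0 < t then majorant a F W t else 0.
have kE t : dom t -> wmeas kappa (oitv 0 t%:E) = (G0 t)%:E.
  move=> [t0 ta]; rewrite /G0; case: ltP => [t_gt0|t_le0].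
    by rewrite (wmeas_level_density a_gt0 w_gt0 w_decr W_fin f_int has_adm).
  rewrite (_ : oitv 0 t%:E = set0) /wmeas ?integral_set0//.
  apply/seteqP; split => // x [x0]; rewrite lte_fin => xt.
  by have := lt_le_trans (lt_trans x0 xt) t_le0; rewrite ltxx.
have -> : (\sum_(p <- s) p.1%:E * wmeas kappa (oitv 0 p.2%:E) =
    (\sum_(p <- s) p.1 * G0 p.2)%:E)%E.
  rewrite -sumEFin big_seq [RHS]big_seq; apply: eq_bigr => p /hs[_ dp].
  by rewrite kE// EFinM.
apply/lee_addgt0Pr => d d0.
pose C := \sum_(p <- s) p.1.
have C0 : 0 <= C by rewrite /C big_seq sumr_ge0// => p /hs[].
(* An error e at each point costs C * e in the sum, which is at most d. *)
pose e := d / (C + 1).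
have e0 : 0 < e by rewrite divr_gt0// ltr_wpDl.
have eC : C * e <= d.
  rewrite /e mulrCA -[leRHS]mulr1 ler_wpM2l ?(ltW d0)//.
  by rewrite ler_pdivrMr ?mul1r ?lerDl// ltr_wpDl.
pose X t := if 0 < t then G0 t - e else 0.
have hX p : p \in s -> exists q, chord_pair a w f p.2 (X p.2) q.
  move=> /hs[_ [t0 ta]]; rewrite /X; case: ltP => [t_gt0|t_le0].
    rewrite /G0 t_gt0.
    have [x [y [l [dx dy l01 Wl hl]]]] := majorant_chord
      (rearr_prim_continuous a_gt0 f_int) (cumul_continuous a_gt0 w_gt0 w_decr W_fin)
      (cumul_0 w_gt0 w_decr) (rearr_prim_nd a_gt0 f_int)
      (cumul_incr a_gt0 w_gt0 w_decr W_fin) has_adm (conj t_gt0 ta) e0.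
    by exists (x, y, l).
  have -> : p.2 = 0 by apply/le_anti; rewrite t_le0 t0.
  exists (0, 0, 1); split => //=; rewrite ?lexx ?ler01 ?subrr ?mul0r ?addr0 ?mul1r//.
  by rewrite (rearr_prim_0 a_gt0 f_int).
have := chord_sum_le a_gt0 w_gt0 w_decr W_fin E_fsym mf f_int hs mem norm hX.
move=> h; apply: (@le_trans _ _ ((\sum_(p <- s) p.1 * X p.2)%:E + d%:E)%E).
  rewrite -EFinD lee_fin; apply: (@le_trans _ _ (\sum_(p <- s) p.1 * X p.2 + C * e)).
    rewrite /C mulr_suml -big_split/= big_seq [leRHS]big_seq.
    apply: ler_sum => p /hs[p0 _]; rewrite -mulrDr ler_wpM2l// /X /G0.
    by case: ltP => _; rewrite ?subrK// add0r ltW.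
  by rewrite lerD2l.
by rewrite leeD2r.
Qed.

Lemma slope_ge0_ereal x : I x -> (0 <= (k x)%:E)%E.
Proof. by move=> Ix; rewrite lee_fin; apply (level_slope_ge0 has_adm Ix). Qed.

Lemma slope_nincr_ereal x y : I x -> I y -> x <= y -> ((k y)%:E <= (k x)%:E)%E.
Proof.
move=> Ix Iy xy; rewrite lee_fin.
apply (level_slope_nincr a_gt0 w_gt0 w_decr W_fin f_int has_adm Ix Iy xy).
Qed.

Lemma level_prefix t : dom t ->
  (\int[leb]_(r in oitv 0%R +oo) mine (W t)%:E (wmeas w (I `&` [set x | r%:E < (k x)%:E]))
   = wmeas kappa (oitv 0%R t%:E))%E.
Proof.
move=> [t0 ta]; have Hw := weight_density w_gt0 w_decr.
rewrite -(cumulE a_gt0 w_gt0 w_decr W_fin t0 (ltW ta)).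
rewrite -(integral_nincr_prefix Hw (ltW ta) slope_nincr_ereal slope_ge0_ereal).
apply: eq_integral => x /set_mem[x0 xt]; rewrite -EFinM level_densityE//.
exact: lt_trans xt ta.
Qed.

Section test.
Variables (khat h : R -> R).
Hypothesis mk : L0 J khat.
(** [khat] stands for the rearrangement of k with respect to w dm; the estimate uses its
    distribution only. *)
Hypothesis distr_khat : forall r, 0 < r ->
  distr leb J khat r = wmeas w (I `&` [set x | r%:E < (k x)%:E]%E).
Hypotheses (Eh : fs_mem E h) (Eh1 : (fs_norm E h <= 1)%E).

Let mh : L0 J h := bfs_meas (fsym_bfs E_fsym) Eh.
Let HJ := density_leb (measurable_oitv (0 : R) b).

Section truncated.
Variable u : R.
Hypotheses (u_gt0 : 0 < u) (ub : (u%:E < b)%E).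
Local Notation D := (oitv 0 u%:E).
Let DJ : D `<=` J.
Proof. by move=> x [x0 xu]; split => //; exact: lt_trans ub. Qed.
Let mhD : L0 D h.
Proof. by apply: measurable_funS mh; [exact: measurable_oitv|exact: DJ]. Qed.
Let mkD : L0 D khat.
Proof. by apply: measurable_funS mk; [exact: measurable_oitv|exact: DJ]. Qed.
Let HD := density_leb (measurable_oitv (0 : R) u%:E).

Let distr_bound s : (distr leb D h s <= u%:E)%E.
Proof.
apply: le_trans (distr_le_total HD mhD s) _.
by rewrite leb_oitv_fin ?subr0// ltW.
Qed.

(** Restricting h to (0,u) with u < b keeps its distribution at most u, below b, hence among the
    values of W. *)
Lemma height_exists s : exists t, dom t /\ distr leb D h s = (W t)%:E.
Proof.
have fin : distr leb D h s \is a fin_num.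
  rewrite ge0_fin_numE; last exact: (distr_ge0 HD mhD).
  by apply: le_lt_trans (distr_bound s) _; exact: ltry.
have [||t dt Wt] := @cumul_onto R a w a_gt0 w_gt0 w_decr W_fin (fine (distr leb D h s)).
- by rewrite fine_ge0//; exact: (distr_ge0 HD mhD).
- by rewrite fineK//; exact: le_lt_trans (distr_bound s) ub.
by exists t; split => //; rewrite Wt fineK.
Qed.

Definition height (s : R) : R :=
  xget 0 [set t | dom t /\ distr leb D h s = (W t)%:E].

Lemma heightP s : dom (height s) /\ distr leb D h s = (W (height s))%:E.
Proof.
have [t ht] := height_exists s.
exact: (@xgetI _ 0 [set t | dom t /\ distr leb D h s = (W t)%:E] t).
Qed.

Definition level_profile (s : R) : \bar R := wmeas kappa (oitv 0 (height s)%:E).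
Local Notation Q := level_profile.

(** Hence the integral of the profile over s is the Hardy-Littlewood bound for h and [khat], while
    each of its values is an integral of k w over an initial interval, to which [step_level_le]
    applies. *)
Lemma level_profileE s : Q s = (\int[leb]_(r in oitv 0%R +oo)
   mine (distr leb D h s) (distr leb J khat r))%E.
Proof.
have [ds ->] := heightP s; rewrite /level_profile -(level_prefix ds).
by apply: eq_integral => r /set_mem[r0 _]; rewrite distr_khat.
Qed.

Lemma level_profile_ge0 s : (0 <= Q s)%E.
Proof.
rewrite level_profileE; apply: integral_ge0 => r _.
by rewrite le_min (distr_ge0 HD mhD) (distr_ge0 HJ mk).
Qed.

Lemma level_profile_nincr s t : s <= t -> (Q t <= Q s)%E.
Proof.
move=> st; rewrite !level_profileE; apply: min_integral_le_inner.
- exact: (distr_ge0 HD mhD).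
- by move=> r _; exact: (distr_ge0 HJ mk).
- by move=> r r' _; exact: (distr_le HJ mk).
- by move=> r r' _; exact: (distr_le HJ mk).
- exact: (distr_le HD mhD).
- by move=> r _; exact: lexx.
Qed.

(** The step function at y counts, with weight c, levels c * (i+1) below h^*(y). So it is at most
    h^*, and therefore submajorized by h. *)
Lemma staircase_mem (c : R) (N : nat) : 0 < c ->
  let s := [seq (c, height (c * i.+1%:R)) | i <- iota 0 N] in
  fs_mem E (step (Wmap s)) /\ (fs_norm E (step (Wmap s)) <= 1)%E.
Proof.
move=> c0 s.
have s0 p : p \in Wmap s -> 0 <= p.1.
  by move=> /mapP[q /mapP[i _ ->] ->] /=; exact: ltW.
have le_h y : J y -> ((step (Wmap s) y)%:E <= rearr leb J h y)%E.
  move=> Jy; have r0 := rearr_ge0 (mu := leb) (D := J) (f := h) y.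
  have [-> | rfin] := eqVneq (rearr leb J h y) +oo%E; first exact: leey.
  have {}rfin : rearr leb J h y \is a fin_num by rewrite ge0_fin_numE// lt_neqAle rfin leey.
  have fr0 : 0 <= fine (rearr leb J h y) by exact: fine_ge0.
  rewrite -(fineK rfin) lee_fin; apply: le_trans (staircase_le N c0 fr0).
  rewrite /step !big_map -{1}(subn0 N) big_mkord; apply: ler_sum => i _ /=.
  rewrite ler_wpM2l ?(ltW c0)// ler_nat; case: ltP => // yW.
  suff -> : c * i.+1%:R < fine (rearr leb J h y) by [].
  have ci : 0 <= c * i.+1%:R by rewrite mulr_ge0// ltW.
  rewrite -lte_fin fineK// (rearr_gt HJ mh)//.
  have [_ e] := heightP (c * i.+1%:R).
  apply: (@lt_le_trans _ _ (distr leb D h (c * i.+1%:R))).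
    by rewrite e lte_fin.
  apply: (density_le HJ).
  - exact: measurable_level HD _ mhD _.
  - exact: measurable_level HJ _ mh _.
  - by move=> z [/DJ].
  - by move=> z [].
have [mem norm] : fs_mem E (step (Wmap s)) /\
    (fs_norm E (step (Wmap s)) <= fs_norm E h)%E.
  apply: (fsym_submaj E_fsym); [exact: step_L0|exact: Eh|move=> x [x0 xb]].
  rewrite integral_rearr_nincr; first last.
  - exact: ltW xb.
  - by move=> v v' _ _; exact: step_nincr.
  - by move=> v _; exact: step_ge0.
  have sub : oitv 0 x%:E `<=` J by move=> y [y0 yx]; split => //; exact: lt_trans xb.
  apply: ge0_le_integral.
  - exact: measurable_oitv.
  - by move=> y _; rewrite lee_fin step_ge0.
  - by apply/measurable_EFinP; exact: step_L0.
  - exact: rearr_measurable.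
  - by move=> y /sub; exact: le_h.
by split => //; exact: le_trans norm Eh1.
Qed.

Lemma riemann_profile (c : R) (N : nat) : 0 < c ->
  (\int[leb]_(x in [set` `[c, (c * N.+1%:R)%R[%R]) Q x <= S f)%E.
Proof.
move=> c0; have [mem norm] := staircase_mem N c0.
pose s := [seq (c, height (c * i.+1%:R)) | i <- iota 0 N].
rewrite -/s in mem norm.
have hs p : p \in s -> 0 <= p.1 /\ dom p.2.
  move=> /mapP[i _ ->]; split; [exact: (ltW c0)|exact: (heightP (c * i.+1%:R)).1].
apply: le_trans (step_level_le hs mem norm).
apply: le_trans (riemann_le N c0 _ _) _.
- by move=> v _; exact: level_profile_ge0.
- by move=> v v' _; exact: level_profile_nincr.
rewrite /s big_map -(big_mkord xpredT (fun i => c%:E * Q (c * i.+1%:R)%R)%E).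
by rewrite /index_iota subn0.
Qed.

Lemma integral_profile_le : (\int[leb]_(s in oitv 0%R +oo) Q s <= S f)%E.
Proof.
pose A n := [set` `[(n.+1%:R^-1 : R), n.+1%:R[%R].
(* Mesh 1/(n+1) with N = n(n+2), for which N + 1 = (n+1)^2: the cells fill [1/(n+1), n+1), so
   refining and exhausting happen together. *)
have AE n : A n = [set` `[(n.+1%:R^-1 : R), n.+1%:R^-1 * ((n * n.+2).+1)%:R[%R].
  rewrite /A (_ : n.+1%:R^-1 * ((n * n.+2).+1)%:R = n.+1%:R :> R)//.
  rewrite (_ : (n * n.+2).+1 = n.+1 * n.+1)%N; last by rewrite !mulnS !mulSn; lia.
  by rewrite natrM mulKf// pnatr_eq0.
have TE : oitv (0 : R) +oo%E = \bigcup_n A n.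
  apply/seteqP; split => x.
    move=> [x0 _]; exists (maxn (Num.bound x) (Num.bound x^-1)) => //.
    rewrite /A /= in_itv/=; apply/andP; split.
      rewrite -[leRHS]invrK lef_pV2 ?posrE ?invr_gt0//.
      apply: le_trans (ltW (archi_boundP (_ : 0 <= x^-1))) _; first by rewrite invr_ge0 ltW.
      by rewrite ler_nat; apply: leqW; rewrite leq_maxr.
    apply: lt_le_trans (archi_boundP (ltW x0)) _.
    by rewrite ler_nat; apply: leqW; rewrite leq_maxl.
  move=> [n _]; rewrite /A /= in_itv/= => /andP[nx _]; split; last exact: ltry.
  by apply: lt_le_trans nx; rewrite invr_gt0.
have A0 n x : A n x -> 0 < x.
  by rewrite /A /= in_itv/= => /andP[nx _]; apply: lt_le_trans nx; rewrite invr_gt0.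
have lim : (\int[leb]_(s in A n) Q s)%E @[n --> \oo] -->
    (\int[leb]_(s in oitv 0%R +oo) Q s)%E.
  rewrite TE; apply: (@ge0_nondecreasing_set_cvg_integral _ (lebR R) R A Q leb).
  - move=> m n mn; apply/subsetPset => x; rewrite /A /= !in_itv/= => /andP[mx xm].
    apply/andP; split; last by apply: lt_le_trans xm _; rewrite ler_nat.
    by apply: le_trans mx; rewrite lef_pV2 ?posrE// ler_nat.
  - by move=> n; apply: is_interval_measurable_lebR; exact: interval_is_interval.
  - move=> n; apply: nincr_measurable; first exact: interval_is_interval.
    by move=> x y _ _; exact: level_profile_nincr.
  - by move=> n x _; exact: level_profile_ge0.
rewrite -[leLHS](cvg_lim (@ereal_hausdorff R) lim).
apply: lime_le; first by apply/cvg_ex; eexists; exact: lim.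
apply: nearW => n; rewrite AE; apply: riemann_profile.
by rewrite invr_gt0.
Qed.

Lemma integral_trunc_le :
  (\int[leb]_(x in D) `|khat x * h x|%:E <= S f)%E.
Proof.
apply: le_trans integral_profile_le.
apply: (@le_trans _ _ (min_integral (distr leb D h) (distr leb D khat))).
  apply: le_trans (hardy_littlewood HD mhD mkD).
  rewrite le_eqVlt; apply/orP; left; apply/eqP; apply: eq_integral => x _.
  by rewrite /= mule1 normrM mulrC EFinM.
have dDJ r : (distr leb D khat r <= distr leb J khat r)%E.
  apply: (density_le HJ).
  - exact: measurable_level HD _ mkD _.
  - exact: measurable_level HJ _ mk _.
  - by move=> z [/DJ].
  - by move=> z [].
apply: le_integral_nincr.
- move=> s t _ st; apply: min_integral_le_inner.
  + exact: (distr_ge0 HD mhD).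
  + by move=> r _; exact: (distr_ge0 HD mkD).
  + by move=> r r' _; exact: (distr_le HD mkD).
  + by move=> r r' _; exact: (distr_le HD mkD).
  + exact: (distr_le HD mhD).
  + by move=> r _; exact: lexx.
- by move=> s t _; exact: level_profile_nincr.
- move=> s _; apply/andP; split.
    apply: integral_ge0 => r _.
    by rewrite le_min (distr_ge0 HD mhD) (distr_ge0 HD mkD).
  rewrite level_profileE; apply: min_integral_le_inner.
  + exact: (distr_ge0 HD mhD).
  + by move=> r _; exact: (distr_ge0 HD mkD).
  + by move=> r r' _; exact: (distr_le HD mkD).
  + by move=> r r' _; exact: (distr_le HJ mk).
  + exact: lexx.
  + by move=> r _; exact: dDJ.
Qed.

End truncated.

Lemma integral_test_le : (\int[leb]_(x in J) `|khat x * h x|%:E <= S f)%E.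
Proof.
have [t [nt ht Jt]] := oitv_exhaust (total_gt0 a_gt0 w_gt0 w_decr W_fin).
have sub n : oitv 0 (t n)%:E `<=` J by rewrite [X in _ `<=` X]Jt => x Dx; exists n.
have lim : (\int[leb]_(x in oitv 0%R (t n)%:E) `|khat x * h x|%:E)%E @[n --> \oo] -->
    (\int[leb]_(x in J) `|khat x * h x|%:E)%E.
  rewrite [X in integral _ X]Jt.
  apply: (@ge0_nondecreasing_set_cvg_integral _ (lebR R) R
    (fun n => oitv 0 (t n)%:E) (fun x => `|khat x * h x|%:E) leb).
  - move=> m n mn; apply/subsetPset => x [x0 xm]; split => //.
    by apply: lt_le_trans xm _; rewrite lee_fin nt.
  - by move=> n; exact: measurable_oitv.
  - move=> n; apply/measurable_EFinP/L0_abs/L0_mul.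
      by apply: measurable_funS mk; [exact: measurable_oitv|exact: sub].
    by apply: measurable_funS mh; [exact: measurable_oitv|exact: sub].
  - by move=> n x _; rewrite lee_fin.
rewrite -[leLHS](cvg_lim (@ereal_hausdorff R) lim).
apply: lime_le; first by apply/cvg_ex; eexists; exact: lim.
by apply: nearW => n; have [t0 tb] := ht n; exact: integral_trunc_le.
Qed.

End test.

End norm_lower_bound.

(** This rests on the completeness of the Lebesgue sigma-algebra: the level function is identified
    with a decreasing function only almost everywhere. *)
Lemma ae_eq_L0 {R : realType} (D : set R) (f g : R -> R) :
  ae_on D (fun t => f t = g t) -> L0 D f -> L0 D g.
Proof.
move=> fg /measurable_EFinP mf; apply/measurable_EFinP.
apply: (@ae_measurable_fun _ (lebR R) R leb completed_lebesgue_measure_is_complete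
  D (EFin \o f)) mf.
by rewrite /ae_on in fg; apply: filterS fg => x fgx Dx; rewrite /= fgx.
Qed.

(** * Consequences of a finite dual norm *)

Section level_duality.
Context {R : realType}.
Variables (a : \bar R) (w : R -> R).
Hypothesis a_gt0 : (0 < a)%E.
Local Notation I := (oitv 0 a).
Hypothesis w_gt0 : forall t, I t -> 0 < w t.
Hypothesis w_decr : forall s t, I s -> I t -> s <= t -> w t <= w s.
Hypothesis W_fin : forall t, I t -> (wmeas w (oitv 0 t%:E) < +oo)%E.
Local Notation dom t := (0 <= t /\ below a t).
Local Notation W := (cumul a w).
Local Notation b := (wmeas w I).
Local Notation J := (oitv 0 b).
Variable E : fspace J.
Hypothesis E_fsym : fully_symmetric E.
Hypothesis E_supp : has_support E.
Local Notation Wmap s := [seq (p.1, W p.2) | p <- s].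
Local Notation Lambda := (Lambda_space I w E).
Local Notation M := (M_space I w (kothe_dual E)).
Local Notation S f := (kothe_norm Lambda f).
Variable f : R -> R.
Hypothesis mf : L0 I f.

(** Here [has_support] enters: some positive multiple of the indicator of (0, W t) lies in the unit
    ball of [E]. *)
Lemma small_step t : I t -> exists2 c, 0 < c &
  fs_mem E (step (Wmap [:: (c, t)])) /\ (fs_norm E (step (Wmap [:: (c, t)])) <= 1)%E.
Proof.
move=> [t0 ta]; have bfs := fsym_bfs E_fsym.
have Wt0 : 0 <= W t by apply: (cumul_ge0 a_gt0 w_gt0 w_decr W_fin); exact: ltW.
have Wtb : ((W t)%:E < b)%E.
  by apply: (cumul_lt a_gt0 w_gt0 w_decr W_fin); split => //; exact: ltW.
have Emem : fs_mem E \1_(oitv 0 (W t)%:E).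
  apply: E_supp; first exact: measurable_oitv.
    by move=> x [x0 xW]; split => //; exact: lt_trans Wtb.
  by rewrite leb_oitv_fin// ltry.
have Nfin := bfs_norm_fin bfs Emem; have N0 := bfs_norm_ge0 bfs Emem.
set N := fine (fs_norm E \1_(oitv 0 (W t)%:E)).
have NN : 0 <= N by rewrite fine_ge0.
have N1 : 0 < N + 1 by rewrite ltr_wpDl.
(* N + 1 rather than N, so that positivity of the norm need not be discussed. *)
exists (N + 1)^-1; first by rewrite invr_gt0.
have c0 : 0 <= (N + 1)^-1 by rewrite invr_ge0 ltW.
have [|||h1 h2] := bfs_solid bfs (f := step (Wmap [:: ((N + 1)^-1, t)]))
   (g := fun x => (N + 1)^-1 * \1_(oitv 0 (W t)%:E) x).
- by apply: step_L0 => p; rewrite inE => /eqP->.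
- exact: bfs_memZ bfs _ _ Emem.
- apply: aeW => x [x0 xb]; rewrite /step big_seq1 /= indicE.
  have [xW|Wx] := ltP x (W t); first by rewrite mem_set.
  by rewrite mulr0 normr0.
split => //; apply: le_trans h2 _; rewrite (bfs_normZ bfs)// -(fineK Nfin) -/N.
by rewrite ger0_norm// -EFinM lee_fin ler_pdivrMl// mulr1 lerDl.
Qed.

Hypothesis S_fin : (S f < +oo)%E.

Lemma dual_int t : I t -> (\int[leb]_(s in oitv 0 t%:E) rearr leb I f s < +oo)%E.
Proof.
move=> It; have [c c0 [mem norm]] := small_step It.
have := @step_integral_le R a w a_gt0 w_gt0 w_decr W_fin E (fsym_bfs E_fsym)
  [:: (c, t)] f mf _ mem norm.
rewrite big_seq1 /= => h.
rewrite ltey; apply/eqP => e; move: S_fin; rewrite ltNge => /negP; apply.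
apply: le_trans (h _); first by rewrite e gt0_muley.
by move=> p; rewrite inE => /eqP ->; split; [exact: ltW|case: It => /ltW].
Qed.

(** Without an admissible slope there are arbitrarily steep chords from 0 passing above t. Testing
    with a single step at t then shows that c * rho * W t <= S for every rho >= 0. *)
Lemma dual_adm t : 0 < t -> below a t -> exists rho, admissible a (rearr_prim a f) W t rho.
Proof.
move=> t0 ta; apply: contrapT => nadm; have It : I t by [].
have dt : dom t by split => //; exact: ltW.
have [c c0 [mem norm]] := small_step It.
have f_int := dual_int.
have Wt : 0 < W t.
  rewrite -(cumul_0 w_gt0 w_decr) (cumul_incr a_gt0 w_gt0 w_decr W_fin)//.
have S0 : (0 <= S f)%E.
  have := @step_integral_le R a w a_gt0 w_gt0 w_decr W_fin E (fsym_bfs E_fsym)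
    [:: (c, t)] f mf _ mem norm.
  rewrite big_seq1 /= => h; apply: le_trans (h _).
    by rewrite mule_ge0 ?lee_fin ?(ltW c0)// integral_ge0// => x _; exact: rearr_ge0.
  by move=> p; rewrite inE => /eqP ->; split; [exact: ltW|exact: dt].
have Sf : S f \is a fin_num by rewrite ge0_fin_numE.
(* Chosen so that c * rho * W t = S f + 1. *)
pose rho := (fine (S f) + 1) / (c * W t).
have rho0 : 0 <= rho.
  by rewrite divr_ge0 ?addr_ge0 ?fine_ge0// mulr_ge0// ltW.
have [s [ds ts hs]] := unbounded_chords (rearr_prim_continuous a_gt0 f_int)
  (cumul_continuous a_gt0 w_gt0 w_decr W_fin) (rearr_prim_0 a_gt0 f_int)
  (cumul_0 w_gt0 w_decr) (conj t0 ta) nadm rho0.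
have Ws : W t < W s by apply: (cumul_incr a_gt0 w_gt0 w_decr W_fin).
have Ws0 : 0 < W s := lt_trans Wt Ws.
have := @chord_sum_le R a w a_gt0 w_gt0 w_decr W_fin E E_fsym f mf f_int
  [:: (c, t)] (fun x => rho * W x) _ mem norm.
rewrite big_seq1 /= => h.
have : ((c * (rho * W t))%:E <= S f)%E.
  apply: h => p; rewrite inE => /eqP ->; first by split; [exact: ltW|exact: dt].
  (* On the chord from 0 to s the point of abscissa W t has weight W t / W s at s. *)
  exists (0, s, 1 - W t / W s); split => //=.
  - by rewrite subr_ge0 ler_pdivrMr// mul1r (ltW Ws)/= gerBl divr_ge0// ltW.
  - by rewrite (cumul_0 w_gt0 w_decr) mulr0 add0r opprB addrC subrK divfK// gt_eqF.
  - rewrite (rearr_prim_0 a_gt0 f_int) mulr0 add0r opprB addrC subrK.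
    have -> : rho * W t = W t / W s * (rho * W s) by field; rewrite gt_eqF.
    by rewrite ler_wpM2l ?(ltW hs)// divr_ge0// ltW.
rewrite -(fineK Sf) lee_fin /rho mulrCA divfK ?gt_eqF ?mulr_gt0//.
by rewrite gerDl leNgt ltr01.
Qed.

End level_duality.

(** * The theorem *)

Section level_norm.
Context {R : realType}.
Variables (a : \bar R) (w : R -> R).
Hypothesis a_gt0 : (0 < a)%E.
Local Notation I := (oitv 0 a).
Hypothesis w_gt0 : forall t, I t -> 0 < w t.
Hypothesis w_decr : forall s t, I s -> I t -> s <= t -> w t <= w s.
Hypothesis W_fin : forall t, I t -> (wmeas w (oitv 0 t%:E) < +oo)%E.
Local Notation dom t := (0 <= t /\ below a t).
Local Notation W := (cumul a w).
Local Notation b := (wmeas w I).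
Local Notation J := (oitv 0 b).
Variable E : fspace J.
Hypothesis E_fsym : fully_symmetric E.
Hypothesis E_supp : has_support E.
Local Notation Lambda := (Lambda_space I w E).
Local Notation M := (M_space I w (kothe_dual E)).
Local Notation S f := (kothe_norm Lambda f).
Variable f : R -> R.
Hypothesis mf : L0 I f.

Section regular.
Hypothesis f_int : forall t, I t ->
  (\int[leb]_(s in oitv 0 t%:E) rearr leb I f s < +oo)%E.
Local Notation F := (rearr_prim a f).
Hypothesis has_adm : forall t, 0 < t -> below a t -> exists rho, admissible a F W t rho.
Local Notation kappa := (level_density a w f).
Local Notation k := (slope a F W).
Local Notation f0 := (fine \o level_function I w f).

Let Hw := weight_density w_gt0 w_decr.

Let f0_kappa : ae_on I (fun t => kappa t = f0 t).
Proof.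
have := level_function_ae a_gt0 w_gt0 w_decr W_fin mf f_int has_adm.
by rewrite /ae_on; apply: filterS => t h It; rewrite /= (h It).
Qed.

Let kappa_ge0 t : I t -> 0 <= kappa t.
Proof. by move=> [t0 _]; apply (level_density_ge0 w_gt0 has_adm t0). Qed.

Let kappa_nincr s t : I s -> I t -> s <= t -> kappa t <= kappa s.
Proof.
move=> [s0 _] _ st.
apply (level_density_nincr a_gt0 w_gt0 w_decr W_fin f_int has_adm s0 st).
Qed.

Let mkappa : L0 I kappa := nincr_L0 kappa_nincr.

Lemma level_function_L0 : L0 I f0.
Proof. exact: ae_eq_L0 f0_kappa mkappa. Qed.

Lemma rearr_level_function : rearr leb I f0 = rearr leb I kappa.
Proof.
apply: ae_eq_rearr; [exact: measurable_oitv|exact: level_function_L0|exact: mkappa|].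
have := f0_kappa.
by rewrite /ae_on; apply: filterS => t h It; rewrite (h It).
Qed.

Lemma level_function_submaj : submaj I f f0.
Proof.
move=> x [x0 xa]; rewrite rearr_level_function.
rewrite (integral_rearr_nincr kappa_ge0 kappa_nincr (ltW xa)).
rewrite -[leRHS]/(wmeas kappa (oitv 0 x%:E)).
rewrite (wmeas_level_density a_gt0 w_gt0 w_decr W_fin f_int has_adm (conj x0 xa)).
rewrite (rprimE a_gt0 f_int (ltW x0)) lee_fin.
apply (le_majorant (rearr_prim_continuous a_gt0 f_int)
  (cumul_continuous a_gt0 w_gt0 w_decr W_fin) (cumul_0 w_gt0 w_decr)
  (cumul_incr a_gt0 w_gt0 w_decr W_fin) has_adm (conj x0 xa)).
Qed.

Local Notation A := (fine \o rearr_div I w f0).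

Lemma rearr_div_fin t : I t -> rearr_div I w f0 t \is a fin_num.
Proof.
move=> It; rewrite /rearr_div rearr_level_function inver gt_eqF ?w_gt0//.
rewrite fin_numM// ge0_fin_numE ?rearr_ge0//.
exact: le_lt_trans (rearr_nincr_le kappa_ge0 kappa_nincr It) (ltry _).
Qed.

(** [kappa] is decreasing, so it agrees almost everywhere with its own rearrangement, and dividing
    by w leaves k. *)
Lemma rearr_div_ae : ae_on I (fun t => k t = A t).
Proof.
have := rearr_nincr_ae kappa_ge0 kappa_nincr.
rewrite /ae_on; apply: filterS => t h It; rewrite /= /rearr_div rearr_level_function.
rewrite (h It) level_densityE; last by case: It.
by rewrite inver gt_eqF ?w_gt0// -EFinM /= mulfK// gt_eqF ?w_gt0.
Qed.

Let slope_decr s t : I s -> I t -> s <= t -> k t <= k s.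
Proof.
move=> Is It st.
apply (level_slope_nincr a_gt0 w_gt0 w_decr W_fin f_int has_adm Is It st).
Qed.

Let slope_pos t : I t -> 0 <= k t.
Proof. by move=> It; apply (level_slope_ge0 has_adm It). Qed.

Let mk : L0 I k := nincr_L0 slope_decr.

Lemma rearr_div_L0 : L0 I A.
Proof. exact: ae_eq_L0 rearr_div_ae mk. Qed.

Lemma distr_rearr_div r :
  distr (wmeas w) I A r = wmeas w (I `&` [set x | (r%:E < (k x)%:E)%E]).
Proof.
rewrite -(nincr_distr slope_pos (wmeas w) r); apply: (density_ae Hw).
- exact: measurable_level Hw _ rearr_div_L0 _.
- exact: measurable_level Hw _ mk _.
- by move=> x [].
- by move=> x [].
have := rearr_div_ae; rewrite /ae_on; apply: filterS => t h It.
by split => -[_ /= rt]; split => //=; move: rt; rewrite (h It).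
Qed.

Local Notation khat := (fine \o rearr (wmeas w) I A).

(** Write u = W t. As k is decreasing, the set {k > k t} lies in (0,t), of w-measure u, so the
    rearrangement at u is at most k t. *)
Lemma rearr_w_fin u : J u -> rearr (wmeas w) I A u \is a fin_num.
Proof.
move=> [u0 ub]; have [t dt Wt] := cumul_onto a_gt0 w_gt0 w_decr W_fin (ltW u0) ub.
have t0 : 0 < t.
  rewrite lt_neqAle (proj1 dt) andbT; apply/eqP => t0; move: u0.
  by rewrite -Wt -t0 (cumul_0 w_gt0 w_decr) ltxx.
have It : I t by split => //; case: dt.
rewrite ge0_fin_numE ?rearr_ge0//; apply: (@le_lt_trans _ _ (k t)%:E); last exact: ltry.
rewrite leNgt (rearr_gt Hw rearr_div_L0) ?slope_pos// -leNgt distr_rearr_div -Wt.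
rewrite -(cumulE a_gt0 w_gt0 w_decr W_fin (ltW t0) (ltW (proj2 It))).
apply: (density_le Hw).
- apply: downset_measurable (@oitv_interval R 0 a) _.
  by apply: (downset_level (k t)%:E) => x y Ix Iy xy; rewrite lee_fin; exact: slope_decr.
- exact: measurable_oitv.
- move=> x [Ix /=]; rewrite lte_fin => kx; split; first by case: Ix.
  by rewrite lte_fin ltNge; apply/negP => /(slope_decr It Ix); rewrite leNgt kx.
- by apply: oitv_dom_sub => //; exact: ltW (proj2 It).
Qed.

Lemma distr_khat r : 0 < r ->
  distr leb J khat r = wmeas w (I `&` [set x | (r%:E < (k x)%:E)%E]).
Proof.
move=> r0; rewrite -distr_rearr_div.
rewrite -(leb_rearr_level Hw rearr_div_L0 (lexx b) (ltW r0)) /distr.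
congr leb; apply/seteqP; split => u [Ju /= h]; split => //=.
  move: h; rewrite ger0_norm; last by rewrite fine_ge0// rearr_ge0.
  by rewrite -lte_fin fineK// rearr_w_fin.
rewrite ger0_norm; last by rewrite fine_ge0// rearr_ge0.
by rewrite -lte_fin fineK// rearr_w_fin.
Qed.

Lemma level_norm_le : (fs_enorm M (level_function I w f) <= S f)%E.
Proof.
apply: ge_ereal_sup => _ [h [Eh Eh1] <-].
apply: (integral_test_le a_gt0 w_gt0 w_decr W_fin E_fsym mf f_int has_adm _ _ Eh Eh1).
  exact: rearr_fine_L0.
exact: distr_khat.
Qed.

Lemma level_function_mem : (S f < +oo)%E -> fs_emem M (level_function I w f).
Proof.
move=> Sf; split.
  have := level_function_ae a_gt0 w_gt0 w_decr W_fin mf f_int has_adm.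
  by rewrite /ae_on; apply: filterS => t h It; rewrite (h It).
split; first exact: level_function_L0.
split; first by apply: aeW; exact: rearr_div_fin.
split; first exact: rearr_div_L0.
split; first by apply: aeW; exact: rearr_w_fin.
split; first exact: rearr_fine_L0.
exact: le_lt_trans level_norm_le Sf.
Qed.

End regular.

(** If some t had no admissible slope, the level function would be infinite on all of I, which has
    positive measure. *)
Lemma level_mem_regular : level_mem w f M ->
  (forall t, I t -> (\int[leb]_(s in oitv 0 t%:E) rearr leb I f s < +oo)%E) /\
  forall t, 0 < t -> below a t -> exists rho, admissible a (rearr_prim a f) W t rho.
Proof.
move=> [[ffin fint] [f0fin _]].
have f_int t : I t -> (\int[leb]_(s in oitv 0 t%:E) rearr leb I f s < +oo)%E.
  by move=> It; apply: (integrable_lty _ (fint t It)); exact: measurable_oitv.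
split => // t t0 ta; apply: contrapT => nadm.
have oo s : I s -> level_function I w f s = +oo%E.
  move=> Is.
  apply: (level_function_unbounded (rearr_prim_continuous a_gt0 f_int)
    (cumul_continuous a_gt0 w_gt0 w_decr W_fin) (rearr_prim_0 a_gt0 f_int)
    (cumul_0 w_gt0 w_decr) (rearr_prim_nd a_gt0 f_int)
    (cumul_incr a_gt0 w_gt0 w_decr W_fin) a_gt0
    (ratio_end_gt a_gt0 w_gt0 w_decr W_fin f_int) (conj t0 ta) nadm Is).
  exact: w_gt0.
have : leb I = 0%E.
  apply: (measure_negligible (mu := leb)); first exact: measurable_oitv.
  case: f0fin => N [mN N0 sub]; exists N; split => // x Ix; apply: sub => /= h.
  by have := h Ix; rewrite (oo x Ix).
by rewrite leb_oitv0 ?(ltW a_gt0)// => a0; move: a_gt0; rewrite a0 ltxx.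
Qed.

Lemma dual_norm_le g : submaj I f g -> fs_mem M g -> (S f <= fs_norm M g)%E.
Proof.
move=> fg Mg; apply: ge_ereal_sup => _ [h [Lh Lh1] <-].
exact: integral_mul_le_norm.
Qed.

Lemma dual_norm_level : level_mem w f M -> S f = fs_enorm M (level_function I w f).
Proof.
move=> L; have [f_int has_adm] := level_mem_regular L.
apply/eqP; rewrite eq_le level_norm_le// andbT.
apply: dual_norm_le; last by case: L => _ [].
exact: level_function_submaj.
Qed.

Lemma dual_level_mem : (S f < +oo)%E -> level_mem w f M.
Proof.
move=> Sf.
have f_int := dual_int a_gt0 w_gt0 w_decr W_fin E_fsym E_supp mf Sf.
have has_adm := dual_adm a_gt0 w_gt0 w_decr W_fin E_fsym E_supp mf Sf.
split; last exact: level_function_mem.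
split => t It; first by apply: (fstar_fin a_gt0 f_int); case: It.
apply/integrableP; split; first exact: rearr_measurable.
under eq_integral do rewrite gee0_abs ?rearr_ge0//.
exact: f_int.
Qed.

End level_norm.

Theorem corollary6p17 (R : realType) (a b : \bar R) (w : R -> R)
    (a_gt0 : (0 < a)%E)
    (w_gt0 : forall t, oitv 0 a t -> 0 < w t)
    (w_decr : forall s t, oitv 0 a s -> oitv 0 a t -> s <= t -> w t <= w s)
    (W_fin : forall t, oitv 0 a t -> (wmeas w (oitv 0 t%:E) < +oo)%E)
    (b_def : b = wmeas w (oitv 0 a))
    (E : fspace (oitv 0 b))
    (E_fsym : fully_symmetric E) (E_supp : has_support E) :
  let I := oitv 0 a in
  let Lambda := Lambda_space I w E in
  let M := M_space I w (kothe_dual E) in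
  let Q := Q_space I w (kothe_dual E) in
  (forall f : R -> R, L0 I f ->
     ereal_sup [set (\int[leb]_(t in I) `|f t * g t|%:E)%E |
       g in [set g | fs_mem Lambda g /\ (fs_norm Lambda g <= 1)%E]]
     = if `[< level_mem w f M >] then fs_enorm M (level_function I w f)
       else +oo%E) /\
  (forall f : R -> R, fs_mem (kothe_dual Lambda) f ->
     [/\ level_mem w f M, fs_mem Q f,
         fs_norm (kothe_dual Lambda) f = fs_enorm M (level_function I w f) &
         fs_enorm M (level_function I w f) = fs_norm Q f]).
Proof.
subst b => I Lambda M Q.
have level_case f : L0 I f -> level_mem w f M ->
    kothe_norm Lambda f = fs_enorm M (level_function I w f).
  by move=> mf; exact: dual_norm_level.
split=> [f mf|f [mf Sf]].
  case: asboolP => [|nL]; first exact: level_case.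
  (* A finite supremum would already put the level function into [M]. *)
  apply/eqP; rewrite -leye_eq leNgt; apply/negP => Sf; apply: nL.
  exact: dual_level_mem.
have L : level_mem w f M by exact: dual_level_mem.
have [f_int has_adm] := level_mem_regular a_gt0 w_gt0 w_decr W_fin L.
have f0_maj : submaj I f (fine \o level_function I w f).
  exact: level_function_submaj.
have f0_mem : fs_mem M (fine \o level_function I w f) by case: L => _ [].
split => //.
- by split => //; exists (fine \o level_function I w f).
- exact: level_case.
(* The infimum is attained at the level function: every competitor g bounds the dual norm from
   above, and that norm equals the one of the level function. *)
apply/eqP; rewrite eq_le; apply/andP; split; last first.
  by apply: ereal_inf_lbound; exists (fine \o level_function I w f).
apply: le_ereal_inf_tmp => _ [g [Mg fg] <-].
by rewrite -(level_case f mf L); exact: dual_norm_le.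
Qed.
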